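(* Let $(M,\mathcal{T})$ be an ideally triangulated compact $3$-manifold with boundary, all of whose boundary components have negative Euler characteristic. Suppose there exists a hyper-ideal polyhedral metric $l^*\in\mathcal{L}(M,\mathcal{T})$ with zero combinatorial Ricci curvature, i.e. $K_e(l^* )=0$ for all $e\in E$. Then for every initial hyper-ideal polyhedral metric $l_0\in\mathcal{L}(M,\mathcal{T})$, the extended solution of the combinatorial Ricci flow, i.e. the solution $l:[0,+\infty)\to\mathbb{R}^E$ of $\frac{dl_e}{dt}=\widetilde{K}_e(l)$ $(e\in E)$ with $l(0)=l_0$, converges exponentially fast to $l^*$: there are constants $C,c>0$ with $\|l(t)-l^*\|\le Ce^{-ct}$ for all $t\ge 0$.
   Context: Hyper-ideal tetrahedra. A hyper-ideal tetrahedron is a compact convex polyhedron in $\mathbb{H}^3$ diffeomorphic to a truncated Euclidean tetrahedron, with four right-angled hexagonal faces and four triangular faces (vertex triangles $\Delta_1,\dots,\Delta_4$), each triangular face being orthogonal to its three adjacent hexagonal faces. Its six edges are the pairwise intersections of hexagonal faces; $l_{ij}=l_{ji}$ is the length of the edge joining $\Delta_i$ and $\Delta_j$, and $a_{ij}\in(0,\pi)$ is the dihedral angle there. The tetrahedron is determined up to isometry by $(l_{12},\dots,l_{34})$. Let $\mathcal{L}\subset\mathbb{R}^6_{>0}$ be the (open) set of six-tuples that are the edge lengths of a nondegenerate hyper-ideal tetrahedron; $a_{ij}$ is a function on $\mathcal{L}$. Triangulations. An ideally triangulated compact $3$-manifold with boundary $(M,\mathcal{T})$ is a compact $3$-manifold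 $M$ with boundary presented as the quotient of a finite set $T$ of truncated tetrahedra by gluing their hexagonal faces in pairs, so that the vertex triangles give a triangulation of $\partial M$. $E$ is the (finite) set of edges: equivalence classes, under gluing, of the edges arising as intersections of two hexagonal faces. For $l\in\mathbb{R}^E$ and $\sigma\in T$, $l_\sigma\in\mathbb{R}^6$ is the vector of values of $l$ on the six edges of $\sigma$. A hyper-ideal polyhedral metric is an $l\in\mathbb{R}^E_{>0}$ with $l_\sigma\in\mathcal{L}$ for all $\sigma\in T$; $\mathcal{L}(M,\mathcal{T})$ is the set of these. The combinatorial Ricci curvature of $l\in\mathcal{L}(M,\mathcal{T})$ at $e\in E$ is $K_e(l)=2\pi-(\text{sum of all dihedral angles at } e)$, the sum being over all edges of tetrahedra identified to $e$. The combinatorial Ricci flow is $\frac{dl_e}{dt}=K_e(l)$. Extension of angles. For $l\in\mathbb{R}^6_{>0}$ and $\{i,j,k,h\}=\{1,2,3,4\}$ let $\cosh x^i_{jk}=\frac{\cosh l_{ij}\cosh l_{ik}+\cosh l_{jk}}{\sinh l_{ij}\sinh l_{ik}}$ with $x^i_{jk}>0$, and $\phi_{ij}(l)=\frac{\cosh x^i_{jk}\cosh x^i_{jh}-\cosh x^i_{kh}}{\sinh x^i_{jk}\sinh x^i_{jh}}$ (this is symmetric in $i,j$). On $\mathcal{L}$, $\phi_{ij}=\cos a_{ij}$. Extend $a_{ij}$ to $\mathbb{R}^6_{>0}$ by $a_{ij}=0$ where $\phi_{ij}\ge 1$ and $a_{ij}=\pi$ where $\phi_{ij}\le -1$, and then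 continuously to $\mathbb{R}^6_{\ge 0}$. For $l\in\mathbb{R}^6$ put $\widetilde{a}_{ij}(l)=a_{ij}(l^+)$ with $l^+_{ij}=\max\{0,l_{ij}\}$; this is a continuous function on $\mathbb{R}^6$. (Equivalently, $\widetilde a_{ij}(l)=\arccos(\max\{-1,\min\{1,\phi_{ij}(l^+)\}\})$, where, with $c_{ab}=\cosh l_{ab}$, $\phi_{ij}=\frac{c_{ij}(c_{ik}c_{jh}+c_{jk}c_{ih})+c_{jk}c_{jh}+c_{ik}c_{ih}+c_{kh}-c_{ij}^2c_{kh}}{\sqrt{D_{ijk}D_{ijh}}}$ and $D_{abc}=2c_{ab}c_{bc}c_{ac}+c_{ab}^2+c_{bc}^2+c_{ac}^2-1$.) For $l\in\mathbb{R}^E$ (a generalized hyper-ideal polyhedral metric), the generalized combinatorial Ricci curvature at $e\in E$ is $\widetilde{K}_e(l)=2\pi-\sum\widetilde{a}_{ij}(l_\sigma)$, summed over all edges $\{ij\}$ of tetrahedra $\sigma\in T$ identified to $e$. It extends $K_e$ continuously to $\mathbb{R}^E$. The flow $\frac{dl_e}{dt}=\widetilde K_e(l)$ on $\mathbb{R}^E$ has, for each initial value, a unique solution on $[0,+\infty)$; for initial value in $\mathcal{L}(M,\mathcal{T})$ it extends the solution of the combinatorial Ricci flow and is called the extended solution. *)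

(* Defs.v *)
From HB Require Import structures.
From mathcomp Require Import all_boot all_order all_algebra all_fingroup.
From mathcomp Require Import all_classical all_reals all_analysis.
From mathcomp Require Import ring lra.

Set Implicit Arguments.
Unset Strict Implicit.
Unset Printing Implicit Defensive.

Import Order.TTheory GRing.Theory Num.Theory.
Import numFieldNormedType.Exports.

Local Open Scope classical_set_scope.
Local Open Scope ring_scope.

(** * Ideal triangulations

  [T] is the set of truncated tetrahedra; the vertices, equivalently the vertex
  triangles, of each are indexed by ['I_4], and its hexagonal face number [k]
  is the one opposite to vertex [k].  The face [k] of [s] is glued to the face
  [gperm s k k] of [nbr s k], and the vertices [i != k] are matched by
  [i |-> gperm s k i].  The last axiom says that no edge is identified with
  itself with its orientation reversed; the quotient is a manifold with
  boundary exactly in this case (otherwise the midpoint of such an edge has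
  the cone over a projective plane as a neighbourhood). *)

Section FacePairing.
Variables (T : finType) (nbr : T -> 'I_4 -> T) (gperm : T -> 'I_4 -> {perm 'I_4}).

(* [(s, i, j)], with [i != j], is the edge [ij] of [s] oriented from [i] to
   [j]; it is glued to another oriented edge across each of the two faces
   [k != i, j] containing it. *)
Definition edge_glued (x y : T * 'I_4 * 'I_4) : bool :=
  [exists k : 'I_4, [&& k != x.1.2, k != x.2
    & y == (nbr x.1.1 k, gperm x.1.1 k x.1.2, gperm x.1.1 k x.2)]].

Definition unoriented_edge_glued (x y : T * 'I_4 * 'I_4) : bool :=
  edge_glued x y || (y == (x.1.1, x.2, x.1.2)).

End FacePairing.

Record ideal_triangulation (T : finType) := IdealTriangulation {
  nbr : T -> 'I_4 -> T;
  gperm : T -> 'I_4 -> {perm 'I_4};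
  nbrK : forall s k, nbr (nbr s k) (gperm s k k) = s;
  gpermV : forall s k, gperm (nbr s k) (gperm s k k) = (gperm s k)^-1%g;
  no_self_gluing : forall s k, (nbr s k, gperm s k k) <> (s, k);
  no_reversed_edge : forall s i j, i != j ->
    ~~ connect (edge_glued nbr gperm) (s, i, j) (s, j, i) }.

Section Triangulation.
Variables (T : finType) (tri : ideal_triangulation T).
Local Notation nbr := (nbr tri).
Local Notation gperm := (gperm tri).

Definition edge_class (s : T) (i j : 'I_4) : {set T * 'I_4 * 'I_4} :=
  [set y | connect (unoriented_edge_glued nbr gperm) (s, i, j) y]%SET.

Definition edge_classes : {set {set T * 'I_4 * 'I_4}} :=
  [set edge_class x.1.1 x.1.2 x.2
     | x : T * 'I_4 * 'I_4 in [set x | x.1.2 != x.2]%SET]%SET.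

Definition edge := {e : {set T * 'I_4 * 'I_4} | e \in edge_classes}.

(** The boundary: [(s, i)] is the vertex triangle [i] of [s].  It has the three
  sides [(s, i, k)], [k != i], lying on the hexagonal faces [k], and the three
  vertices [(s, i, j)], [j != i], lying on the edges [ij]. *)

Definition triangle_glued (x y : T * 'I_4) : bool :=
  [exists k : 'I_4, (k != x.2) && (y == (nbr x.1 k, gperm x.1 k x.2))].

Definition boundary_component (x : T * 'I_4) : {set T * 'I_4} :=
  [set y | connect triangle_glued x y]%SET.

Definition side_glued (x y : T * 'I_4 * 'I_4) : bool :=
  y == (nbr x.1.1 x.2, gperm x.1.1 x.2 x.1.2, gperm x.1.1 x.2 x.2).

Definition boundary_vertices (C : {set T * 'I_4}) :
    {set {set T * 'I_4 * 'I_4}} :=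
  [set [set y | connect (edge_glued nbr gperm) x y]%SET
     | x : T * 'I_4 * 'I_4 in [set x | (x.1 \in C) && (x.1.2 != x.2)]%SET]%SET.

Definition boundary_sides (C : {set T * 'I_4}) :
    {set {set T * 'I_4 * 'I_4}} :=
  [set [set y | connect side_glued x y]%SET
     | x : T * 'I_4 * 'I_4 in [set x | (x.1 \in C) && (x.1.2 != x.2)]%SET]%SET.

Definition euler_char (C : {set T * 'I_4}) : int :=
  #|boundary_vertices C|%:Z - #|boundary_sides C|%:Z + #|C|%:Z.

Definition negative_boundary : Prop :=
  forall x : T * 'I_4, euler_char (boundary_component x) < 0.

End Triangulation.

Section Hyperideal.
Variable R : realType.

Definition cosh (x : R) : R := (expR x + expR (- x)) / 2.
Definition sinh (x : R) : R := (expR x - expR (- x)) / 2.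

(* the nonnegative [x] with [cosh x = y], for [1 <= y] *)
Definition arcosh (y : R) : R := ln (y + Num.sqrt (y ^+ 2 - 1)).

(** * Hyper-ideal tetrahedra, in the hyperboloid model of hyperbolic space *)

Definition mink (x y : 'rV[R]_4) : R :=
  - (x 0 0 * y 0 0) + \sum_(i < 4 | i != 0) x 0 i * y 0 i.

Definition hyperboloid : set 'rV[R]_4 :=
  [set x | mink x x = -1 /\ 0 < x 0 0].

Definition hdist (x y : 'rV[R]_4) : R := arcosh (- mink x y).

(* [hex_normal k] and [tri_normal i] are the outer unit normals of the
   hexagonal face [k] and of the vertex triangle [i]; [corner i j] is the end
   on the vertex triangle [i] of the edge [ij]. *)
Record truncated_tet := TruncatedTet {
  hex_normal : 'I_4 -> 'rV[R]_4;
  tri_normal : 'I_4 -> 'rV[R]_4;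
  corner : 'I_4 -> 'I_4 -> 'rV[R]_4 }.

Definition solid (P : truncated_tet) : set 'rV[R]_4 :=
  [set x | hyperboloid x /\
     forall i, mink x (hex_normal P i) <= 0 /\ mink x (tri_normal P i) <= 0].

(* [tet_corners] gives the combinatorial type: the corner [(i, j)] lies on the
   vertex triangle [i] and on the two hexagonal faces other than [i] and [j],
   and on no other face.  [tet_orthogonal] makes the hexagons right-angled. *)
Record hyperideal_tet (P : truncated_tet) : Prop := HyperidealTet {
  tet_hex_unit : forall i, mink (hex_normal P i) (hex_normal P i) = 1;
  tet_tri_unit : forall i, mink (tri_normal P i) (tri_normal P i) = 1;
  tet_orthogonal : forall i j, i != j ->
    mink (tri_normal P i) (hex_normal P j) = 0;
  tet_corners : forall i j, i != j -> [/\ solid P (corner P i j),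
    forall k, (mink (corner P i j) (tri_normal P k) == 0) = (k == i) &
    forall k, (mink (corner P i j) (hex_normal P k) == 0)
              = (k != i) && (k != j)];
  tet_compact : compact (solid P) }.

(* The two indices other than [i] and [j], for [i != j]. *)
Definition third (i j : 'I_4) : 'I_4 :=
  nth ord0 [seq k <- enum 'I_4 | (k != i) && (k != j)] 0.
Definition fourth (i j : 'I_4) : 'I_4 :=
  nth ord0 [seq k <- enum 'I_4 | (k != i) && (k != j)] 1.

Definition tet_length (P : truncated_tet) (i j : 'I_4) : R :=
  hdist (corner P i j) (corner P j i).

(* the angle, inside [solid P], between the hexagonal faces meeting along [ij] *)
Definition tet_angle (P : truncated_tet) (i j : 'I_4) : R :=
  acos (- mink (hex_normal P (third i j)) (hex_normal P (fourth i j))).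

(* A vector of R^6 is represented by a symmetric function ['I_4 -> 'I_4 -> R],
   the diagonal values of which are irrelevant. *)
Definition tet_lengths (P : truncated_tet) (l : 'I_4 -> 'I_4 -> R) : Prop :=
  hyperideal_tet P /\ forall i j, i != j -> l i j = tet_length P i j.

Definition hyperideal_lengths : set ('I_4 -> 'I_4 -> R) :=
  [set l | exists P, tet_lengths P l].

(* meaningful for [hyperideal_lengths l], which determines the tetrahedron up
   to isometry *)
Definition dihedral (l : 'I_4 -> 'I_4 -> R) (i j : 'I_4) : R :=
  xget 0 [set a | exists P, tet_lengths P l /\ a = tet_angle P i j].

(** * Extended dihedral angles

  For positive [l], [tri_side l i j k] is [x^i_jk], the length of the side of
  the vertex triangle [i] on the hexagonal face containing [i], [j] and [k],
  and [phi_ij = (cosh x^i_jk cosh x^i_jh - cosh x^i_kh)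
                / (sinh x^i_jk sinh x^i_jh)].
  Cancelling the factors [sinh l_ab] gives the expression [phi] below ([phiE]),
  which is continuous for nonnegative [l] as well, so that [ext_angle] is the
  continuous extension of the angle ([ext_angle_continuous]). *)

Definition tri_side (l : 'I_4 -> 'I_4 -> R) (i j k : 'I_4) : R :=
  arcosh ((cosh (l i j) * cosh (l i k) + cosh (l j k))
          / (sinh (l i j) * sinh (l i k))).

Definition phi_disc (l : 'I_4 -> 'I_4 -> R) (a b c : 'I_4) : R :=
  2 * cosh (l a b) * cosh (l b c) * cosh (l a c)
  + cosh (l a b) ^+ 2 + cosh (l b c) ^+ 2 + cosh (l a c) ^+ 2 - 1.

Definition phi (l : 'I_4 -> 'I_4 -> R) (i j k h : 'I_4) : R :=
  (cosh (l i j) * (cosh (l i k) * cosh (l j h) + cosh (l j k) * cosh (l i h))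
   + cosh (l j k) * cosh (l j h) + cosh (l i k) * cosh (l i h) + cosh (l k h)
   - cosh (l i j) ^+ 2 * cosh (l k h))
  / Num.sqrt (phi_disc l i j k * phi_disc l i j h).

Definition clamp (x : R) : R := Num.max (-1) (Num.min 1 x).

(* [acos (clamp x)] is [0] for [1 <= x], [pi] for [x <= -1], and [acos x]
   in between; on [hyperideal_lengths], [phi] is the cosine of [dihedral]. *)
Definition ext_angle (l : 'I_4 -> 'I_4 -> R) (i j : 'I_4) : R :=
  acos (clamp (phi (fun a b => Num.max 0 (l a b)) i j (third i j) (fourth i j))).

Lemma cosh_ge1 (x : R) : 1 <= cosh x.
Proof.
have e0 := expR_gt0 x.
suff : expR x + (expR x)^-1 - 2 >= 0 by rewrite /cosh expRN; lra.
have -> : expR x + (expR x)^-1 - 2 = (expR x - 1) ^+ 2 / expR x.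
  by field; rewrite gt_eqF.
by rewrite divr_ge0 ?sqr_ge0 // ltW.
Qed.

Lemma sinh_sqr (x : R) : sinh x ^+ 2 = cosh x ^+ 2 - 1.
Proof. by rewrite /sinh /cosh expRN; field; rewrite gt_eqF ?expR_gt0. Qed.

Lemma sinh_gt0 (x : R) : 0 < x -> 0 < sinh x.
Proof.
move=> x0; have : expR (- x) < expR x by rewrite ltr_expR; lra.
by rewrite /sinh; lra.
Qed.

Lemma arcoshK (y : R) : 1 <= y -> cosh (arcosh y) = y.
Proof.
move=> y1; rewrite /cosh /arcosh expRN.
have s0 := sqrtr_ge0 (y ^+ 2 - 1).
have s2 : Num.sqrt (y ^+ 2 - 1) ^+ 2 = y ^+ 2 - 1 by rewrite sqr_sqrtr //; nra.
rewrite lnK ?posrE; last by lra.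
move: (Num.sqrt _) s0 s2 => s s0 s2.
have -> : (y + s)^-1 = y - s.
  by apply: (mulfI (_ : y + s != 0)); rewrite ?divff; [lra|lra|nra].
lra.
Qed.

Lemma arcosh_ge0 (y : R) : 1 <= y -> 0 <= arcosh y.
Proof.
move=> y1; apply: ln_ge0; have := sqrtr_ge0 (y ^+ 2 - 1); lra.
Qed.

Lemma sinh_arcosh (y : R) : 1 <= y -> sinh (arcosh y) = Num.sqrt (y ^+ 2 - 1).
Proof.
move=> y1; rewrite -[in RHS](arcoshK y1) -sinh_sqr sqrtr_sqr ger0_norm //.
have := arcosh_ge0 y1; rewrite le_eqVlt => /predU1P[<-|/sinh_gt0/ltW//].
by rewrite /sinh oppr0 subrr mul0r.
Qed.

Lemma phi_disc_gt0 (l : 'I_4 -> 'I_4 -> R) (a b c : 'I_4) :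
  0 < phi_disc l a b c.
Proof.
rewrite /phi_disc.
move: (cosh_ge1 (l a b)) (cosh_ge1 (l b c)) (cosh_ge1 (l a c)).
move: (cosh _) (cosh _) (cosh _) => x y z x1 y1 z1.
have xy1 : 1 <= x * y by nra.
have : 1 <= x * y * z by nra.
nra.
Qed.

Lemma phiE (l : 'I_4 -> 'I_4 -> R) (i j k h : 'I_4) :
  0 < l i j -> 0 < l i k -> 0 < l i h ->
  phi l i j k h =
    (cosh (tri_side l i j k) * cosh (tri_side l i j h) - cosh (tri_side l i k h))
    / (sinh (tri_side l i j k) * sinh (tri_side l i j h)).
Proof.
move=> ij ik ih.
have side1 (a b c : R) : 0 < a -> 0 < b ->
    1 <= (cosh a * cosh b + cosh c) / (sinh a * sinh b).
  move=> /sinh_gt0 sa /sinh_gt0 sb.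
  rewrite ler_pdivlMr; last by rewrite mulr_gt0.
  rewrite mul1r.
  have := cosh_ge1 c; have := cosh_ge1 a; have := cosh_ge1 b.
  have : sinh a <= cosh a by rewrite /sinh /cosh; have := expR_gt0 (- a); lra.
  have : sinh b <= cosh b by rewrite /sinh /cosh; have := expR_gt0 (- b); lra.
  nra.
have disc a b c : 0 < l a b -> 0 < l a c ->
    sinh (tri_side l a b c)
    = Num.sqrt (phi_disc l a b c) / (sinh (l a b) * sinh (l a c)).
  move=> ab ac; rewrite sinh_arcosh ?side1 //.
  have sab := sinh_gt0 ab; have sac := sinh_gt0 ac.
  have s0 : 0 < sinh (l a b) * sinh (l a c) by rewrite mulr_gt0.
  apply: (mulIf (_ : sinh (l a b) * sinh (l a c) != 0)); first by rewrite gt_eqF.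
  rewrite divfK ?gt_eqF //.
  rewrite -[X in _ * X = _]ger0_norm ?ltW // -sqrtr_sqr -sqrtrM; last first.
    have := side1 _ _ (l b c) ab ac; nra.
  congr Num.sqrt.
  rewrite mulrBl mul1r -exprMn divfK ?gt_eqF // exprMn !sinh_sqr /phi_disc; ring.
rewrite !disc // /tri_side !arcoshK ?side1 // /phi.
rewrite sqrtrM; last exact/ltW/phi_disc_gt0.
have p0 : 0 < Num.sqrt (phi_disc l i j k) by rewrite sqrtr_gt0 phi_disc_gt0.
have q0 : 0 < Num.sqrt (phi_disc l i j h) by rewrite sqrtr_gt0 phi_disc_gt0.
have a0 := sinh_gt0 ij; have b0 := sinh_gt0 ik; have c0 := sinh_gt0 ih.
have a2 := sinh_sqr (l i j); rewrite /= in a2.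
set p := Num.sqrt (phi_disc l i j k) in p0 *.
set q := Num.sqrt (phi_disc l i j h) in q0 *.
set a := sinh (l i j) in a0 a2 *; set b := sinh (l i k) in b0 *.
set c := sinh (l i h) in c0 *.
have -> : forall x y z, x / (a * b) * (y / (a * c)) - z / (b * c)
    = (x * y - a ^+ 2 * z) / (a ^+ 2 * (b * c)).
  by move=> x y z; field; rewrite !gt_eqF.
have -> : p / (a * b) * (q / (a * c)) = p * q / (a ^+ 2 * (b * c)).
  by field; rewrite !gt_eqF.
have simp (x y : R) : x = y ->
    x / (p * q) = y / (a ^+ 2 * (b * c)) / (p * q / (a ^+ 2 * (b * c))).
  by move=> ->; field; rewrite !gt_eqF.
apply: simp.
rewrite a2; ring.
Qed.

Lemma clamp_itv (x : R) : -1 <= clamp x <= 1.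
Proof. by rewrite /clamp le_max lexx /= ge_max ge_min lexx /= andbT; lra. Qed.

Lemma clamp_ge1 (x : R) : 1 <= x -> clamp x = 1.
Proof. by move=> x1; rewrite /clamp (min_idPl x1); apply/max_idPr; lra. Qed.

Lemma clamp_leN1 (x : R) : x <= -1 -> clamp x = -1.
Proof.
by move=> x1; apply/max_idPl; rewrite ge_min x1 orbT.
Qed.

Lemma clamp_id (x : R) : -1 <= x <= 1 -> clamp x = x.
Proof. by case/andP=> x1 x2; rewrite /clamp (min_idPr x2); apply/max_idPr. Qed.

Lemma acos_clamp_continuous : continuous (fun x : R => acos (clamp x)).
Proof.
have cacos : {within `[-1, 1], continuous (@acos R)}.
  have := @segment_can_ge_continuous R 0 pi (@cos R) (@acos R).
  rewrite cos0 cospi; apply.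
  - exact: pi_ge0.
  - by apply/continuous_subspaceT => ?; exact: continuous_cos.
  - by move=> x; apply: cosK.
have cclamp : continuous clamp.
  move=> x; apply: (@continuous_max R R (fun=> -1) (Num.min 1)).
    exact: cst_continuous.
  apply: (@continuous_min R R (fun=> 1) id); first exact: cst_continuous.
  exact: cvg_id.
move=> x; have /subspace_continuousP/(_ (clamp x)) := cacos.
rewrite /= in_itv /= clamp_itv => /(_ isT) cx.
apply: cvg_trans cx => A /= cA.
have {}cA := cclamp x _ cA.
rewrite !nbhs_simpl /= in cA *.
by apply: filterS cA => y /=; apply; rewrite in_itv /= clamp_itv.
Qed.

Lemma ext_angle_continuous (i j : 'I_4) :
  continuous (fun l : 'M[R]_4 => ext_angle (fun a b => l a b) i j).
Proof.
have ccosh : continuous cosh.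
  move=> x; apply: cvgMl; apply: cvgD; first exact: continuous_expR.
  apply: (@continuous_comp _ _ _ -%R expR); last exact: continuous_expR.
  exact: opp_continuous.
move=> l; rewrite /ext_angle; move: (third i j) (fourth i j) => k h.
apply: (@continuous_comp _ _ _
  (fun m : 'M[R]_4 => phi (fun a b => Num.max 0 (m a b)) i j k h)
  (fun x => acos (clamp x))); last exact: acos_clamp_continuous.
have c a b : (fun m : 'M[R]_4 => cosh (Num.max 0 (m a b))) @ l
    --> cosh (Num.max 0 (l a b)).
  apply: (@continuous_comp _ _ _ (fun m : 'M[R]_4 => Num.max 0 (m a b)) cosh);
    last exact: ccosh.
  apply: (@continuous_max _ _ (fun=> 0) (fun m : 'M[R]_4 => m a b)).
    exact: cst_continuous.
  exact: coord_continuous.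
have cdisc a b d :
    (fun m : 'M[R]_4 => phi_disc (fun a b => Num.max 0 (m a b)) a b d) @ l
    --> phi_disc (fun a b => Num.max 0 (l a b)) a b d.
  have c2 := @cvg_cst R 2 _ (nbhs l) (nbhs_filter l).
  have c1 := @cvg_cst R 1 _ (nbhs l) (nbhs_filter l).
  exact: (cvgB (cvgD (cvgD (cvgD
    (cvgM (cvgM (cvgM c2 (c a b)) (c b d)) (c a d))
    (cvgM (c a b) (c a b))) (cvgM (c b d) (c b d)))
    (cvgM (c a d) (c a d))) c1).
have cden : (fun m : 'M[R]_4 =>
    (Num.sqrt (phi_disc (fun a b => Num.max 0 (m a b)) i j k
               * phi_disc (fun a b => Num.max 0 (m a b)) i j h))^-1) @ l
    --> (Num.sqrt (phi_disc (fun a b => Num.max 0 (l a b)) i j k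
               * phi_disc (fun a b => Num.max 0 (l a b)) i j h))^-1.
  have ne0 : Num.sqrt (phi_disc (fun a b => Num.max 0 (l a b)) i j k
               * phi_disc (fun a b => Num.max 0 (l a b)) i j h) != 0.
    by rewrite gt_eqF // sqrtr_gt0 mulr_gt0 ?phi_disc_gt0.
  have cq : (fun m : 'M[R]_4 =>
      Num.sqrt (phi_disc (fun a b => Num.max 0 (m a b)) i j k
                * phi_disc (fun a b => Num.max 0 (m a b)) i j h)) @ l
      --> Num.sqrt (phi_disc (fun a b => Num.max 0 (l a b)) i j k
                    * phi_disc (fun a b => Num.max 0 (l a b)) i j h).
    have cdd := cvgM (cdisc i j k) (cdisc i j h).
    have cs := @sqrt_continuous R (phi_disc (fun a b => Num.max 0 (l a b)) i j k
                    * phi_disc (fun a b => Num.max 0 (l a b)) i j h).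
    exact: (cvg_comp _ _ (cdd (nbhs_filter l)) cs).
  exact: (cvgV ne0 cq).
exact: (cvgM (cvgB (cvgD (cvgD (cvgD
  (cvgM (c i j) (cvgD (cvgM (c i k) (c j h)) (cvgM (c j k) (c i h))))
  (cvgM (c j k) (c j h))) (cvgM (c i k) (c i h))) (c k h))
  (cvgM (cvgM (c i j) (c i j)) (c k h))) cden).
Qed.

End Hyperideal.

(** * Metrics and curvature *)

Section Curvature.
Variables (R : realType) (T : finType) (tri : ideal_triangulation T).

(* [l_s]; for [i != j] the class of [(s, i, j)] is an edge. *)
Definition tet_restrict (l : edge tri -> R) (s : T) (i j : 'I_4) : R :=
  if insub (edge_class tri s i j) is Some e then l e else 0.

Definition hyperideal_metric (l : edge tri -> R) : Prop :=
  (forall e, 0 < l e) /\ (forall s, hyperideal_lengths (tet_restrict l s)).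

Definition angle_sum (angle : ('I_4 -> 'I_4 -> R) -> 'I_4 -> 'I_4 -> R)
    (l : edge tri -> R) (e : edge tri) : R :=
  \sum_(s : T) \sum_(i < 4)
    \sum_(j < 4 | (i < j)%N && (edge_class tri s i j == val e))
      angle (tet_restrict l s) i j.

(* meaningful for [hyperideal_metric l] *)
Definition curvature (l : edge tri -> R) (e : edge tri) : R :=
  2 * pi - angle_sum (@dihedral R) l e.

Definition ext_curvature (l : edge tri -> R) (e : edge tri) : R :=
  2 * pi - angle_sum (@ext_angle R) l e.

(* the derivative at [t = 0] is one-sided *)
Definition extended_ricci_flow (l : R -> edge tri -> R) : Prop :=
  forall t : R, 0 <= t -> forall e : edge tri,
    (l s e - l t e) / (s - t) @[s --> within `[0, +oo[ t^'] -->
      ext_curvature (l t) e.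

Definition edge_norm (x : edge tri -> R) : R :=
  Num.sqrt (\sum_(e : edge tri) x e ^+ 2).

End Curvature.

(* Main.v *)
(** For the lengths [l] of a tetrahedron let [G] be the Gram matrix of the normals
  of its vertex triangles, with entries [1] and [- cosh l_ij].  The extended
  cosine [phi_ij] is the quotient of the cofactor [G_kh] by the geometric mean of
  the minors [G_kk] and [G_hh], and [1 - phi_ij ^+ 2] is [- det G * sinh l_ij ^+ 2]
  divided by the product of these minors.  So for positive [l] either [det G < 0]
  and all angles are smooth, or all of them are [0] or [pi].

  Where [det G < 0], the derivative of [sum_ij a_ij u_ij] in the direction [u] is
  a quadratic form in [u], which after rescaling depends only on the angles.  It
  is nondegenerate, as a deformation fixing the angles is trivial; multiplying
  all angles by [t] preserves the angle conditions at the vertices, and for small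
  [t] the form is diagonally dominant, so it is positive definite.  Hence
  [sum_ij a_ij u_ij] is a continuous function on each line in direction [u], and
  increases except where it takes one of finitely many values: the angles are
  monotone on [R^6], strongly so near the zero curvature metric.  Therefore the
  squared distance to this metric decreases exponentially along the flow. *)

Require Import Defs.
From mathcomp Require Import all_boot all_order all_algebra all_fingroup.
From mathcomp Require Import all_classical all_reals all_analysis.
From mathcomp Require Import ring lra.

Set Implicit Arguments.
Unset Strict Implicit.
Unset Printing Implicit Defensive.

Import Order.TTheory GRing.Theory Num.Theory.
Import numFieldNormedType.Exports.

Local Open Scope classical_set_scope.
Local Open Scope ring_scope.

(** * The quadratic form of the angles *)

(** The derivative of every angle carries the same factor [1 / sqrt (- det G)]. It is common to the
    six angles, which is why one quadratic form governs them all, but it is unbounded at the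
    boundary of the nondegenerate set, and nothing controls how a segment meets that boundary.
    Monotonicity is therefore read off from values instead of by integrating the slope: a decrease
    would have to cross an intermediate level that no flat configuration attains, and at the last
    crossing the slope is positive. The algebra rests on Jacobi's identity: 2x2 minors of the
    adjugate of G are [det G] times the complementary minors. It turns cofactors into cosines of
    angles, and it makes each vertex link a hyperbolic triangle, which is where the angle conditions
    at the vertices come from. Strong monotonicity is available only near the zero curvature metric.
    Farther out along a ray the gain already made is merely kept, so the rate depends on the radius
    of the ball in which the flow stays. Plain monotonicity must confine the flow to a ball before a
    rate can be named. *)

Section AngleForm.
Variable R : realType.
Implicit Types (x y z : R).

(* For the Gram matrix with diagonal entries [1] and off-diagonal entries [- a_ij]
   (see [gram4] and [gram4_adj]), [gram_det] is the determinant, [- face_disc] a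
   principal 3x3 minor, and [cofac] with first argument [a_ij] the [(k, h)]
   cofactor, where [{i, j, k, h}] are the four indices. *)
Definition face_disc (x y z : R) : R :=
  2 * x * y * z + x ^+ 2 + y ^+ 2 + z ^+ 2 - 1.

Definition cofac (ij ik ih jk jh kh : R) : R :=
  ij * (ik * jh + jk * ih) + jk * jh + ik * ih + kh - ij ^+ 2 * kh.

Definition gram_det (a12 a13 a14 a23 a24 a34 : R) : R :=
  1 - a12 ^+ 2 - a13 ^+ 2 - a14 ^+ 2 - a23 ^+ 2 - a24 ^+ 2 - a34 ^+ 2
  + (a12 * a34) ^+ 2 + (a13 * a24) ^+ 2 + (a14 * a23) ^+ 2
  - 2 * (a12 * a13 * a23 + a12 * a14 * a24 + a13 * a14 * a34 + a23 * a24 * a34)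
  - 2 * (a12 * a23 * a34 * a14 + a12 * a24 * a34 * a13 + a13 * a23 * a24 * a14).

(** The arguments are cofactors, not lengths. By [cofac_sqr] the denominator is then
    [- det G * sinh l_ij ^+ 2]; once the discriminants are normalised to 1 it becomes the squared
    sine of the dihedral angle. *)
Definition qdiag (ij ik ih jk jh Dk Dh : R) : R :=
  (jh * ik + ih * jk + ij * (jh * ih / Dk + jk * ik / Dh)) / (Dk * Dh - ij ^+ 2).

(* The Jacobian of the angles: for [p_ij] the cofactors, [D_k] the discriminants
   and [e_ij = sinh l_ij * dl_ij], it is [sum_ij da_ij dl_ij] up to a positive
   factor (see [is_derive_angdot]). *)
Definition qform (p12 p13 p14 p23 p24 p34 D1 D2 D3 D4
                  e12 e13 e14 e23 e24 e34 : R) : R :=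
  qdiag p12 p13 p14 p23 p24 D3 D4 * e12 ^+ 2
  + qdiag p13 p12 p14 p23 p34 D2 D4 * e13 ^+ 2
  + qdiag p14 p12 p13 p24 p34 D2 D3 * e14 ^+ 2
  + qdiag p23 p12 p24 p13 p34 D1 D4 * e23 ^+ 2
  + qdiag p24 p12 p23 p14 p34 D1 D3 * e24 ^+ 2
  + qdiag p34 p13 p23 p14 p24 D1 D2 * e34 ^+ 2
  + 2 * (e12 * e34 + e13 * e24 + e14 * e23)
  - 2 * (p23 * e12 * e13 + p13 * e12 * e23 + p12 * e13 * e23) / D4
  - 2 * (p24 * e12 * e14 + p14 * e12 * e24 + p12 * e14 * e24) / D3
  - 2 * (p34 * e13 * e14 + p14 * e13 * e34 + p13 * e14 * e34) / D2
  - 2 * (p34 * e23 * e24 + p24 * e23 * e34 + p23 * e24 * e34) / D1.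

(** Jacobi's identity for the 2x2 minor of the adjugate on the rows [k] and [h], whose complementary
    minor is [1 - ij ^+ 2]. It decides whether the cosine of the angle lies strictly between -1 and
    1. *)
Lemma cofac_sqr (ij ik ih jk jh kh : R) :
  face_disc ij jk ik * face_disc ij jh ih - cofac ij ik ih jk jh kh ^+ 2
  = - gram_det ij ik ih jk jh kh * (ij ^+ 2 - 1).
Proof. rewrite /face_disc /cofac /gram_det; ring. Qed.

Lemma qdiag_scale (ri rj rk rh ij ik ih jk jh : R) :
  0 < ri -> 0 < rj -> 0 < rk -> 0 < rh -> 1 - ij ^+ 2 != 0 ->
  qdiag (ij * (rk * rh)) (ik * (rj * rh)) (ih * (rj * rk)) (jk * (ri * rh))
      (jh * (ri * rk)) (rk ^+ 2) (rh ^+ 2) =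
    qdiag ij ik ih jk jh 1 1 * (ri * rj) ^+ 2 / (ri * rj * rk * rh).
Proof.
move=> i0 j0 k0 h0 ne; rewrite /qdiag.
have ne' : rk ^+ 2 * rh ^+ 2 - (ij * (rk * rh)) ^+ 2 != 0.
  rewrite (_ : _ - _ = (1 - ij ^+ 2) * (rk ^+ 2 * rh ^+ 2)); last by ring.
  by rewrite mulf_neq0 // mulf_neq0 // expf_neq0 // gt_eqF.
by field; rewrite -exprMn in ne'; rewrite ne ne' !gt_eqF.
Qed.

(** With [r_k] the square root of the discriminant [D_k], the scaled-down cofactors are cosines of
    dihedral angles. The factors [r_i * r_j] are absorbed by the variables, so positivity need only
    be studied with all discriminants equal to 1. *)
Lemma qform_scale (p12 p13 p14 p23 p24 p34 r1 r2 r3 r4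
                   e12 e13 e14 e23 e24 e34 : R) :
  0 < r1 -> 0 < r2 -> 0 < r3 -> 0 < r4 ->
  1 - p12 ^+ 2 != 0 -> 1 - p13 ^+ 2 != 0 -> 1 - p14 ^+ 2 != 0 ->
  1 - p23 ^+ 2 != 0 -> 1 - p24 ^+ 2 != 0 -> 1 - p34 ^+ 2 != 0 ->
  qform (p12 * (r3 * r4)) (p13 * (r2 * r4)) (p14 * (r2 * r3)) (p23 * (r1 * r4))
      (p24 * (r1 * r3)) (p34 * (r1 * r2)) (r1 ^+ 2) (r2 ^+ 2) (r3 ^+ 2) (r4 ^+ 2)
      e12 e13 e14 e23 e24 e34 =
  qform p12 p13 p14 p23 p24 p34 1 1 1 1
      (e12 * (r1 * r2)) (e13 * (r1 * r3)) (e14 * (r1 * r4))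
      (e23 * (r2 * r3)) (e24 * (r2 * r4)) (e34 * (r3 * r4)) / (r1 * r2 * r3 * r4).
Proof.
move=> r1p r2p r3p r4p n12 n13 n14 n23 n24 n34; rewrite /qform.
have := @qdiag_scale r1 r2 r3 r4 p12 p13 p14 p23 p24 r1p r2p r3p r4p n12 => ->.
have := @qdiag_scale r1 r3 r2 r4 p13 p12 p14 p23 p34 r1p r3p r2p r4p n13.
rewrite (mulrC r3 r2) => ->.
have := @qdiag_scale r1 r4 r2 r3 p14 p12 p13 p24 p34 r1p r4p r2p r3p n14.
rewrite (mulrC r4 r2) (mulrC r4 r3) => ->.
have := @qdiag_scale r2 r3 r1 r4 p23 p12 p24 p13 p34 r2p r3p r1p r4p n23.
rewrite (mulrC r3 r1) (mulrC r2 r1) => ->.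
have := @qdiag_scale r2 r4 r1 r3 p24 p12 p23 p14 p34 r2p r4p r1p r3p n24.
rewrite (mulrC r4 r1) (mulrC r4 r3) (mulrC r2 r1) => ->.
have := @qdiag_scale r3 r4 r1 r2 p34 p13 p23 p14 p24 r3p r4p r1p r2p n34.
rewrite (mulrC r4 r1) (mulrC r4 r2) (mulrC r3 r1) (mulrC r3 r2) => ->.
move: (qdiag p12 _ _ _ _ _ _) (qdiag p13 _ _ _ _ _ _) (qdiag p14 _ _ _ _ _ _)
  (qdiag p23 _ _ _ _ _ _) (qdiag p24 _ _ _ _ _ _) (qdiag p34 _ _ _ _ _ _).
by move=> q12 q13 q14 q23 q24 q34; field; rewrite !gt_eqF.
Qed.

(** Three angles of sum below pi belong to a hyperbolic triangle, and [(cos a + cos b * cos c) /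
    (sin b * sin c)] is the cosh of the side opposite to [a]. *)
Lemma triangle_angles (a b c : R) : 0 < a -> 0 < b -> 0 < c -> a + b + c < pi ->
  sin b * sin c < cos a + cos b * cos c.
Proof.
move=> a0 b0 c0 s.
have : cos (pi - (b + c)) < cos a.
  by rewrite ltr_cos ?in_itv //=; lra.
rewrite cosB cospi sinpi cosD; lra.
Qed.

(* In terms of [X = a13 + a12 a23] and [X' = a14 + a12 a24], the cofactor [12]
   is [X X' + s ^+ 2 (a34 + a23 a24)] and the discriminants of the two faces
   containing [12] are [X ^+ 2 - s ^+ 2 s23 ^+ 2] and [X' ^+ 2 - s ^+ 2 s24 ^+ 2] *)
Lemma gram_det_lt0 (a12 a13 a14 a23 a24 a34 s12 s23 s24 : R) :
  0 < s12 -> 0 <= s23 -> 0 <= s24 ->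
  s12 ^+ 2 = 1 - a12 ^+ 2 -> s23 ^+ 2 = 1 - a23 ^+ 2 -> s24 ^+ 2 = 1 - a24 ^+ 2 ->
  s12 * s23 < a13 + a12 * a23 -> s12 * s24 < a14 + a12 * a24 ->
  s23 * s24 < a34 + a23 * a24 -> gram_det a12 a13 a14 a23 a24 a34 < 0.
Proof.
move=> s12p s23p s24p e12 e23 e24 h3 h4 h34.
have := cofac_sqr a12 a13 a14 a23 a24 a34.
set g := gram_det _ _ _ _ _ _.
have -> : face_disc a12 a23 a13 = (a13 + a12 * a23) ^+ 2 - (s12 * s23) ^+ 2.
  by rewrite /face_disc exprMn e12 e23; ring.
have -> : face_disc a12 a24 a14 = (a14 + a12 * a24) ^+ 2 - (s12 * s24) ^+ 2.
  by rewrite /face_disc exprMn e12 e24; ring.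
have -> : cofac a12 a13 a14 a23 a24 a34 =
   (a13 + a12 * a23) * (a14 + a12 * a24) + s12 ^+ 2 * (a34 + a23 * a24).
  by rewrite /cofac e12; ring.
have -> : a12 ^+ 2 - 1 = - s12 ^+ 2 by rewrite e12; ring.
have t2 : 0 < s12 ^+ 2 by rewrite exprn_gt0.
have u0 : 0 <= s12 * s23 by rewrite mulr_ge0 // ltW.
have v0 : 0 <= s12 * s24 by rewrite mulr_ge0 // ltW.
have : (s12 * s23) * (s12 * s24) < s12 ^+ 2 * (a34 + a23 * a24).
  by rewrite (_ : _ * _ = s12 ^+ 2 * (s23 * s24)) ?ltr_pM2l //; ring.
move: (s12 ^+ 2) (s12 * s24) (s12 * s23) (a14 + _) (a13 + _) (s12 ^+ 2 * (a34 + _))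
  t2 u0 v0 h3 h4 => t v u Y X w t0 u0 v0 uX vY uvw e.
(* The product of the discriminants equals [(X * Y + u * v) ^+ 2 - (X * v + Y * u) ^+ 2], so it
   stays below the square of the cofactor [X * Y + w] as soon as [u * v < w]. *)
have lt : (X * Y + u * v) ^+ 2 < (X * Y + w) ^+ 2.
  have XY : 0 <= X * Y by rewrite mulr_ge0 //; lra.
  have uv : 0 <= u * v by rewrite mulr_ge0.
  by rewrite ltr_pXn2r ?nnegrE //; lra.
have : g * t = (X ^+ 2 - u ^+ 2) * (Y ^+ 2 - v ^+ 2) - (X * Y + w) ^+ 2 by rewrite e; ring.
have -> : (X ^+ 2 - u ^+ 2) * (Y ^+ 2 - v ^+ 2) =
  (X * Y + u * v) ^+ 2 - (X * v + Y * u) ^+ 2 by ring.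
have := sqr_ge0 (X * v + Y * u).
move=> sq gt; have : g * t < 0 by lra.
by rewrite pmulr_llt0.
Qed.

End AngleForm.

(** * Positivity, by deformation to small angles *)

Section Path.
Variables (R : realType) (V : normedModType R).

(** The continuity method: the parameter attains its minimum on the compact set where [f <= 0]. A
    negative value at that parameter would persist slightly earlier, so the slice there is
    nonnegative and touches zero. *)
Lemma first_nonpositive (S : set V) (f : R * V -> R) (a b : R) :
  compact S -> a <= b ->
  (forall t x, a <= t <= b -> S x -> {for (t, x), continuous f}) ->
  (forall x, S x -> 0 < f (a, x)) -> (exists2 x, S x & f (b, x) <= 0) ->
  exists s x, [/\ a < s <= b, S x, f (s, x) = 0 & forall y, S y -> 0 <= f (s, y)].
Proof.
move=> cS ab cf fa [x0 Sx0 fx0].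
set K := `[a, b] `*` S.
have cK : compact K by apply: compact_setX => //; exact: segment_compact.
have clK : closed K by apply: compact_closed => //; exact: norm_hausdorff.
set K0 := K `&` [set p | f p <= 0].
have cK0 : compact K0.
  apply: (@subclosed_compact _ _ K) => // [|p []//].
  move=> p pK0; have Kp : K p by apply: clK => B /pK0[q [[Kq _] Bq]]; exists q.
  split => //=; rewrite leNgt; apply/negP => fp.
  have cp : f x @[x --> p] --> f p.
    by case: p Kp {pK0 fp} => t x [/=]; rewrite in_itv /=; exact: cf.
  have [q [[_ /= fq]]] := pK0 _ (@cvgr_gt _ _ _ _ f _ cp _ fp).
  by rewrite /= ltNge fq.
have K0n : K0 !=set0.
  by exists (b, x0); split => //; split => //=; rewrite in_itv /= ab lexx.
have cfst : {within K0, continuous (fst : R * V -> R)}.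
  by apply: continuous_subspaceT => ?; exact: cvg_fst.
have [[s x] /set_mem[[/=]]] := @compact_EVT_min _ R fst K0 K0n cK0 cfst.
rewrite in_itv /= => /andP[as_ sb] Sx fsx smin.
have lt_as : a < s.
  rewrite lt_neqAle as_ andbT; apply/eqP => e.
  by have := fa _ Sx; rewrite e ltNge fsx.
have nneg y : S y -> 0 <= f (s, y).
  move=> Sy; rewrite leNgt; apply/negP => fy.
  have csy : f (t, y) @[t --> s] --> f (s, y).
    have h : (fun t => (t, y)) @ s --> (s, y).
      exact: (@cvg_pair _ _ _ (nbhs s) (nbhs s) (nbhs y) _ _ _ id (fun=> y)
        (@cvg_id _ _) (@cvg_cst _ y _ (nbhs s) _)).
    by apply: (cvg_comp _ _ h); apply: cf => //; rewrite as_.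
  have : nbhs s (fun t => f (t, y) < 0) by exact: (@cvgr_lt _ _ _ _ _ _ csy _ fy).
  move=> /nbhs_ballP[e /= e0 be].
  pose t := Num.max a (s - e / 2).
  have ts : t < s by rewrite gt_max lt_as /=; lra.
  have [at_ te] : a <= t /\ s - e / 2 <= t by rewrite !le_max !lexx orbT.
  have fty : f (t, y) < 0.
    by apply: be; rewrite /ball /= ger0_norm; lra.
  have : s <= t.
    apply: (smin (t, y)); apply/mem_set; split => /=; last exact/ltW.
    by split => //=; rewrite in_itv /=; lra.
  by rewrite leNgt ts.
exists s, x; split => //; first by rewrite lt_as.
by apply/eqP; rewrite eq_le fsx nneg.
Qed.

End Path.

Section PositiveDefinite.
Variable R : realType.

Definition sym4 (d1 d2 d3 d4 a12 a13 a14 a23 a24 a34 : R) : 'M[R]_4 :=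
  \matrix_(i, j) nth 0 (nth [::] [:: [:: d1; a12; a13; a14]; [:: a12; d2; a23; a24];
    [:: a13; a23; d3; a34]; [:: a14; a24; a34; d4]] i) j.

Lemma sym4_mul (d1 d2 d3 d4 a12 a13 a14 a23 a24 a34 : R) (B : 'M[R]_4) i j :
  (sym4 d1 d2 d3 d4 a12 a13 a14 a23 a24 a34 *m B) i j =
  let r := nth [::] [:: [:: d1; a12; a13; a14]; [:: a12; d2; a23; a24];
    [:: a13; a23; d3; a34]; [:: a14; a24; a34; d4]] i in
  r`_0 * B 0 j + r`_1 * B 1 j + r`_2 * B 2 j + r`_3 * B 3 j.
Proof.
rewrite !mxE !big_ord_recr big_ord0 /= add0r !mxE.
by do ![congr (_ + _)]; congr (_ * B _ _); apply/val_inj.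
Qed.

Definition gram4 (a12 a13 a14 a23 a24 a34 : R) : 'M[R]_4 :=
  sym4 1 1 1 1 (- a12) (- a13) (- a14) (- a23) (- a24) (- a34).

Definition gram4_adj (a12 a13 a14 a23 a24 a34 : R) : 'M[R]_4 :=
  sym4 (- face_disc a23 a34 a24) (- face_disc a13 a34 a14)
    (- face_disc a12 a24 a14) (- face_disc a12 a23 a13)
    (cofac a34 a13 a23 a14 a24 a12) (cofac a24 a12 a23 a14 a34 a13)
    (cofac a23 a12 a24 a13 a34 a14) (cofac a14 a12 a13 a24 a34 a23)
    (cofac a13 a12 a14 a23 a34 a24) (cofac a12 a13 a14 a23 a24 a34).

Lemma mul_gram4_adj (a12 a13 a14 a23 a24 a34 : R) :
  gram4 a12 a13 a14 a23 a24 a34 *m gram4_adj a12 a13 a14 a23 a24 a34 =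
  (gram_det a12 a13 a14 a23 a24 a34)%:M.
Proof.
apply/matrixP => -[[|[|[|[|//]]]] ?] [[|[|[|[|//]]]] ?];
rewrite sym4_mul !mxE -val_eqE /= /face_disc /cofac /gram_det; ring.
Qed.

Lemma mul_adj_gram4 (a12 a13 a14 a23 a24 a34 : R) :
  gram4_adj a12 a13 a14 a23 a24 a34 *m gram4 a12 a13 a14 a23 a24 a34 =
  (gram_det a12 a13 a14 a23 a24 a34)%:M.
Proof.
apply/matrixP => -[[|[|[|[|//]]]] ?] [[|[|[|[|//]]]] ?];
rewrite sym4_mul !mxE -val_eqE /= /face_disc /cofac /gram_det; ring.
Qed.

(* [H E H = D H + H D] yields [E = H^-1 D + D H^-1]; as [E] has zero
   diagonal and the diagonal of [H^-1] has no zero, [D = 0]. *)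
Lemma gram4_rigid (n : nat) (H A : 'M[R]_n) (d : R) (E : 'M[R]_n) (v : 'rV[R]_n) :
  d != 0 -> H *m A = d%:M -> A *m H = d%:M -> (forall i, A i i != 0) ->
  (forall i, E i i = 0) ->
  H *m E *m H = diag_mx v *m H + H *m diag_mx v -> E = 0.
Proof.
move=> d0 HA AH Ad Ed e.
have : A *m (H *m E *m H) *m A = A *m (diag_mx v *m H + H *m diag_mx v) *m A by rewrite e.
rewrite -!mulmxA HA !mulmxA AH mulmxDr mulmxDl.
rewrite mul_scalar_mx mul_mx_scalar !mulmxA AH -!mulmxA HA mul_scalar_mx.
rewrite mulmxA mul_mx_scalar.
move=> e2.
have v0 i : v 0 i = 0.
  have := congr1 (fun M : 'M[R]_n => M i i) e2.
  rewrite mul_mx_diag mul_diag_mx !mxE Ed !mulr0 => /esym/eqP.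
  rewrite (mulrC (v 0 i)) -mulr2n -mulrnAr mulf_eq0 (negbTE d0) /=.
  by rewrite mulrn_eq0 /= mulf_eq0 (negbTE (Ad i)) /= => /eqP.
have vz : v = 0 by apply/rowP => i; rewrite v0 mxE.
move: e2; rewrite vz raddf0 mul0mx mulmx0 !scaler0 addr0 => /eqP.
by rewrite !scaler_eq0 (negbTE d0) /= => /eqP.
Qed.

End PositiveDefinite.

Section PositiveDefinite.
Variable R : realType.

Lemma qdiagE (ij ik ih jk jh : R) : 1 - ij ^+ 2 != 0 ->
  qdiag ij ik ih jk jh 1 1 * (1 - ij ^+ 2) =
  jh * ik + ih * jk + ij * (jh * ih + jk * ik).
Proof. by move=> n; rewrite /qdiag !divr1 mulr1 divfK. Qed.

(** A vector killed by the form is a deformation [E] of the length Gram matrix that fixes all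
    angles. Multiplied by [1 - p ^+ 2], the six equations become the off-diagonal entries of the
    matrix equation of [gram4_rigid], where [H] is the Gram matrix with entries [- p], each placed
    at the pair of indices opposite to its edge. *)
Lemma qform_injective (p12 p13 p14 p23 p24 p34 e12 e13 e14 e23 e24 e34 : R) :
  1 - p12 ^+ 2 != 0 -> 1 - p13 ^+ 2 != 0 -> 1 - p14 ^+ 2 != 0 ->
  1 - p23 ^+ 2 != 0 -> 1 - p24 ^+ 2 != 0 -> 1 - p34 ^+ 2 != 0 ->
  face_disc p12 p13 p14 != 0 -> face_disc p12 p23 p24 != 0 ->
  face_disc p13 p23 p34 != 0 -> face_disc p14 p24 p34 != 0 ->
  gram_det p34 p24 p23 p14 p13 p12 != 0 ->
  qdiag p12 p13 p14 p23 p24 1 1 * e12 + e34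
    - (p23 * e13 + p13 * e23) - (p24 * e14 + p14 * e24) = 0 ->
  qdiag p13 p12 p14 p23 p34 1 1 * e13 + e24
    - (p23 * e12 + p12 * e23) - (p34 * e14 + p14 * e34) = 0 ->
  qdiag p14 p12 p13 p24 p34 1 1 * e14 + e23
    - (p24 * e12 + p12 * e24) - (p34 * e13 + p13 * e34) = 0 ->
  qdiag p23 p12 p24 p13 p34 1 1 * e23 + e14
    - (p13 * e12 + p12 * e13) - (p34 * e24 + p24 * e34) = 0 ->
  qdiag p24 p12 p23 p14 p34 1 1 * e24 + e13
    - (p14 * e12 + p12 * e14) - (p34 * e23 + p23 * e34) = 0 ->
  qdiag p34 p13 p23 p14 p24 1 1 * e34 + e12
    - (p14 * e13 + p13 * e14) - (p24 * e23 + p23 * e24) = 0 ->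
  [/\ e12 = 0, e13 = 0 & e14 = 0] /\ [/\ e23 = 0, e24 = 0 & e34 = 0].
Proof.
move=> n12 n13 n14 n23 n24 n34 f1 f2 f3 f4 d.
have lin (q A m e X : R) : q * m = A -> q * e + X = 0 -> A * e + m * X = 0.
  move=> <- h; have -> : q * m * e + m * X = m * (q * e + X) by ring.
  by rewrite h mulr0.
rewrite -!addrA.
move=> /(lin _ _ _ _ _ (qdiagE _ _ _ _ n12)) l12
  /(lin _ _ _ _ _ (qdiagE _ _ _ _ n13)) l13
  /(lin _ _ _ _ _ (qdiagE _ _ _ _ n14)) l14
  /(lin _ _ _ _ _ (qdiagE _ _ _ _ n23)) l23
  /(lin _ _ _ _ _ (qdiagE _ _ _ _ n24)) l24
  /(lin _ _ _ _ _ (qdiagE _ _ _ _ n34)) l34.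
(* Half the diagonal of [H *m E *m H]: as [H] has unit diagonal, the diagonal entries of the
   equation leave no other choice. *)
pose v := \row_(j < 4) nth 0
  [:: - p34 * e12 - p24 * e13 - p23 * e14
      + p34 * p24 * e23 + p34 * p23 * e24 + p24 * p23 * e34;
      - p34 * e12 + p34 * p14 * e13 + p34 * p13 * e14
      - p14 * e23 - p13 * e24 + p14 * p13 * e34;
      p24 * p14 * e12 - p24 * e13 + p24 * p12 * e14
      - p14 * e23 + p14 * p12 * e24 - p12 * e34;
      p23 * p13 * e12 + p23 * p12 * e13 - p23 * e14
      + p13 * p12 * e23 - p13 * e24 - p12 * e34 ] j.
pose E := sym4 0 0 0 0 e12 e13 e14 e23 e24 e34.
have E0 : E = 0.
  apply: (gram4_rigid (d := gram_det p34 p24 p23 p14 p13 p12) (v := v) d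
    (mul_gram4_adj _ _ _ _ _ _) (mul_adj_gram4 _ _ _ _ _ _)).
  - case=> [[|[|[|[|//]]]] ?]; rewrite !mxE /= oppr_eq0.
    + by move: f1; congr (~~ (_ == _)); rewrite /face_disc; ring.
    + by move: f2; congr (~~ (_ == _)); rewrite /face_disc; ring.
    + by move: f3; congr (~~ (_ == _)); rewrite /face_disc; ring.
    + by move: f4; congr (~~ (_ == _)); rewrite /face_disc; ring.
  - by case=> [[|[|[|[|//]]]] ?]; rewrite !mxE.
  - apply/matrixP => i j; apply/eqP; rewrite -subr_eq0; apply/eqP.
    rewrite -mulmxA mul_mx_diag mul_diag_mx sym4_mul !sym4_mul !mxE.
    (* The diagonal entries hold by the choice of [v]; each off-diagonal entry is the equation of
       the edge joining the two other indices. *)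
    case: i j => [[|[|[|[|//]]]] ?] [[|[|[|[|//]]]] ?]; rewrite /=; try ring;
    [rewrite -[RHS]l34|rewrite -[RHS]l24|rewrite -[RHS]l23|rewrite -[RHS]l34
    |rewrite -[RHS]l14|rewrite -[RHS]l13|rewrite -[RHS]l24|rewrite -[RHS]l14
    |rewrite -[RHS]l12|rewrite -[RHS]l23|rewrite -[RHS]l13|rewrite -[RHS]l12]; ring.
have Ez i j : E i j = 0 by rewrite E0 mxE.
by split; split; [have := Ez 0 1|have := Ez 0 2|have := Ez 0 3
  |have := Ez 1 2|have := Ez 1 3|have := Ez 2 3]; rewrite mxE.
Qed.

Lemma linear_coef0 (l a : R) : (forall t, 0 <= t * (2 * l + t * a)) -> l = 0.
Proof.
move=> h; apply/eqP/negP => /negP l0.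
pose b := `|a| + 1; have b0 : 0 < b by rewrite ltr_wpDl.
have := h (- l / b); rewrite leNgt => /negP; apply.
have -> : - l / b * (2 * l + - l / b * a) = - (l / b) ^+ 2 * (2 * b - a).
  by field; rewrite gt_eqF.
rewrite mulNr oppr_lt0 mulr_gt0 //.
  by rewrite exprn_even_gt0 //= mulf_neq0 // invr_neq0 // gt_eqF.
have := ler_norm a; have := normr_ge0 a; rewrite /b; lra.
Qed.

(** A zero of a nonnegative form is a minimum, hence a critical point. Perturbing one coordinate at
    a time yields the six linear equations of [qform_injective]. *)
Lemma qform_isotropic (p12 p13 p14 p23 p24 p34 e12 e13 e14 e23 e24 e34 : R) :
  (forall e12 e13 e14 e23 e24 e34 : R,
     0 <= qform p12 p13 p14 p23 p24 p34 1 1 1 1 e12 e13 e14 e23 e24 e34) ->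
  qform p12 p13 p14 p23 p24 p34 1 1 1 1 e12 e13 e14 e23 e24 e34 = 0 ->
  1 - p12 ^+ 2 != 0 -> 1 - p13 ^+ 2 != 0 -> 1 - p14 ^+ 2 != 0 ->
  1 - p23 ^+ 2 != 0 -> 1 - p24 ^+ 2 != 0 -> 1 - p34 ^+ 2 != 0 ->
  face_disc p12 p13 p14 != 0 -> face_disc p12 p23 p24 != 0 ->
  face_disc p13 p23 p34 != 0 -> face_disc p14 p24 p34 != 0 ->
  gram_det p34 p24 p23 p14 p13 p12 != 0 ->
  [/\ e12 = 0, e13 = 0 & e14 = 0] /\ [/\ e23 = 0, e24 = 0 & e34 = 0].
Proof.
move=> psd q0 n12 n13 n14 n23 n24 n34 f1 f2 f3 f4 d.
have crit (f : R -> R) (l a : R) : (forall t, 0 <= f t) ->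
    (forall t, f t = qform p12 p13 p14 p23 p24 p34 1 1 1 1 e12 e13 e14 e23 e24 e34
       + t * (2 * l + t * a)) -> l = 0.
  by move=> f0 fE; apply: (@linear_coef0 l a) => t; have := f0 t; rewrite fE q0 add0r.
apply: (@qform_injective p12 p13 p14 p23 p24 p34) => //.
- apply: (crit (fun t => qform p12 p13 p14 p23 p24 p34 1 1 1 1
    (e12 + t) e13 e14 e23 e24 e34) _ (qdiag p12 p13 p14 p23 p24 1 1)) => t //.
  by rewrite /qform !divr1; ring.
- apply: (crit (fun t => qform p12 p13 p14 p23 p24 p34 1 1 1 1
    e12 (e13 + t) e14 e23 e24 e34) _ (qdiag p13 p12 p14 p23 p34 1 1)) => t //.
  by rewrite /qform !divr1; ring.
- apply: (crit (fun t => qform p12 p13 p14 p23 p24 p34 1 1 1 1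
    e12 e13 (e14 + t) e23 e24 e34) _ (qdiag p14 p12 p13 p24 p34 1 1)) => t //.
  by rewrite /qform !divr1; ring.
- apply: (crit (fun t => qform p12 p13 p14 p23 p24 p34 1 1 1 1
    e12 e13 e14 (e23 + t) e24 e34) _ (qdiag p23 p12 p24 p13 p34 1 1)) => t //.
  by rewrite /qform !divr1; ring.
- apply: (crit (fun t => qform p12 p13 p14 p23 p24 p34 1 1 1 1
    e12 e13 e14 e23 (e24 + t) e34) _ (qdiag p24 p12 p23 p14 p34 1 1)) => t //.
  by rewrite /qform !divr1; ring.
- apply: (crit (fun t => qform p12 p13 p14 p23 p24 p34 1 1 1 1
    e12 e13 e14 e23 e24 (e34 + t)) _ (qdiag p34 p13 p23 p14 p24 1 1)) => t //.
  by rewrite /qform !divr1; ring.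
Qed.

(** When the angles are small, the diagonal coefficients are large because of the denominator
    [1 - p ^+ 2], while the off-diagonal ones stay bounded by 1. A diagonal of 6 is enough: each
    variable loses at most 1 to the opposite edge and 4 to the adjacent edges, which leaves 1. *)
Lemma qform_dominant (p12 p13 p14 p23 p24 p34 e12 e13 e14 e23 e24 e34 : R) :
  9/10 < p12 < 1 -> 9/10 < p13 < 1 -> 9/10 < p14 < 1 ->
  9/10 < p23 < 1 -> 9/10 < p24 < 1 -> 9/10 < p34 < 1 ->
  e12 ^+ 2 + e13 ^+ 2 + e14 ^+ 2 + e23 ^+ 2 + e24 ^+ 2 + e34 ^+ 2 <=
  qform p12 p13 p14 p23 p24 p34 1 1 1 1 e12 e13 e14 e23 e24 e34.
Proof.
move=> h12 h13 h14 h23 h24 h34.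
have dg (ij ik ih jk jh e : R) : 9/10 < ij < 1 -> 9/10 < ik < 1 ->
    9/10 < ih < 1 -> 9/10 < jk < 1 -> 9/10 < jh < 1 ->
    6 * e ^+ 2 <= qdiag ij ik ih jk jh 1 1 * e ^+ 2.
  move=> hij hik hih hjk hjh; apply: ler_wpM2r; first exact: sqr_ge0.
  rewrite /qdiag !divr1 mulr1 ler_pdivlMr; last by nra.
  have mul (x y : R) : 9/10 < x < 1 -> 9/10 < y < 1 -> 4/5 < x * y by nra.
  have m1 := mul _ _ hjh hik; have m2 := mul _ _ hih hjk.
  have m3 := mul _ _ hjh hih; have m4 := mul _ _ hjk hik.
  nra.
have cr (p x y : R) : 9/10 < p < 1 -> 2 * (p * x * y) <= x ^+ 2 + y ^+ 2.
  move=> hp; have := sqr_ge0 (x - y); have := sqr_ge0 (x + y); nra.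
have op (x y : R) : - (x ^+ 2 + y ^+ 2) <= 2 * (x * y).
  by have := sqr_ge0 (x + y); lra.
rewrite /qform !divr1.
have := dg _ _ _ _ _ e12 h12 h13 h14 h23 h24.
have := dg _ _ _ _ _ e13 h13 h12 h14 h23 h34.
have := dg _ _ _ _ _ e14 h14 h12 h13 h24 h34.
have := dg _ _ _ _ _ e23 h23 h12 h24 h13 h34.
have := dg _ _ _ _ _ e24 h24 h12 h23 h14 h34.
have := dg _ _ _ _ _ e34 h34 h13 h23 h14 h24.
have := op e12 e34; have := op e13 e24; have := op e14 e23.
have := cr _ e12 e13 h23; have := cr _ e12 e23 h13; have := cr _ e13 e23 h12.
have := cr _ e12 e14 h24; have := cr _ e12 e24 h14; have := cr _ e14 e24 h12.
have := cr _ e13 e14 h34; have := cr _ e13 e34 h14; have := cr _ e14 e34 h13.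
have := cr _ e23 e24 h34; have := cr _ e23 e34 h24; have := cr _ e24 e34 h23.
lra.
Qed.

End PositiveDefinite.

(** * Coordinates in R^6, limits and compactness *)

Section Vectors.
Variable R : realType.

Definition crd (x : 'rV[R]_6) (k : nat) : R := x 0 (inord k).

(* the edges are listed in the order 12, 13, 14, 23, 24, 34 *)
Definition vec6 (a b c d e f : R) : 'rV[R]_6 :=
  \row_j nth 0 [:: a; b; c; d; e; f] j.

Definition sqnorm (x : 'rV[R]_6) : R :=
  crd x 0 ^+ 2 + crd x 1 ^+ 2 + crd x 2 ^+ 2 + crd x 3 ^+ 2 + crd x 4 ^+ 2
  + crd x 5 ^+ 2.

End Vectors.

Section Continuity.
Variables (R : realType) (T : Type) (F : set_system T).
Context {FF : Filter F}.
Implicit Types f g : T -> R.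

Lemma cvg_add f g (a b : R) : f @ F --> a -> g @ F --> b ->
  (fun t => f t + g t) @ F --> a + b.
Proof. by move=> *; exact: cvgD. Qed.

Lemma cvg_sub f g (a b : R) : f @ F --> a -> g @ F --> b ->
  (fun t => f t - g t) @ F --> a - b.
Proof. by move=> *; exact: cvgB. Qed.

Lemma cvg_mul f g (a b : R) : f @ F --> a -> g @ F --> b ->
  (fun t => f t * g t) @ F --> a * b.
Proof. by move=> *; exact: cvgM. Qed.

Lemma cvg_sqr f (a : R) : f @ F --> a -> (fun t => f t ^+ 2) @ F --> a ^+ 2.
Proof. by move=> fa; exact: (cvgM fa fa). Qed.

Lemma cvg_div f g (a b : R) : b != 0 -> f @ F --> a -> g @ F --> b ->
  (fun t => f t / g t) @ F --> a / b.
Proof. by move=> b0 fa gb; exact: (cvgM fa (cvgV b0 gb)). Qed.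

Ltac cvg_arith := repeat
  lazymatch goal with
  | |- cvg_to (nbhs (fmap (fun t => _ ^+ 2) _)) _ => refine (cvg_sqr _)
  | |- cvg_to (nbhs (fmap (fun t => _ + - _) _)) _ => refine (cvg_sub _ _)
  | |- cvg_to (nbhs (fmap (fun t => _ + _) _)) _ => refine (cvg_add _ _)
  | |- cvg_to (nbhs (fmap (fun t => _ / _) _)) _ => refine (cvg_div _ _ _)
  | |- cvg_to (nbhs (fmap (fun t => _ * _) _)) _ => refine (cvg_mul _ _)
  | |- cvg_to _ _ => first [ assumption | exact: cvg_cst ]
  | |- _ => assumption
  end.

Lemma cvg_face_disc f g h (a b c : R) :
  f @ F --> a -> g @ F --> b -> h @ F --> c ->
  (fun t => face_disc (f t) (g t) (h t)) @ F --> face_disc a b c.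
Proof. by move=> *; rewrite /face_disc; cvg_arith. Qed.

Lemma cvg_cofac f1 f2 f3 f4 f5 f6 (a1 a2 a3 a4 a5 a6 : R) :
  f1 @ F --> a1 -> f2 @ F --> a2 -> f3 @ F --> a3 ->
  f4 @ F --> a4 -> f5 @ F --> a5 -> f6 @ F --> a6 ->
  (fun t => cofac (f1 t) (f2 t) (f3 t) (f4 t) (f5 t) (f6 t)) @ F -->
    cofac a1 a2 a3 a4 a5 a6.
Proof. by move=> *; rewrite /cofac; cvg_arith. Qed.

Lemma cvg_gram_det f1 f2 f3 f4 f5 f6 (a1 a2 a3 a4 a5 a6 : R) :
  f1 @ F --> a1 -> f2 @ F --> a2 -> f3 @ F --> a3 ->
  f4 @ F --> a4 -> f5 @ F --> a5 -> f6 @ F --> a6 ->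
  (fun t => gram_det (f1 t) (f2 t) (f3 t) (f4 t) (f5 t) (f6 t)) @ F -->
    gram_det a1 a2 a3 a4 a5 a6.
Proof. by move=> *; rewrite /gram_det; cvg_arith. Qed.

Lemma cvg_qdiag f1 f2 f3 f4 f5 f6 f7 (a1 a2 a3 a4 a5 a6 a7 : R) :
  a6 != 0 -> a7 != 0 -> a6 * a7 - a1 ^+ 2 != 0 ->
  f1 @ F --> a1 -> f2 @ F --> a2 -> f3 @ F --> a3 ->
  f4 @ F --> a4 -> f5 @ F --> a5 -> f6 @ F --> a6 -> f7 @ F --> a7 ->
  (fun t => qdiag (f1 t) (f2 t) (f3 t) (f4 t) (f5 t) (f6 t) (f7 t)) @ F -->
    qdiag a1 a2 a3 a4 a5 a6 a7.
Proof. by move=> *; rewrite /qdiag; cvg_arith. Qed.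

Lemma cvg_qform f12 f13 f14 f23 f24 f34 d1 d2 d3 d4 g12 g13 g14 g23 g24 g34
    (p12 p13 p14 p23 p24 p34 D1 D2 D3 D4 e12 e13 e14 e23 e24 e34 : R) :
  D1 != 0 -> D2 != 0 -> D3 != 0 -> D4 != 0 ->
  D3 * D4 - p12 ^+ 2 != 0 -> D2 * D4 - p13 ^+ 2 != 0 ->
  D2 * D3 - p14 ^+ 2 != 0 -> D1 * D4 - p23 ^+ 2 != 0 ->
  D1 * D3 - p24 ^+ 2 != 0 -> D1 * D2 - p34 ^+ 2 != 0 ->
  f12 @ F --> p12 -> f13 @ F --> p13 -> f14 @ F --> p14 ->
  f23 @ F --> p23 -> f24 @ F --> p24 -> f34 @ F --> p34 ->
  d1 @ F --> D1 -> d2 @ F --> D2 -> d3 @ F --> D3 -> d4 @ F --> D4 ->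
  g12 @ F --> e12 -> g13 @ F --> e13 -> g14 @ F --> e14 ->
  g23 @ F --> e23 -> g24 @ F --> e24 -> g34 @ F --> e34 ->
  (fun t => qform (f12 t) (f13 t) (f14 t) (f23 t) (f24 t) (f34 t)
     (d1 t) (d2 t) (d3 t) (d4 t) (g12 t) (g13 t) (g14 t) (g23 t) (g24 t) (g34 t))
   @ F --> qform p12 p13 p14 p23 p24 p34 D1 D2 D3 D4 e12 e13 e14 e23 e24 e34.
Proof.
move=> *; rewrite /qform.
do 4![refine (cvg_sub _ _); last by cvg_arith].
refine (cvg_add _ _); last by cvg_arith.
by do 5?[apply: cvg_add]; (apply: cvg_mul; [exact: cvg_qdiag | exact: cvg_sqr]).
Qed.

Lemma cvg_sqnorm (f : T -> 'rV[R]_6) (y : 'rV[R]_6) :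
  (forall k, (fun t => crd (f t) k) @ F --> crd y k) ->
  (fun t => sqnorm (f t)) @ F --> sqnorm y.
Proof.
move=> fy; rewrite /sqnorm.
by do 5?[refine (cvg_add _ _)]; refine (cvg_sqr _); exact: fy.
Qed.

End Continuity.

Section Sphere.
Variable R : realType.

Lemma crd_vec6 (a b c d e f : R) k : (k < 6)%N ->
  crd (vec6 a b c d e f) k = nth 0 [:: a; b; c; d; e; f] k.
Proof. by move=> k6; rewrite /crd mxE inordK. Qed.

Lemma crd_continuous k : continuous (fun x : 'rV[R]_6 => crd x k).
Proof. exact: coord_continuous. Qed.

Lemma sqnorm_continuous : continuous (@sqnorm R).
Proof.
move=> x; apply: (@cvg_sqnorm _ _ (nbhs x) (nbhs_filter x) id x) => k.
exact: crd_continuous.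
Qed.

Lemma crd_sqr_le (x : 'rV[R]_6) k : (k < 6)%N -> crd x k ^+ 2 <= sqnorm x.
Proof.
move=> k6; rewrite /sqnorm.
have := sqr_ge0 (crd x 0); have := sqr_ge0 (crd x 1); have := sqr_ge0 (crd x 2).
have := sqr_ge0 (crd x 3); have := sqr_ge0 (crd x 4); have := sqr_ge0 (crd x 5).
by case: k k6 => [|[|[|[|[|[|//]]]]]] _; lra.
Qed.

(** The set [A] of admissible squared distances lets one proof serve both the unit sphere, with [A]
    a point, and closed balls, with [A] a half-line. *)
Lemma sqnorm_compact (y : 'rV[R]_6) (A : set R) (M : R) : closed A ->
  A `<=` [set r | r <= M] -> compact [set x | A (sqnorm (x - y))].
Proof.
move=> cA AM; apply: bounded_closed_compact.
  exists (`|y| + `|M| + 1); split; first exact: num_real.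
  move=> B yB x /= /AM /= Ax.
  have xM : `|x - y| <= `|M| + 1.
    rewrite [`|_|]mx_normrE; apply: bigmax_le => [|[i j] _ /=].
      by rewrite addr_ge0.
    rewrite (ord1 i).
    have := le_trans (@crd_sqr_le (x - y) j (ltn_ord j)) Ax.
    rewrite /crd inord_val => sq.
    have M1 : M <= `|M| := ler_norm M.
    have M0 := normr_ge0 M.
    rewrite -(@ler_pXn2r _ 2) ?nnegrE ?addr_ge0 // real_normK ?num_real //.
    nra.
  by rewrite -[x](subrK y); apply: (le_trans (ler_normD _ _)); lra.
have cont : continuous (fun x : 'rV[R]_6 => sqnorm (x - y)).
  move=> x.
  have cB : (fun x : 'rV[R]_6 => x - y) @ x --> x - y.
    exact: (@cvgB _ _ _ (nbhs x) (nbhs_filter x) id (fun=> y) _ _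
      (@cvg_id _ (nbhs x)) (@cvg_cst _ y _ (nbhs x) _)).
  exact: (cvg_comp _ _ cB (@sqnorm_continuous (x - y))).
by move/continuous_closedP : cont; apply.
Qed.

Lemma sphere_compact : compact [set x : 'rV[R]_6 | sqnorm x = 1].
Proof.
have le1 : [set (1 : R)] `<=` [set r | r <= 1] by move=> _ ->; exact: lexx.
have := @sqnorm_compact 0 [set 1] 1 (@closed_eq _ 1) le1.
have -> : [set x : 'rV[R]_6 | [set 1] (sqnorm (x - 0))] = [set x | sqnorm x = 1].
  by apply/seteqP; split=> x /=; rewrite subr0.
exact.
Qed.

Lemma compact_pos_bound (X : topologicalType) (K : set X) (f : X -> R) :
  compact K -> (forall x, K x -> {for x, continuous f}) ->
  (forall x, K x -> 0 < f x) -> exists2 c, 0 < c & forall x, K x -> c <= f x.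
Proof.
move=> cK cf f0; have [->|/set0P K0] := eqVneq K set0; first by exists 1.
have wf : {within K, continuous f}.
  by apply: continuous_in_subspaceT => x /set_mem; exact: cf.
have [c /set_mem Kc cmin] := compact_EVT_min K0 cK wf.
by exists (f c); [exact: f0 | move=> x /mem_set; exact: cmin].
Qed.

End Sphere.

(** * Positivity of the normalised form under the angle conditions *)

Section AngleFormPositive.
Variable R : realType.

Lemma cos_itv (a : R) : 0 < a < pi -> -1 < cos a < 1.
Proof.
move=> /andP[a0 ap]; rewrite -cospi -[X in _ < _ < X](@cos0 R).
by rewrite !ltr_cos ?in_itv /=; lra.
Qed.

Lemma face_disc_angles (a b c : R) : 0 < a -> 0 < b -> 0 < c -> a + b + c < pi ->
  0 < face_disc (cos a) (cos b) (cos c).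
Proof.
move=> a0 b0 c0 s; have := triangle_angles a0 b0 c0 s.
have sb : 0 < sin b by rewrite sin_gt0_pi // b0; lra.
have sc : 0 < sin c by rewrite sin_gt0_pi // c0; lra.
have b2 := sin2cos2 b; have c2 := sin2cos2 c.
move=> h; have : (sin b * sin c) ^+ 2 < (cos a + cos b * cos c) ^+ 2.
  have := mulr_gt0 sb sc; nra.
rewrite exprMn b2 c2 /face_disc; lra.
Qed.

(* The hexagonal faces [k] and [h] meet along the edge [ij], so that [- cos t_ij]
   is the [(k, h)] entry of the Gram matrix of their normals. *)
Lemma gram_det_angles (t12 t13 t14 t23 t24 t34 : R) :
  0 < t12 -> 0 < t13 -> 0 < t14 -> 0 < t23 -> 0 < t24 -> 0 < t34 ->
  t12 + t13 + t14 < pi -> t12 + t23 + t24 < pi ->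
  t13 + t23 + t34 < pi -> t14 + t24 + t34 < pi ->
  gram_det (cos t34) (cos t24) (cos t23) (cos t14) (cos t13) (cos t12) < 0.
Proof.
move=> p12 p13 p14 p23 p24 p34 h1 h2 h3 h4.
apply: (@gram_det_lt0 _ _ _ _ _ _ _ (sin t34) (sin t14) (sin t13)).
- by rewrite sin_gt0_pi //; lra.
- by rewrite ltW // sin_gt0_pi //; lra.
- by rewrite ltW // sin_gt0_pi //; lra.
- exact: sin2cos2.
- exact: sin2cos2.
- exact: sin2cos2.
- by have := @triangle_angles _ t24 t34 t14 p24 p34 p14; apply; lra.
- by have := @triangle_angles _ t23 t34 t13 p23 p34 p13; apply; lra.
- by have := @triangle_angles _ t12 t14 t13 p12 p14 p13; apply; lra.
Qed.

Lemma cos_near1 : exists2 e : R, 0 < e & forall a, 0 < a < e -> 9/10 < cos a.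
Proof.
have h : (9 / 10 : R) < cos 0 by rewrite cos0; lra.
have : nbhs (0 : R) (fun a => 9/10 < cos a).
  by apply: (@cvgr_gt _ _ _ _ (@cos R) _ (@continuous_cos R 0) _ h).
move=> /nbhs_ballP[e /= e0 he]; exists e => // a /andP[a0 ae].
by apply: he; rewrite /ball /= sub0r normrN gtr0_norm.
Qed.

Lemma qform_angle_gt0 (t12 t13 t14 t23 t24 t34 : R) (E : 'rV[R]_6) :
  0 < t12 -> 0 < t13 -> 0 < t14 -> 0 < t23 -> 0 < t24 -> 0 < t34 ->
  t12 + t13 + t14 < pi -> t12 + t23 + t24 < pi ->
  t13 + t23 + t34 < pi -> t14 + t24 + t34 < pi -> sqnorm E = 1 ->
  0 < qform (cos t12) (cos t13) (cos t14) (cos t23) (cos t24) (cos t34) 1 1 1 1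
    (crd E 0) (crd E 1) (crd E 2) (crd E 3) (crd E 4) (crd E 5).
Proof.
move=> p12 p13 p14 p23 p24 p34 h1 h2 h3 h4 E1.
have [e e0 he] := cos_near1.
have pi0 := pi_gt0 R.
(* The start of the deformation: [a * pi < e] brings all scaled angles, which are below [a * pi],
   into the range of [qform_dominant], and [1 / 2] keeps [a] below the end point 1. *)
pose a := Num.min (1 / 2) (e / (2 * pi)) : R.
have a0 : 0 < a by rewrite lt_min !divr_gt0 ?mulr_gt0.
have a1 : a < 1 by rewrite gt_min; apply/orP; left; lra.
have ae : a * pi < e.
  have : a <= e / (2 * pi) by rewrite ge_min lexx orbT.
  rewrite ler_pdivlMr ?mulr_gt0 //; nra.
(* all angles are scaled by [q.1], which keeps the angle conditions at the vertices *)
pose f (q : R * 'rV[R]_6) := qform (cos (q.1 * t12)) (cos (q.1 * t13))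
  (cos (q.1 * t14)) (cos (q.1 * t23)) (cos (q.1 * t24)) (cos (q.1 * t34)) 1 1 1 1
  (crd q.2 0) (crd q.2 1) (crd q.2 2) (crd q.2 3) (crd q.2 4) (crd q.2 5).
have sc (s t : R) : 0 < s <= 1 -> 0 < t < pi -> 0 < s * t < pi.
  by move=> hs ht; apply/andP; split; nra.
have ne (s t : R) : 0 < s <= 1 -> 0 < t < pi -> 1 - cos (s * t) ^+ 2 != 0.
  by move=> hs ht; have := cos_itv (sc _ _ hs ht); nra.
have cf (s : R) x : a <= s <= 1 -> sqnorm x = 1 -> {for (s, x), continuous f}.
  move=> /andP[as_ s1] _.
  have hs : 0 < s <= 1 by rewrite s1 andbT; lra.
  have ccos t : (fun q : R * 'rV[R]_6 => cos (q.1 * t)) @ (s, x) --> cos (s * t).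
    have h : (fun q : R * 'rV[R]_6 => q.1 * t) @ nbhs (s, x) --> s * t.
      exact: (@cvg_mul _ _ (nbhs (s, x)) _ fst (fun=> t) _ _
        (@cvg_fst _ _ (nbhs s) (nbhs x) _) (@cvg_cst _ t _ (nbhs (s, x)) _)).
    exact: (cvg_comp _ _ h (@continuous_cos R (s * t))).
  have ccrd k : (fun q : R * 'rV[R]_6 => crd q.2 k) @ nbhs (s, x) --> crd x k.
    have h : (@snd R 'rV[R]_6) @ nbhs (s, x) --> x.
      exact: (@cvg_snd _ _ (nbhs s) (nbhs x) _).
    exact: (@cvg_comp _ _ _ snd (fun y : 'rV[R]_6 => crd y k) _ (nbhs x) _ h
      (@crd_continuous R k x)).
  apply: (@cvg_qform _ _ (nbhs (s, x)) (nbhs_filter _));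
    rewrite ?mul1r ?oner_neq0 ?ne //; try lra;
    exact: (@cvg_cst _ _ _ (nbhs (s, x)) (nbhs_filter _)).
rewrite ltNge; apply/negP => q0.
have [||s [x [/andP[as_ s1] x1 fx fpos]]] := @first_nonpositive R _ _ f a 1
  (@sphere_compact R) (ltW a1) cf.
- move=> x x1; have dom (t : R) : 0 < t < pi -> 9/10 < cos (a * t) < 1.
    move=> ht; have := cos_itv (sc a t _ ht); rewrite a0 ltW // => /(_ isT) /andP[_ ->].
    by rewrite he // mulr_gt0 //=; nra.
  apply: lt_le_trans (qform_dominant _ _ _ _ _ _ _ _ _ _ _ _); try by apply: dom; lra.
  by move: x1; rewrite /= /sqnorm => ->.
- by exists E => //; rewrite /f /= !mul1r.
have hs : 0 < s <= 1 by rewrite s1 andbT; lra.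
have s0 : 0 < s by lra.
have sm (t : R) : 0 < t -> 0 < s * t by move=> ?; rewrite mulr_gt0.
have sum (t u v : R) : 0 < t -> 0 < u -> 0 < v -> t + u + v < pi ->
    s * t + s * u + s * v < pi.
  by move=> *; rewrite -!mulrDr; nra.
(* At the critical parameter, nonnegativity is known on the unit sphere only; homogeneity extends it
   to all vectors, and the zero vector is treated apart. *)
have psd (e12 e13 e14 e23 e24 e34 : R) : 0 <= qform (cos (s * t12))
    (cos (s * t13)) (cos (s * t14)) (cos (s * t23)) (cos (s * t24)) (cos (s * t34))
    1 1 1 1 e12 e13 e14 e23 e24 e34.
  pose y := vec6 e12 e13 e14 e23 e24 e34.
  have [y0|y0] := eqVneq (sqnorm y) 0.
    have z k : (k < 6)%N -> nth 0 [:: e12; e13; e14; e23; e24; e34] k = 0.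
      move=> k6; rewrite -crd_vec6 //; apply/eqP; rewrite -sqrf_eq0 eq_le sqr_ge0.
      by rewrite -y0 crd_sqr_le.
    have /= -> := z 0%N isT; have /= -> := z 1%N isT; have /= -> := z 2%N isT.
    have /= -> := z 3%N isT; have /= -> := z 4%N isT; have /= -> := z 5%N isT.
    by rewrite /qform expr0n /= ?(mulr0, mul0r, addr0, subr0).
  have yp : 0 < sqnorm y.
    rewrite lt_neqAle eq_sym y0.
    by apply: le_trans (crd_sqr_le y (isT : (0 < 6)%N)); exact: sqr_ge0.
  pose r := Num.sqrt (sqnorm y).
  have r0 : 0 < r by rewrite sqrtr_gt0.
  have r2 : r ^+ 2 = sqnorm y by rewrite sqr_sqrtr // ltW.
  have := fpos (vec6 (e12 / r) (e13 / r) (e14 / r) (e23 / r) (e24 / r) (e34 / r)).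
  rewrite /f /sqnorm /= !crd_vec6 //= => h.
  have -> : qform (cos (s * t12)) (cos (s * t13)) (cos (s * t14)) (cos (s * t23))
     (cos (s * t24)) (cos (s * t34)) 1 1 1 1 e12 e13 e14 e23 e24 e34 = r ^+ 2 *
    qform (cos (s * t12)) (cos (s * t13)) (cos (s * t14)) (cos (s * t23))
     (cos (s * t24)) (cos (s * t34)) 1 1 1 1 (e12 / r) (e13 / r) (e14 / r) (e23 / r)
     (e24 / r) (e34 / r).
    by rewrite /qform; field; rewrite gt_eqF.
  rewrite mulr_ge0 ?sqr_ge0 // h // !exprMn -!mulrDl exprVn r2 /sqnorm /y.
  rewrite !crd_vec6 //= divff //.
  by move: y0; rewrite /sqnorm !crd_vec6.
have nes (t : R) : 0 < t < pi -> 1 - cos (s * t) ^+ 2 != 0 by exact: ne.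
have [[x0_ x1_ x2_] [x3_ x4_ x5_]] :
    [/\ crd x 0 = 0, crd x 1 = 0 & crd x 2 = 0] /\
    [/\ crd x 3 = 0, crd x 4 = 0 & crd x 5 = 0].
  apply: (qform_isotropic psd fx); try by apply: nes; lra.
  - by rewrite gt_eqF // face_disc_angles ?sm ?sum.
  - by rewrite gt_eqF // face_disc_angles ?sm ?sum.
  - by rewrite gt_eqF // face_disc_angles ?sm ?sum.
  - by rewrite gt_eqF // face_disc_angles ?sm ?sum.
  - by rewrite lt_eqF // gram_det_angles ?sm ?sum.
move: x1; rewrite /= /sqnorm x0_ x1_ x2_ x3_ x4_ x5_ expr0n /= !addr0 => /esym/eqP.
by rewrite oner_eq0.
Qed.

End AngleFormPositive.

(** * From edge lengths to angles: the vertex links *)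

Section LengthForm.
Variable R : realType.

(** Each inequality leaves two cases, [a + b + c < pi] or, up to the order of the angles,
    [pi < b + c - a]. Adding two inequalities of the second kind would give an angle larger than
    pi. *)
Lemma angle_sum_lt_pi (a b c : R) : 0 < a < pi -> 0 < b < pi -> 0 < c < pi ->
  sin b * sin c < cos a + cos b * cos c ->
  sin a * sin c < cos b + cos a * cos c ->
  sin a * sin b < cos c + cos a * cos b -> a + b + c < pi.
Proof.
move=> ha hb hc ca cb cc.
have key (x y z : R) : 0 < x < pi -> 0 < y < pi -> 0 < z < pi ->
    sin y * sin z < cos x + cos y * cos z ->
    (x + y + z < pi) || (pi < y + z - x).
  move=> hx hy hz h; rewrite -implyNb; apply/implyP; rewrite -leNgt => le.
  have [yz|yz] := leP (y + z) pi.
    have : cos x <= cos (pi - (y + z)) by rewrite leNgt ltr_cos ?in_itv /= -?leNgt; lra.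
    by rewrite cosB cospi sinpi cosD; lra.
  have [//|le2] := ltP.
  have : cos x <= cos (y + z - pi) by rewrite leNgt ltr_cos ?in_itv /= -?leNgt; lra.
  by rewrite cosB cospi sinpi cosD; lra.
have := key a b c ha hb hc ca; have := key b a c hb ha hc cb.
have := key c a b hc ha hb cc.
by move=> /orP[] ? /orP[] ? /orP[] ?; lra.
Qed.

Lemma face_disc_gt0 (x y z : R) : 1 <= x -> 1 <= y -> 1 <= z -> 0 < face_disc x y z.
Proof.
move=> x1 y1 z1; rewrite /face_disc; have xy1 : 1 <= x * y by nra.
have : 1 <= x * y * z by nra.
by nra.
Qed.

Lemma cofac_ratio_itv (N D D' : R) : 0 < D -> 0 < D' -> 0 < D * D' - N ^+ 2 ->
  -1 < N / (Num.sqrt D * Num.sqrt D') < 1.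
Proof.
move=> D0 D'0 h.
have r0 : 0 < Num.sqrt D * Num.sqrt D' by rewrite mulr_gt0 ?sqrtr_gt0.
rewrite ltr_pdivlMr // ltr_pdivrMr // mul1r mulN1r -ltr_norml.
rewrite -(@ltr_pXn2r _ 2) ?nnegrE ?normr_ge0 ?(ltW r0) //.
rewrite real_normK ?num_real // exprMn !sqr_sqrtr ?ltW //; lra.
Qed.

Lemma acos_itv (x : R) : -1 < x < 1 -> 0 < acos x < pi.
Proof. by move=> /andP[x1 x2]; rewrite acos_gt0 ?ltW //= acos_ltpi // x1 ltW. Qed.

Lemma cos_acos (x : R) : -1 < x < 1 -> cos (acos x) = x.
Proof. by move=> /andP[x1 x2]; rewrite acosK // in_itv /= !ltW. Qed.

(** The law of cosines in the vertex triangle [i]: divided by the left-hand side, the right-hand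
    side becomes [(ckh + cik * cih) / sqrt ((cik ^+ 2 - 1) * (cih ^+ 2 - 1))], the cosh of the side
    opposite to the corner [ij], which exceeds 1. The three equations say this in terms of
    cofactors, with [g] standing for [- det G]. *)
Lemma link_inequality (g rj rk rh Nij Nik Nih cik cih ckh : R) :
  0 < g -> 0 < rj -> 0 < rk -> 0 < rh -> 1 < cik -> 1 < cih -> 1 < ckh ->
  Nij * rj ^+ 2 + Nih * Nik = g * (ckh + cik * cih) ->
  rj ^+ 2 * rh ^+ 2 - Nik ^+ 2 = g * (cik ^+ 2 - 1) ->
  rj ^+ 2 * rk ^+ 2 - Nih ^+ 2 = g * (cih ^+ 2 - 1) ->
  -1 < Nik / (rj * rh) < 1 -> -1 < Nih / (rj * rk) < 1 ->
  sin (acos (Nik / (rj * rh))) * sin (acos (Nih / (rj * rk))) <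
  Nij / (rk * rh) + Nik / (rj * rh) * (Nih / (rj * rk)).
Proof.
move=> g0 j0 k0 h0 ik ih kh e1 e2 e3 p q.
have s1 := acos_itv p; have s2 := acos_itv q.
set x := sin _; set y := sin _.
have x0 : 0 < x by apply: sin_gt0_pi.
have y0 : 0 < y by apply: sin_gt0_pi.
have x2 : x ^+ 2 = g * (cik ^+ 2 - 1) / (rj * rh) ^+ 2.
  rewrite /x sin2cos2 cos_acos // -e2; field; rewrite !gt_eqF //.
have y2 : y ^+ 2 = g * (cih ^+ 2 - 1) / (rj * rk) ^+ 2.
  rewrite /y sin2cos2 cos_acos // -e3; field; rewrite !gt_eqF //.
have -> : Nij / (rk * rh) + Nik / (rj * rh) * (Nih / (rj * rk)) =
    (Nij * rj ^+ 2 + Nih * Nik) / (rj ^+ 2 * rk * rh).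
  by field; rewrite !gt_eqF.
rewrite e1 -(@ltr_pXn2r _ 2) ?nnegrE //; first last.
- by rewrite ltW // divr_gt0 ?mulr_gt0 ?addr_gt0 ?mulr_gt0 ?exprn_gt0 //; lra.
- by rewrite mulr_ge0 // ltW.
have -> : (x * y) ^+ 2 =
    g ^+ 2 * ((cik ^+ 2 - 1) * (cih ^+ 2 - 1)) / (rj ^+ 2 * rk * rh) ^+ 2.
  by rewrite exprMn x2 y2; field; rewrite !gt_eqF.
rewrite expr_div_n ltr_pM2r ?invr_gt0 ?exprn_gt0 ?mulr_gt0 ?exprn_gt0 //.
rewrite (exprMn _ g) ltr_pM2l ?exprn_gt0 //.
have m : 1 < cik * cih by nra.
nra.
Qed.

(** The three angles along the edges at [i] are those of a hyperbolic triangle, the link of [i]. The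
    identities [eij] to [xih] are instances of Jacobi's identity for the adjugate and supply the
    equations of [link_inequality] for its three sides. *)
Lemma link_angle_sum (ij ik ih jk jh kh : R) :
  1 < ij -> 1 < ik -> 1 < ih -> 1 < jk -> 1 < jh -> 1 < kh ->
  gram_det ij ik ih jk jh kh < 0 ->
  let rj := Num.sqrt (face_disc ik kh ih) in
  let rk := Num.sqrt (face_disc ij jh ih) in
  let rh := Num.sqrt (face_disc ij jk ik) in
  acos (cofac ij ik ih jk jh kh / (rk * rh))
  + acos (cofac ik ij ih jk kh jh / (rj * rh))
  + acos (cofac ih ij ik jh kh jk / (rj * rk)) < pi.
Proof.
move=> ij1 ik1 ih1 jk1 jh1 kh1 g0.
set Dj := face_disc ik kh ih; set Dk := face_disc ij jh ih.
set Dh := face_disc ij jk ik.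
set Nij := cofac ij _ _ _ _ _; set Nik := cofac ik _ _ _ _ _.
set Nih := cofac ih _ _ _ _ _; set g := gram_det _ _ _ _ _ _ in g0.
have Dj0 : 0 < Dj by rewrite face_disc_gt0 // ltW.
have Dk0 : 0 < Dk by rewrite face_disc_gt0 // ltW.
have Dh0 : 0 < Dh by rewrite face_disc_gt0 // ltW.
have eij : Dk * Dh - Nij ^+ 2 = - g * (ij ^+ 2 - 1).
  by rewrite /Dk /Dh /Nij /g /face_disc /cofac /gram_det; ring.
have eik : Dj * Dh - Nik ^+ 2 = - g * (ik ^+ 2 - 1).
  by rewrite /Dj /Dh /Nik /g /face_disc /cofac /gram_det; ring.
have eih : Dj * Dk - Nih ^+ 2 = - g * (ih ^+ 2 - 1).
  by rewrite /Dj /Dk /Nih /g /face_disc /cofac /gram_det; ring.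
have xij : Nij * Dj + Nih * Nik = - g * (kh + ik * ih).
  by rewrite /Dj /Nij /Nih /Nik /g /face_disc /cofac /gram_det; ring.
have xik : Nik * Dk + Nih * Nij = - g * (jh + ij * ih).
  by rewrite /Dk /Nij /Nih /Nik /g /face_disc /cofac /gram_det; ring.
have xih : Nih * Dh + Nik * Nij = - g * (jk + ij * ik).
  by rewrite /Dh /Nij /Nih /Nik /g /face_disc /cofac /gram_det; ring.
have ng : 0 < - g by lra.
have pos (x : R) : 1 < x -> 0 < - g * (x ^+ 2 - 1).
  by move=> x1; rewrite mulr_gt0 //; nra.
have pij : -1 < Nij / (Num.sqrt Dk * Num.sqrt Dh) < 1.
  by apply: cofac_ratio_itv => //; rewrite eij pos.
have pik : -1 < Nik / (Num.sqrt Dj * Num.sqrt Dh) < 1.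
  by apply: cofac_ratio_itv => //; rewrite eik pos.
have pih : -1 < Nih / (Num.sqrt Dj * Num.sqrt Dk) < 1.
  by apply: cofac_ratio_itv => //; rewrite eih pos.
move: eij eik eih xij xik xih pij pik pih.
rewrite -(sqr_sqrtr (ltW Dj0)) -(sqr_sqrtr (ltW Dk0)) -(sqr_sqrtr (ltW Dh0)).
rewrite !sqrtr_sqr !(ger0_norm (sqrtr_ge0 _)).
have {Dj0} : 0 < Num.sqrt Dj by rewrite sqrtr_gt0.
have {Dk0} : 0 < Num.sqrt Dk by rewrite sqrtr_gt0.
have {Dh0} : 0 < Num.sqrt Dh by rewrite sqrtr_gt0.
move: (Num.sqrt Dj) (Num.sqrt Dk) (Num.sqrt Dh) => rj rk rh h0 k0 j0.
move=> eij eik eih xij xik xih pij pik pih.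
apply: angle_sum_lt_pi; rewrite ?acos_itv ?cos_acos //.
- exact: (link_inequality ng j0 k0 h0 ik1 ih1 kh1).
- move: pih xij xik xih eih; rewrite (mulrC rj rk) (mulrC (rj ^+ 2) (rk ^+ 2)).
  move=> pih xij xik xih eih.
  exact: (link_inequality ng k0 j0 h0 ij1 ih1 jh1).
- move: pik pij eij eik; rewrite (mulrC rj rh) (mulrC rk rh).
  rewrite (mulrC (rj ^+ 2) (rh ^+ 2)) (mulrC (rk ^+ 2) (rh ^+ 2)) => pik pij eij eik.
  exact: (link_inequality ng h0 j0 k0 ij1 ik1 jk1).
Qed.

Lemma qform_scale_sqrt (p12 p13 p14 p23 p24 p34 D1 D2 D3 D4
                   e12 e13 e14 e23 e24 e34 : R) :
  let r1 := Num.sqrt D1 in let r2 := Num.sqrt D2 in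
  let r3 := Num.sqrt D3 in let r4 := Num.sqrt D4 in
  0 < D1 -> 0 < D2 -> 0 < D3 -> 0 < D4 ->
  -1 < p12 / (r3 * r4) < 1 -> -1 < p13 / (r2 * r4) < 1 -> -1 < p14 / (r2 * r3) < 1 ->
  -1 < p23 / (r1 * r4) < 1 -> -1 < p24 / (r1 * r3) < 1 -> -1 < p34 / (r1 * r2) < 1 ->
  qform p12 p13 p14 p23 p24 p34 D1 D2 D3 D4 e12 e13 e14 e23 e24 e34 =
  qform (p12 / (r3 * r4)) (p13 / (r2 * r4)) (p14 / (r2 * r3))
      (p23 / (r1 * r4)) (p24 / (r1 * r3)) (p34 / (r1 * r2)) 1 1 1 1
      (e12 * (r1 * r2)) (e13 * (r1 * r3)) (e14 * (r1 * r4))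
      (e23 * (r2 * r3)) (e24 * (r2 * r4)) (e34 * (r3 * r4)) / (r1 * r2 * r3 * r4).
Proof.
move=> r1 r2 r3 r4 d1 d2 d3 d4 h12 h13 h14 h23 h24 h34.
have r1p : 0 < r1 by rewrite sqrtr_gt0.
have r2p : 0 < r2 by rewrite sqrtr_gt0.
have r3p : 0 < r3 by rewrite sqrtr_gt0.
have r4p : 0 < r4 by rewrite sqrtr_gt0.
have ne (p : R) : -1 < p < 1 -> 1 - p ^+ 2 != 0 by move=> hp; rewrite gt_eqF //; nra.
rewrite -qform_scale ?ne // !divfK ?mulf_neq0 ?gt_eqF //.
by rewrite !sqr_sqrtr ?ltW.
Qed.

End LengthForm.

Section TetForm.
Variable R : realType.

Definition tet_form (c12 c13 c14 c23 c24 c34 e12 e13 e14 e23 e24 e34 : R) : R :=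
  qform (cofac c12 c13 c14 c23 c24 c34) (cofac c13 c12 c14 c23 c34 c24)
    (cofac c14 c12 c13 c24 c34 c23) (cofac c23 c12 c24 c13 c34 c14)
    (cofac c24 c12 c23 c14 c34 c13) (cofac c34 c13 c23 c14 c24 c12)
    (face_disc c23 c34 c24) (face_disc c13 c34 c14) (face_disc c12 c24 c14)
    (face_disc c12 c23 c13) e12 e13 e14 e23 e24 e34.

Lemma qform_homog (p12 p13 p14 p23 p24 p34 D1 D2 D3 D4 r
    e12 e13 e14 e23 e24 e34 : R) :
  qform p12 p13 p14 p23 p24 p34 D1 D2 D3 D4 (r * e12) (r * e13) (r * e14)
    (r * e23) (r * e24) (r * e34) =
  r ^+ 2 * qform p12 p13 p14 p23 p24 p34 D1 D2 D3 D4 e12 e13 e14 e23 e24 e34.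
Proof. rewrite /qform; ring. Qed.

Lemma qform_angle_pos (t12 t13 t14 t23 t24 t34 e12 e13 e14 e23 e24 e34 : R) :
  0 < t12 -> 0 < t13 -> 0 < t14 -> 0 < t23 -> 0 < t24 -> 0 < t34 ->
  t12 + t13 + t14 < pi -> t12 + t23 + t24 < pi ->
  t13 + t23 + t34 < pi -> t14 + t24 + t34 < pi ->
  0 < e12 ^+ 2 + e13 ^+ 2 + e14 ^+ 2 + e23 ^+ 2 + e24 ^+ 2 + e34 ^+ 2 ->
  0 < qform (cos t12) (cos t13) (cos t14) (cos t23) (cos t24) (cos t34) 1 1 1 1
    e12 e13 e14 e23 e24 e34.
Proof.
move=> p12 p13 p14 p23 p24 p34 h1 h2 h3 h4 e0.
set S := (X in 0 < X) in e0; pose r := Num.sqrt S.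
have r0 : 0 < r by rewrite sqrtr_gt0.
have r2 : r ^+ 2 = S by rewrite sqr_sqrtr // ltW.
have rK (e : R) : e = r * (e / r) by rewrite mulrC divfK // gt_eqF.
rewrite [e12]rK [e13]rK [e14]rK [e23]rK [e24]rK [e34]rK qform_homog.
rewrite mulr_gt0 ?exprn_gt0 //.
have := @qform_angle_gt0 _ t12 t13 t14 t23 t24 t34
  (vec6 (e12 / r) (e13 / r) (e14 / r) (e23 / r) (e24 / r) (e34 / r))
  p12 p13 p14 p23 p24 p34 h1 h2 h3 h4.
rewrite /sqnorm !crd_vec6 //= => h; apply: h.
by rewrite !expr_div_n -!mulrDl r2 divff // gt_eqF.
Qed.

(** The relabellings that preserve the edge [ij]: exchange of [i] and [j], of [k] and [h], or both.
    The equations are bundled so that a single [rewrite] brings every occurrence to one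
    representative. *)
Lemma cofac_perm (ij ik ih jk jh kh : R) :
  (cofac ij jk jh ik ih kh = cofac ij ik ih jk jh kh) *
  (cofac ij ih ik jh jk kh = cofac ij ik ih jk jh kh) *
  (cofac ij jh jk ih ik kh = cofac ij ik ih jk jh kh).
Proof. by rewrite /cofac; do !split; ring. Qed.

Lemma face_disc_perm (x y z : R) :
  (face_disc x z y = face_disc x y z) * (face_disc y x z = face_disc x y z) *
  (face_disc y z x = face_disc x y z) * (face_disc z x y = face_disc x y z) *
  (face_disc z y x = face_disc x y z).
Proof. by rewrite /face_disc; do !split; ring. Qed.

Lemma gram_det_perm (a12 a13 a14 a23 a24 a34 : R) :
  (gram_det a13 a12 a14 a23 a34 a24 = gram_det a12 a13 a14 a23 a24 a34) *
  (gram_det a14 a12 a13 a24 a34 a23 = gram_det a12 a13 a14 a23 a24 a34) *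
  (gram_det a23 a12 a24 a13 a34 a14 = gram_det a12 a13 a14 a23 a24 a34) *
  (gram_det a24 a12 a23 a14 a34 a13 = gram_det a12 a13 a14 a23 a24 a34) *
  (gram_det a34 a13 a23 a14 a24 a12 = gram_det a12 a13 a14 a23 a24 a34).
Proof. by rewrite /gram_det; do !split; ring. Qed.

(** After normalisation the coefficients are cosines of the dihedral angles, and [link_angle_sum] at
    the four vertices gives the conditions of [qform_angle_pos]. Most of the proof matches the names
    that one cofactor receives at different vertices. *)
Lemma tet_form_gt0 (c12 c13 c14 c23 c24 c34 e12 e13 e14 e23 e24 e34 : R) :
  1 < c12 -> 1 < c13 -> 1 < c14 -> 1 < c23 -> 1 < c24 -> 1 < c34 ->
  gram_det c12 c13 c14 c23 c24 c34 < 0 ->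
  0 < e12 ^+ 2 + e13 ^+ 2 + e14 ^+ 2 + e23 ^+ 2 + e24 ^+ 2 + e34 ^+ 2 ->
  0 < tet_form c12 c13 c14 c23 c24 c34 e12 e13 e14 e23 e24 e34.
Proof.
move=> h12 h13 h14 h23 h24 h34 g0 e0; rewrite /tet_form.
have := link_angle_sum h12 h13 h14 h23 h24 h34 g0.
have g2 : gram_det c12 c23 c24 c13 c14 c34 < 0.
  by move: g0; congr (_ < _); rewrite /gram_det; ring.
have := link_angle_sum h12 h23 h24 h13 h14 h34 g2.
have g3 : gram_det c13 c23 c34 c12 c14 c24 < 0.
  by move: g0; congr (_ < _); rewrite /gram_det; ring.
have := link_angle_sum h13 h23 h34 h12 h14 h24 g3.
have g4 : gram_det c14 c24 c34 c12 c13 c23 < 0.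
  by move: g0; congr (_ < _); rewrite /gram_det; ring.
have := link_angle_sum h14 h24 h34 h12 h13 h23 g4.
rewrite /=.
have n12 := cofac_sqr c12 c13 c14 c23 c24 c34.
have n13 := cofac_sqr c13 c12 c14 c23 c34 c24.
have n14 := cofac_sqr c14 c12 c13 c24 c34 c23.
have n23 := cofac_sqr c23 c12 c24 c13 c34 c14.
have n24 := cofac_sqr c24 c12 c23 c14 c34 c13.
have n34 := cofac_sqr c34 c13 c23 c14 c24 c12.
have d1 : 0 < face_disc c23 c34 c24 by rewrite face_disc_gt0 // ltW.
have d2 : 0 < face_disc c13 c34 c14 by rewrite face_disc_gt0 // ltW.
have d3 : 0 < face_disc c12 c24 c14 by rewrite face_disc_gt0 // ltW.
have d4 : 0 < face_disc c12 c23 c13 by rewrite face_disc_gt0 // ltW.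
have pos (g x : R) : g = gram_det c12 c13 c14 c23 c24 c34 -> 1 < x ->
    0 < - g * (x ^+ 2 - 1).
  by move=> -> x1; rewrite mulr_gt0 //; [lra | nra].
have m12 : 0 < - gram_det c12 c13 c14 c23 c24 c34 * (c12 ^+ 2 - 1) by exact: pos.
have m13 : 0 < - gram_det c13 c12 c14 c23 c34 c24 * (c13 ^+ 2 - 1).
  by apply: pos => //; rewrite (gram_det_perm c12 c13 c14 c23 c24 c34).
have m14 : 0 < - gram_det c14 c12 c13 c24 c34 c23 * (c14 ^+ 2 - 1).
  by apply: pos => //; rewrite (gram_det_perm c12 c13 c14 c23 c24 c34).
have m23 : 0 < - gram_det c23 c12 c24 c13 c34 c14 * (c23 ^+ 2 - 1).
  by apply: pos => //; rewrite (gram_det_perm c12 c13 c14 c23 c24 c34).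
have m24 : 0 < - gram_det c24 c12 c23 c14 c34 c13 * (c24 ^+ 2 - 1).
  by apply: pos => //; rewrite (gram_det_perm c12 c13 c14 c23 c24 c34).
have m34 : 0 < - gram_det c34 c13 c23 c14 c24 c12 * (c34 ^+ 2 - 1).
  by apply: pos => //; rewrite (gram_det_perm c12 c13 c14 c23 c24 c34).
move: m12 m13 m14 m23 m24 m34; rewrite -n12 -n13 -n14 -n23 -n24 -n34.
rewrite !(face_disc_perm c23 c34 c24) !(face_disc_perm c13 c34 c14).
rewrite !(face_disc_perm c12 c24 c14) !(face_disc_perm c12 c23 c13).
rewrite !(cofac_perm c12 c13 c14) !(cofac_perm c13 c12 c14) !(cofac_perm c23 c12 c24).
rewrite !(cofac_perm c14 c12 c13) !(cofac_perm c24 c12 c23) !(cofac_perm c34 c13 c23).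
move: (face_disc c23 _ _) (face_disc c13 _ _) (face_disc c12 c24 _)
  (face_disc c12 c23 _) d1 d2 d3 d4 => D1 D2 D3 D4 d1 d2 d3 d4.
move: (cofac c12 _ _ _ _ _) (cofac c13 _ _ _ _ _) (cofac c14 _ _ _ _ _)
  (cofac c23 _ _ _ _ _) (cofac c24 _ _ _ _ _) (cofac c34 _ _ _ _ _).
move=> p12 p13 p14 p23 p24 p34.
rewrite (mulrC D4 D3) (mulrC D4 D2) (mulrC D3 D2) (mulrC D4 D1) (mulrC D3 D1) (mulrC D2 D1).
move=> /(cofac_ratio_itv d3 d4) k12 /(cofac_ratio_itv d2 d4) k13.
move=> /(cofac_ratio_itv d2 d3) k14 /(cofac_ratio_itv d1 d4) k23.
move=> /(cofac_ratio_itv d1 d3) k24 /(cofac_ratio_itv d1 d2) k34 s4 s3 s2 s1.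
rewrite qform_scale_sqrt // divr_gt0 ?mulr_gt0 ?sqrtr_gt0 //.
rewrite -(cos_acos k12) -(cos_acos k13) -(cos_acos k14).
rewrite -(cos_acos k23) -(cos_acos k24) -(cos_acos k34).
have ap (x : R) : -1 < x < 1 -> 0 < acos x by move=> /acos_itv/andP[].
apply: qform_angle_pos; rewrite ?ap //.
have q1 : 0 < Num.sqrt D1 by rewrite sqrtr_gt0.
have q2 : 0 < Num.sqrt D2 by rewrite sqrtr_gt0.
have q3 : 0 < Num.sqrt D3 by rewrite sqrtr_gt0.
have q4 : 0 < Num.sqrt D4 by rewrite sqrtr_gt0.
have z (e k l : R) : 0 < k -> 0 < l -> (e * (k * l)) ^+ 2 <= 0 -> e ^+ 2 <= 0.
  by move=> k0 l0; rewrite exprMn pmulr_lle0 // exprn_gt0 // mulr_gt0.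
rewrite ltNge; apply/negP => le0; move: e0; apply/negP; rewrite -leNgt.
move: le0.
have := z e12 _ _ q1 q2; have := sqr_ge0 (e12 * (Num.sqrt D1 * Num.sqrt D2)).
have := z e13 _ _ q1 q3; have := sqr_ge0 (e13 * (Num.sqrt D1 * Num.sqrt D3)).
have := z e14 _ _ q1 q4; have := sqr_ge0 (e14 * (Num.sqrt D1 * Num.sqrt D4)).
have := z e23 _ _ q2 q3; have := sqr_ge0 (e23 * (Num.sqrt D2 * Num.sqrt D3)).
have := z e24 _ _ q2 q4; have := sqr_ge0 (e24 * (Num.sqrt D2 * Num.sqrt D4)).
have := z e34 _ _ q3 q4; have := sqr_ge0 (e34 * (Num.sqrt D3 * Num.sqrt D4)).
move: ((e12 * _) ^+ 2) ((e13 * _) ^+ 2) ((e14 * _) ^+ 2) ((e23 * _) ^+ 2)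
  ((e24 * _) ^+ 2) ((e34 * _) ^+ 2) => x12 x13 x14 x23 x24 x34.
clear => n34 i34 n24 i24 n23 i23 n14 i14 n13 i13 n12 i12 le0.
have := i12 ltac:(lra); have := i13 ltac:(lra); have := i14 ltac:(lra).
have := i23 ltac:(lra); have := i24 ltac:(lra); have := i34 ltac:(lra).
lra.
Qed.

End TetForm.

(** * The form as a derivative: identities between cofactors *)

Section AngleDerivative.
Variable R : realType.

(** Half the partial derivative of [tet_form] in the variable [eij], written with the edge [ij] in
    the first place so that one computation serves all six angles. *)
Definition tet_row (ij ik ih jk jh kh eij eik eih ejk ejh ekh : R) : R :=
  let Dk := face_disc ij jh ih in let Dh := face_disc ij jk ik in
  let Nik := cofac ik ij ih jk kh jh in let Nih := cofac ih ij ik jh kh jk in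
  let Njk := cofac jk ij jh ik kh ih in let Njh := cofac jh ij jk ih kh ik in
  qdiag (cofac ij ik ih jk jh kh) Nik Nih Njk Njh Dk Dh * eij + ekh
  - (Njk * eik + Nik * ejk) / Dh - (Njh * eih + Nih * ejh) / Dk.

Lemma tet_form_rows (c12 c13 c14 c23 c24 c34 e12 e13 e14 e23 e24 e34 : R) :
  tet_form c12 c13 c14 c23 c24 c34 e12 e13 e14 e23 e24 e34 =
  tet_row c12 c13 c14 c23 c24 c34 e12 e13 e14 e23 e24 e34 * e12
  + tet_row c13 c12 c14 c23 c34 c24 e13 e12 e14 e23 e34 e24 * e13
  + tet_row c14 c12 c13 c24 c34 c23 e14 e12 e13 e24 e34 e23 * e14
  + tet_row c23 c12 c24 c13 c34 c14 e23 e12 e24 e13 e34 e14 * e23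
  + tet_row c24 c12 c23 c14 c34 c13 e24 e12 e23 e14 e34 e13 * e24
  + tet_row c34 c13 c23 c14 c24 c12 e34 e13 e23 e14 e24 e12 * e34.
Proof.
rewrite /tet_form /tet_row /=.
rewrite !(face_disc_perm c23 c34 c24) !(face_disc_perm c13 c34 c14).
rewrite !(face_disc_perm c12 c24 c14) !(face_disc_perm c12 c23 c13).
rewrite !(cofac_perm c12 c13 c14) !(cofac_perm c13 c12 c14) !(cofac_perm c23 c12 c24).
rewrite !(cofac_perm c14 c12 c13) !(cofac_perm c24 c12 c23) !(cofac_perm c34 c13 c23).
rewrite /qform.
move: (face_disc c23 _ _) (face_disc c13 _ _) (face_disc c12 c24 _)
  (face_disc c12 c23 _) => D1 D2 D3 D4.
move: (cofac c12 _ _ _ _ _) (cofac c13 _ _ _ _ _) (cofac c14 _ _ _ _ _)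
  (cofac c23 _ _ _ _ _) (cofac c24 _ _ _ _ _) (cofac c34 _ _ _ _ _).
move=> p12 p13 p14 p23 p24 p34.
ring.
Qed.

Definition dface_disc (x y z dx dy dz : R) : R :=
  2 * ((y * z + x) * dx + (x * z + y) * dy + (x * y + z) * dz).

Definition dcofac (ij ik ih jk jh kh dij dik dih djk djh dkh : R) : R :=
  (ik * jh + jk * ih - 2 * ij * kh) * dij + (ij * jh + ih) * dik
  + (ij * jk + ik) * dih + (ij * ih + jh) * djk + (ij * ik + jk) * djh
  + (1 - ij ^+ 2) * dkh.

(** The parenthesis on the left is the differential of the cosine [cofac / sqrt (Dk * Dh)],
    multiplied by this square root: the quotients by the discriminants come from differentiating the
    denominator logarithmically. *)
Lemma tet_rowE (ij ik ih jk jh kh eij eik eih ejk ejh ekh : R) :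
  1 < ij -> 1 <= ik -> 1 <= ih -> 1 <= jk -> 1 <= jh ->
  gram_det ij ik ih jk jh kh < 0 ->
  - (dcofac ij ik ih jk jh kh eij eik eih ejk ejh ekh
     - cofac ij ik ih jk jh kh / 2 *
       (dface_disc ij jk ik eij ejk eik / face_disc ij jk ik
        + dface_disc ij jh ih eij ejh eih / face_disc ij jh ih)) =
  (ij ^+ 2 - 1) * tet_row ij ik ih jk jh kh eij eik eih ejk ejh ekh.
Proof.
move=> ij1 ik1 ih1 jk1 jh1 g0.
have Dk0 : 0 < face_disc ij jh ih by rewrite face_disc_gt0 // ltW.
have Dh0 : 0 < face_disc ij jk ik by rewrite face_disc_gt0 // ltW.
have s0 : 0 < ij ^+ 2 - 1 by nra.
rewrite /tet_row /=.
have sq := cofac_sqr ij ik ih jk jh kh.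
set g := gram_det ij ik ih jk jh kh in g0 sq *.
set N := cofac ij ik ih jk jh kh in sq *.
set Nik := cofac ik _ _ _ _ _; set Nih := cofac ih _ _ _ _ _.
set Njk := cofac jk _ _ _ _ _; set Njh := cofac jh _ _ _ _ _.
pose Nkh := cofac kh ik jk ih jh ij.
have Eik : (ij * jh + ih) * face_disc ij jk ik - N * (ij * jk + ik) = (ij ^+ 2 - 1) * Njk.
  by rewrite /N /Njk /cofac /face_disc; ring.
have Ejk : (ij * ih + jh) * face_disc ij jk ik - N * (ij * ik + jk) = (ij ^+ 2 - 1) * Nik.
  by rewrite /N /Nik /cofac /face_disc; ring.
have Eih : (ij * jk + ik) * face_disc ij jh ih - N * (ij * jh + ih) = (ij ^+ 2 - 1) * Njh.
  by rewrite /N /Njh /cofac /face_disc; ring.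
have Ejh : (ij * ik + jk) * face_disc ij jh ih - N * (ij * ih + jh) = (ij ^+ 2 - 1) * Nih.
  by rewrite /N /Nih /cofac /face_disc; ring.
have I1 : Njk * Nik = - face_disc ij jk ik * Nkh - g * (ij + ik * jk).
  by rewrite /Njk /Nik /Nkh /g /cofac /face_disc /gram_det; ring.
have I2 : Njh * Nih = - face_disc ij jh ih * Nkh - g * (ij + ih * jh).
  by rewrite /Njh /Nih /Nkh /g /cofac /face_disc /gram_det; ring.
have I3 : Njh * Nik + Nih * Njk = 2 * N * Nkh + g * (ik * jh + jk * ih - 2 * ij * kh).
  by rewrite /N /Njh /Nih /Njk /Nik /Nkh /g /cofac /gram_det; ring.
have Q : (ij ^+ 2 - 1) * qdiag N Nik Nih Njk Njh (face_disc ij jh ih) (face_disc ij jk ik) =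
    - (ik * jh + jk * ih - 2 * ij * kh - N * ((ij + ih * jh) / face_disc ij jh ih
        + (ij + ik * jk) / face_disc ij jk ik)).
  rewrite /qdiag I1 I2 I3 (mulrC (face_disc ij jh ih)) sq.
  by field; rewrite (gt_eqF Dh0) (gt_eqF Dk0) (gt_eqF s0) (lt_eqF g0).
transitivity ((ij ^+ 2 - 1) *
    qdiag N Nik Nih Njk Njh (face_disc ij jh ih) (face_disc ij jk ik) * eij
  + (ij ^+ 2 - 1) * ekh
  - ((ij ^+ 2 - 1) * Njk * eik + (ij ^+ 2 - 1) * Nik * ejk) / face_disc ij jk ik
  - ((ij ^+ 2 - 1) * Njh * eih + (ij ^+ 2 - 1) * Nih * ejh) / face_disc ij jh ih);
  last by ring.
rewrite Q -Eik -Ejk -Eih -Ejh /dcofac /dface_disc.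
move: (face_disc ij jk ik) (face_disc ij jh ih) Dh0 Dk0 N {Eik Ejk Eih Ejh I1 I2 I3 sq Q}.
by move=> Dh Dk Dh0 Dk0 N; field; rewrite !gt_eqF.
Qed.

End AngleDerivative.

(** * Derivatives of the dihedral angles *)

Section AngleDerivative.
Variable R : realType.
Implicit Types (f g : R -> R) (s : R).

Lemma is_derive_mul f g s (a b : R) : is_derive s 1 f a -> is_derive s 1 g b ->
  is_derive s 1 (fun t => f t * g t) (f s * b + g s * a).
Proof. by move=> fa gb; exact: is_deriveM. Qed.

Lemma is_derive_div f g s (a b : R) : g s != 0 ->
  is_derive s 1 f a -> is_derive s 1 g b ->
  is_derive s 1 (fun t => f t / g t) ((a - f s / g s * b) / g s).
Proof.
move=> g0 fa gb.
apply: (is_derive_eq (is_derive_mul fa (is_deriveV g0 gb))).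
by rewrite /GRing.scale /=; field.
Qed.

Lemma is_derive_face_disc f g h s (a b c : R) :
  is_derive s 1 f a -> is_derive s 1 g b -> is_derive s 1 h c ->
  is_derive s 1 (fun t => face_disc (f t) (g t) (h t))
    (dface_disc (f s) (g s) (h s) a b c).
Proof.
move=> fa gb hc; rewrite /face_disc; apply: is_derive_eq.
rewrite /dface_disc /GRing.scale /=; ring.
Qed.

Lemma is_derive_cofac f1 f2 f3 f4 f5 f6 s (a1 a2 a3 a4 a5 a6 : R) :
  is_derive s 1 f1 a1 -> is_derive s 1 f2 a2 -> is_derive s 1 f3 a3 ->
  is_derive s 1 f4 a4 -> is_derive s 1 f5 a5 -> is_derive s 1 f6 a6 ->
  is_derive s 1 (fun t => cofac (f1 t) (f2 t) (f3 t) (f4 t) (f5 t) (f6 t))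
    (dcofac (f1 s) (f2 s) (f3 s) (f4 s) (f5 s) (f6 s) a1 a2 a3 a4 a5 a6).
Proof.
move=> h1 h2 h3 h4 h5 h6; rewrite /cofac; apply: is_derive_eq.
rewrite /dcofac /GRing.scale /=; ring.
Qed.

Definition cosphi (ij ik ih jk jh kh : R) : R :=
  cofac ij ik ih jk jh kh / Num.sqrt (face_disc ij jk ik * face_disc ij jh ih).

Lemma cosphi_itv (ij ik ih jk jh kh : R) :
  1 < ij -> 1 <= ik -> 1 <= ih -> 1 <= jk -> 1 <= jh ->
  gram_det ij ik ih jk jh kh < 0 -> -1 < cosphi ij ik ih jk jh kh < 1.
Proof.
move=> h1 h2 h3 h4 h5 g0.
have Dk0 : 0 < face_disc ij jh ih by rewrite face_disc_gt0 // ltW.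
have Dh0 : 0 < face_disc ij jk ik by rewrite face_disc_gt0 // ltW.
rewrite /cosphi sqrtrM ?ltW //; apply: cofac_ratio_itv => //.
by rewrite cofac_sqr mulr_gt0 //; [lra | nra].
Qed.

(** By [cofac_sqr], a nonnegative determinant makes the square of the cofactor at least the product
    of the two discriminants. *)
Lemma cosphi_out (ij ik ih jk jh kh : R) :
  1 <= ij -> 1 <= ik -> 1 <= ih -> 1 <= jk -> 1 <= jh ->
  0 <= gram_det ij ik ih jk jh kh ->
  cosphi ij ik ih jk jh kh <= -1 \/ 1 <= cosphi ij ik ih jk jh kh.
Proof.
move=> h1 h2 h3 h4 h5 g0.
have Dk0 : 0 < face_disc ij jh ih by rewrite face_disc_gt0 // ltW.
have Dh0 : 0 < face_disc ij jk ik by rewrite face_disc_gt0 // ltW.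
have sq := cofac_sqr ij ik ih jk jh kh.
have le : face_disc ij jk ik * face_disc ij jh ih <= cofac ij ik ih jk jh kh ^+ 2.
  have : 0 <= gram_det ij ik ih jk jh kh * (ij ^+ 2 - 1) by rewrite mulr_ge0 //; nra.
  by move: sq; lra.
have D0 : 0 < face_disc ij jk ik * face_disc ij jh ih by rewrite mulr_gt0.
have : 1 <= `|cosphi ij ik ih jk jh kh|.
  rewrite /cosphi normrM normfV (ger0_norm (sqrtr_ge0 _)) ler_pdivlMr ?sqrtr_gt0 //.
  by rewrite mul1r -sqrtr_sqr ler_wsqrtr.
by rewrite ler_normr => /orP[?|?]; [right | left]; lra.
Qed.

(** By [cofac_sqr], the derivative of [acos] brings in the inverse square root of
    [- gram_det * (f1 ^+ 2 - 1)], up to the discriminants. It cancels half of the factor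
    [f1 ^+ 2 - 1] from [tet_rowE]. The remaining root will be the [sinh] that pairs with the
    direction of motion, and the determinant gives a factor shared by all edges. *)
Lemma is_derive_angle f1 f2 f3 f4 f5 f6 s (a1 a2 a3 a4 a5 a6 : R) :
  is_derive s 1 f1 a1 -> is_derive s 1 f2 a2 -> is_derive s 1 f3 a3 ->
  is_derive s 1 f4 a4 -> is_derive s 1 f5 a5 -> is_derive s 1 f6 a6 ->
  1 < f1 s -> 1 <= f2 s -> 1 <= f3 s -> 1 <= f4 s -> 1 <= f5 s ->
  gram_det (f1 s) (f2 s) (f3 s) (f4 s) (f5 s) (f6 s) < 0 ->
  is_derive s 1 (fun t => acos (cosphi (f1 t) (f2 t) (f3 t) (f4 t) (f5 t) (f6 t)))
    (Num.sqrt (f1 s ^+ 2 - 1)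
     * tet_row (f1 s) (f2 s) (f3 s) (f4 s) (f5 s) (f6 s) a1 a2 a3 a4 a5 a6
     / Num.sqrt (- gram_det (f1 s) (f2 s) (f3 s) (f4 s) (f5 s) (f6 s))).
Proof.
move=> d1 d2 d3 d4 d5 d6 h1 h2 h3 h4 h5 g0.
have Dk0 : 0 < face_disc (f1 s) (f5 s) (f3 s) by rewrite face_disc_gt0 // ltW.
have Dh0 : 0 < face_disc (f1 s) (f4 s) (f2 s) by rewrite face_disc_gt0 // ltW.
have D0 : 0 < face_disc (f1 s) (f4 s) (f2 s) * face_disc (f1 s) (f5 s) (f3 s).
  by rewrite mulr_gt0.
have dN := is_derive_cofac d1 d2 d3 d4 d5 d6.
have dD := is_derive_mul (is_derive_face_disc d1 d4 d2) (is_derive_face_disc d1 d5 d3).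
have dS := @is_derive1_comp _ Num.sqrt (fun t => face_disc (f1 t) (f4 t) (f2 t)
  * face_disc (f1 t) (f5 t) (f3 t)) s _ _ (is_derive1_sqrt D0) dD.
have S0 : 0 < Num.sqrt (face_disc (f1 s) (f4 s) (f2 s) * face_disc (f1 s) (f5 s) (f3 s)).
  by rewrite sqrtr_gt0.
have dq := @is_derive_div _ (fun t => Num.sqrt (face_disc (f1 t) (f4 t) (f2 t)
  * face_disc (f1 t) (f5 t) (f3 t))) s _ _ (lt0r_neq0 S0) dN dS.
have itv := cosphi_itv h1 h2 h3 h4 h5 g0.
have dA := @is_derive1_comp _ acos
  (fun t => cosphi (f1 t) (f2 t) (f3 t) (f4 t) (f5 t) (f6 t)) s _ _
  (is_derive1_acos itv) dq.
apply: (is_derive_eq dA).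
have row := tet_rowE a1 a2 a3 a4 a5 a6 h1 h2 h3 h4 h5 g0.
have s0 : 0 < f1 s ^+ 2 - 1 by nra.
have sq := cofac_sqr (f1 s) (f2 s) (f3 s) (f4 s) (f5 s) (f6 s).
have S2 := sqr_sqrtr (ltW D0).
rewrite /=.
have -> : 1 - (cofac (f1 s) (f2 s) (f3 s) (f4 s) (f5 s) (f6 s) /
    Num.sqrt (face_disc (f1 s) (f4 s) (f2 s) * face_disc (f1 s) (f5 s) (f3 s))) ^+ 2
   = (- gram_det (f1 s) (f2 s) (f3 s) (f4 s) (f5 s) (f6 s) * (f1 s ^+ 2 - 1)) /
     Num.sqrt (face_disc (f1 s) (f4 s) (f2 s) * face_disc (f1 s) (f5 s) (f3 s)) ^+ 2.
  by rewrite -sq expr_div_n S2; field; rewrite !gt_eqF.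
rewrite sqrtrM ?mulr_ge0 ?(ltW s0) //; last by lra.
rewrite sqrtrV ?sqr_ge0 // sqrtr_sqr (ger0_norm (sqrtr_ge0 _)) sqrtrM; last by lra.
have g1 : 0 < Num.sqrt (- gram_det (f1 s) (f2 s) (f3 s) (f4 s) (f5 s) (f6 s)).
  by rewrite sqrtr_gt0; lra.
have s1 : 0 < Num.sqrt (f1 s ^+ 2 - 1) by rewrite sqrtr_gt0.
have s2 := sqr_sqrtr (ltW s0).
move: row; rewrite -s2.
move: (Num.sqrt (f1 s ^+ 2 - 1)) s1 (Num.sqrt (- _)) g1 => q q0 r r0 row.
have -> : tet_row (f1 s) (f2 s) (f3 s) (f4 s) (f5 s) (f6 s) a1 a2 a3 a4 a5 a6 =
  q ^+ 2 * tet_row (f1 s) (f2 s) (f3 s) (f4 s) (f5 s) (f6 s) a1 a2 a3 a4 a5 a6 / q ^+ 2.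
  by field; rewrite gt_eqF.
rewrite -row.
move: (dcofac _ _ _ _ _ _ _ _ _ _ _ _) (cofac _ _ _ _ _ _) (dface_disc (f1 s) (f4 s) _ _ _ _)
  (dface_disc (f1 s) (f5 s) _ _ _ _) => dc N dh dk.
move: (Num.sqrt _) S0 S2 => S S0 S2.
move: (face_disc _ _ _) (face_disc _ _ _) Dk0 Dh0 S2 => Dk Dh Dk0 Dh0 S2.
rewrite sqrtr_sqr (gtr0_norm q0).
transitivity (- (dc - N / 2 * ((Dk * dk + Dh * dh) / S ^+ 2)) / (r * q)).
  by field; rewrite !gt_eqF.
by rewrite S2; field; rewrite !gt_eqF.
Qed.

End AngleDerivative.

Section Angles.
Variable R : realType.

Lemma is_derive_cosh (x : R) : is_derive x 1 (@cosh R) (sinh x).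
Proof.
rewrite /cosh; apply: is_derive_eq; rewrite /sinh /GRing.scale /=; ring.
Qed.

Lemma cosh_continuous : continuous (@cosh R).
Proof.
move=> x; apply: differentiable_continuous; apply/derivable1_diffP.
by have [] := is_derive_cosh x.
Qed.

Lemma sinh_continuous : continuous (@sinh R).
Proof.
move=> x; apply: differentiable_continuous; apply/derivable1_diffP.
rewrite /sinh; exact: ex_derive.
Qed.

Lemma cosh_gt1 (x : R) : 0 < x -> 1 < cosh x.
Proof.
move=> x0; rewrite lt_neqAle cosh_ge1 andbT eq_sym; apply/eqP => e.
by have := sinh_sqr x; rewrite e expr1n subrr => /eqP; rewrite sqrf_eq0 gt_eqF // sinh_gt0.
Qed.

Lemma cosh0 : cosh (0 : R) = 1.
Proof. by rewrite /cosh oppr0 expR0; field. Qed.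

Definition angle6 (ij ik ih jk jh kh : R) : R :=
  acos (clamp (cosphi (cosh (Num.max 0 ij)) (cosh (Num.max 0 ik))
    (cosh (Num.max 0 ih)) (cosh (Num.max 0 jk)) (cosh (Num.max 0 jh))
    (cosh (Num.max 0 kh)))).

Lemma cvg_angle6 T (F : set_system T) {FF : Filter F} (f1 f2 f3 f4 f5 f6 : T -> R)
    (a1 a2 a3 a4 a5 a6 : R) :
  f1 @ F --> a1 -> f2 @ F --> a2 -> f3 @ F --> a3 ->
  f4 @ F --> a4 -> f5 @ F --> a5 -> f6 @ F --> a6 ->
  (fun t => angle6 (f1 t) (f2 t) (f3 t) (f4 t) (f5 t) (f6 t)) @ F -->
    angle6 a1 a2 a3 a4 a5 a6.
Proof.
move=> h1 h2 h3 h4 h5 h6.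
have pc (f : T -> R) a : f @ F --> a ->
    (fun t => cosh (Num.max 0 (f t))) @ F --> cosh (Num.max 0 a).
  move=> fa; have cm : continuous (fun x : R => Num.max 0 x).
    move=> x; apply: (@continuous_max R R (fun=> 0) id); first exact: cst_continuous.
    exact: cvg_id.
  have fm := cvg_comp _ _ fa (cm a).
  exact: (cvg_comp _ _ fm (@cosh_continuous (Num.max 0 a))).
have {}h1 := pc _ _ h1; have {}h2 := pc _ _ h2; have {}h3 := pc _ _ h3.
have {}h4 := pc _ _ h4; have {}h5 := pc _ _ h5; have {}h6 := pc _ _ h6.
have hD := cvg_mul (FF := FF) (cvg_face_disc (FF := FF) h1 h4 h2)
  (cvg_face_disc (FF := FF) h1 h5 h3).
have hS := cvg_comp _ _ hD (@sqrt_continuous _ _).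
have S0 : Num.sqrt (face_disc (cosh (Num.max 0 a1)) (cosh (Num.max 0 a4))
    (cosh (Num.max 0 a2)) * face_disc (cosh (Num.max 0 a1)) (cosh (Num.max 0 a5))
    (cosh (Num.max 0 a3))) != 0.
  by rewrite gt_eqF // sqrtr_gt0 mulr_gt0 // face_disc_gt0 // cosh_ge1.
have hN := cvg_div (FF := FF) S0 (cvg_cofac (FF := FF) h1 h2 h3 h4 h5 h6) hS.
exact: (cvg_comp _ _ hN (@acos_clamp_continuous _ _)).
Qed.

Lemma angle6_ge0 (a1 a2 a3 a4 a5 a6 : R) : 0 <= angle6 a1 a2 a3 a4 a5 a6.
Proof. by rewrite /angle6 acos_ge0 // clamp_itv. Qed.

(** At length 0 the product of the discriminants is the perfect square of the cofactor
    [(ik + jk) * (ih + jh)], so the cosine is exactly 1. *)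
Lemma angle6_le0 (a1 a2 a3 a4 a5 a6 : R) : a1 <= 0 -> angle6 a1 a2 a3 a4 a5 a6 = 0.
Proof.
move=> a0; rewrite /angle6 (max_idPl a0) cosh0.
move: (cosh_ge1 (Num.max 0 a2)) (cosh_ge1 (Num.max 0 a3)) (cosh_ge1 (Num.max 0 a4))
  (cosh_ge1 (Num.max 0 a5)).
move: (cosh (Num.max 0 a2)) (cosh (Num.max 0 a3)) (cosh (Num.max 0 a4))
  (cosh (Num.max 0 a5)) (cosh (Num.max 0 a6)) => ik ih jk jh kh h1 h2 h3 h4.
have -> : cosphi 1 ik ih jk jh kh = 1.
  rewrite /cosphi.
  have -> : cofac 1 ik ih jk jh kh = (ik + jk) * (ih + jh) by rewrite /cofac; ring.
  have -> : face_disc 1 jk ik * face_disc 1 jh ih = ((ik + jk) * (ih + jh)) ^+ 2.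
    by rewrite /face_disc; ring.
  by rewrite sqrtr_sqr ger0_norm ?divff ?gt_eqF ?mulr_ge0 ?mulr_gt0; lra.
by rewrite clamp_ge1 // acos1.
Qed.

Lemma angle6_pos (a1 a2 a3 a4 a5 a6 : R) :
  0 <= a1 -> 0 <= a2 -> 0 <= a3 -> 0 <= a4 -> 0 <= a5 -> 0 <= a6 ->
  angle6 a1 a2 a3 a4 a5 a6 =
  acos (clamp (cosphi (cosh a1) (cosh a2) (cosh a3) (cosh a4) (cosh a5) (cosh a6))).
Proof. by move=> *; rewrite /angle6 !(max_idPr _). Qed.

Lemma angle6_flat (a1 a2 a3 a4 a5 a6 : R) :
  0 <= a1 -> 0 <= a2 -> 0 <= a3 -> 0 <= a4 -> 0 <= a5 -> 0 <= a6 ->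
  0 <= gram_det (cosh a1) (cosh a2) (cosh a3) (cosh a4) (cosh a5) (cosh a6) ->
  exists b : bool, angle6 a1 a2 a3 a4 a5 a6 = if b then pi else 0.
Proof.
move=> h1 h2 h3 h4 h5 h6 g0; rewrite angle6_pos //.
have [le|ge] := cosphi_out (cosh_ge1 a1) (cosh_ge1 a2) (cosh_ge1 a3) (cosh_ge1 a4)
  (cosh_ge1 a5) g0.
- by exists true; rewrite clamp_leN1 // acosN1.
- by exists false; rewrite clamp_ge1 // acos1.
Qed.

(** The hypotheses are open conditions. Near [s] neither the truncation at 0 nor the clamping acts,
    and [angle6] agrees with the differentiable expression of [is_derive_angle]. *)
Lemma is_derive_angle6 (s a1 a2 a3 a4 a5 a6 u1 u2 u3 u4 u5 u6 : R) :
  let x1 := a1 + s * u1 in let x2 := a2 + s * u2 in let x3 := a3 + s * u3 in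
  let x4 := a4 + s * u4 in let x5 := a5 + s * u5 in let x6 := a6 + s * u6 in
  0 < x1 -> 0 < x2 -> 0 < x3 -> 0 < x4 -> 0 < x5 -> 0 < x6 ->
  gram_det (cosh x1) (cosh x2) (cosh x3) (cosh x4) (cosh x5) (cosh x6) < 0 ->
  is_derive s 1 (fun t => angle6 (a1 + t * u1) (a2 + t * u2) (a3 + t * u3)
      (a4 + t * u4) (a5 + t * u5) (a6 + t * u6))
    (sinh x1 * tet_row (cosh x1) (cosh x2) (cosh x3) (cosh x4) (cosh x5) (cosh x6)
      (sinh x1 * u1) (sinh x2 * u2) (sinh x3 * u3) (sinh x4 * u4) (sinh x5 * u5)
      (sinh x6 * u6)
     / Num.sqrt (- gram_det (cosh x1) (cosh x2) (cosh x3) (cosh x4) (cosh x5) (cosh x6))).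
Proof.
move=> x1 x2 x3 x4 x5 x6 p1 p2 p3 p4 p5 p6 g0.
have dl a u : is_derive s 1 (fun t => a + t * u) u.
  by apply: is_derive_eq; rewrite /GRing.scale /= mulr1; ring.
have dc a u : is_derive s 1 (fun t => cosh (a + t * u)) (sinh (a + s * u) * u).
  exact: (@is_derive1_comp _ (@cosh R) (fun t => a + t * u) s _ _ (is_derive_cosh _) (dl a u)).
have pos a u : 0 < a + s * u -> \forall t \near s, 0 < a + t * u.
  move=> p; have [d _] := dl a u.
  have /differentiable_continuous c := (@derivable1_diffP _ _ _ s).1 d.
  exact: (@cvgr_gt _ _ _ _ _ _ c _ p).
have dA := is_derive_angle (dc a1 u1) (dc a2 u2) (dc a3 u3) (dc a4 u4) (dc a5 u5)
  (dc a6 u6) (cosh_gt1 p1) (ltW (cosh_gt1 p2)) (ltW (cosh_gt1 p3)) (ltW (cosh_gt1 p4))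
  (ltW (cosh_gt1 p5)) g0.
have itv := cosphi_itv (cosh_gt1 p1) (ltW (cosh_gt1 p2)) (ltW (cosh_gt1 p3)) (ltW (cosh_gt1 p4))
  (ltW (cosh_gt1 p5)) g0.
move: dA; rewrite -sinh_sqr sqrtr_sqr (gtr0_norm (sinh_gt0 p1)).
apply: near_eq_is_derive.
have cc a u : (fun t => cosh (a + t * u)) @ s --> cosh (a + s * u).
  have [d _] := dc a u.
  exact: (differentiable_continuous ((@derivable1_diffP _ _ _ s).1 d)).
have gn : \forall t \near s, gram_det (cosh (a1 + t * u1)) (cosh (a2 + t * u2))
    (cosh (a3 + t * u3)) (cosh (a4 + t * u4)) (cosh (a5 + t * u5))
    (cosh (a6 + t * u6)) < 0.
  have := cvg_gram_det (FF := nbhs_filter s) (cc a1 u1) (cc a2 u2) (cc a3 u3)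
    (cc a4 u4) (cc a5 u5) (cc a6 u6).
  by move=> cg; exact: (@cvgr_lt _ _ _ _ _ _ cg _ g0).
near=> t.
have t1 : 0 < a1 + t * u1 by near: t; exact: pos.
have t2 : 0 < a2 + t * u2 by near: t; exact: pos.
have t3 : 0 < a3 + t * u3 by near: t; exact: pos.
have t4 : 0 < a4 + t * u4 by near: t; exact: pos.
have t5 : 0 < a5 + t * u5 by near: t; exact: pos.
have t6 : 0 < a6 + t * u6 by near: t; exact: pos.
have gt0 : gram_det (cosh (a1 + t * u1)) (cosh (a2 + t * u2)) (cosh (a3 + t * u3))
    (cosh (a4 + t * u4)) (cosh (a5 + t * u5)) (cosh (a6 + t * u6)) < 0.
  by near: t; exact: gn.
rewrite angle6_pos ?ltW // clamp_id //.
have /andP[] := cosphi_itv (cosh_gt1 t1) (ltW (cosh_gt1 t2)) (ltW (cosh_gt1 t3))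
  (ltW (cosh_gt1 t4)) (ltW (cosh_gt1 t5)) gt0.
by move=> ? ?; rewrite !ltW.
Unshelve. all: by end_near. Qed.

End Angles.

Section AngleVector.
Variable R : realType.
Implicit Types (x y z u : 'rV[R]_6) (s t : R).

Definition angdot x u : R :=
  angle6 (crd x 0) (crd x 1) (crd x 2) (crd x 3) (crd x 4) (crd x 5) * crd u 0
  + angle6 (crd x 1) (crd x 0) (crd x 2) (crd x 3) (crd x 5) (crd x 4) * crd u 1
  + angle6 (crd x 2) (crd x 0) (crd x 1) (crd x 4) (crd x 5) (crd x 3) * crd u 2
  + angle6 (crd x 3) (crd x 0) (crd x 4) (crd x 1) (crd x 5) (crd x 2) * crd u 3
  + angle6 (crd x 4) (crd x 0) (crd x 3) (crd x 2) (crd x 5) (crd x 1) * crd u 4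
  + angle6 (crd x 5) (crd x 1) (crd x 3) (crd x 2) (crd x 4) (crd x 0) * crd u 5.

Definition gdet x : R := gram_det (cosh (crd x 0)) (cosh (crd x 1)) (cosh (crd x 2))
  (cosh (crd x 3)) (cosh (crd x 4)) (cosh (crd x 5)).

Definition nondegenerate x : Prop := (forall k, (k < 6)%N -> 0 < crd x k) /\ gdet x < 0.

Definition angdot_slope x u : R :=
  tet_form (cosh (crd x 0)) (cosh (crd x 1)) (cosh (crd x 2)) (cosh (crd x 3))
    (cosh (crd x 4)) (cosh (crd x 5))
    (sinh (crd x 0) * crd u 0) (sinh (crd x 1) * crd u 1) (sinh (crd x 2) * crd u 2)
    (sinh (crd x 3) * crd u 3) (sinh (crd x 4) * crd u 4) (sinh (crd x 5) * crd u 5)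
  / Num.sqrt (- gdet x).

Lemma crdD x y k : crd (x + y) k = crd x k + crd y k.
Proof. by rewrite /crd mxE. Qed.

Lemma crdB x y k : crd (x - y) k = crd x k - crd y k.
Proof. by rewrite /crd !mxE. Qed.

Lemma crdZ t x k : crd (t *: x) k = t * crd x k.
Proof. by rewrite /crd mxE. Qed.

Lemma sqnorm_ge0 x : 0 <= sqnorm x.
Proof. by rewrite /sqnorm !addr_ge0 ?sqr_ge0. Qed.

Lemma sqnormZ t x : sqnorm (t *: x) = t ^+ 2 * sqnorm x.
Proof. rewrite /sqnorm !crdZ; ring. Qed.

Lemma sqnorm_eq0 x : sqnorm x = 0 -> x = 0.
Proof.
move=> x0; apply/rowP => k; rewrite mxE; apply/eqP.
have := crd_sqr_le x (ltn_ord k).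
by rewrite x0 /crd inord_val => le; rewrite -sqrf_eq0 eq_le le sqr_ge0.
Qed.

Lemma is_derive_angdot y u s : nondegenerate (y + s *: u) ->
  is_derive s 1 (fun t => angdot (y + t *: u) u) (angdot_slope (y + s *: u) u).
Proof.
move=> [pos g0]; have {}pos k : (k < 6)%N -> 0 < crd y k + s * crd u k.
  by move=> k6; have := pos k k6; rewrite crdD crdZ.
have p0 := pos 0%N isT; have p1 := pos 1%N isT; have p2 := pos 2%N isT.
have p3 := pos 3%N isT; have p4 := pos 4%N isT; have p5 := pos 5%N isT.
move: g0; rewrite /angdot_slope /gdet !crdD !crdZ => g0.
have -> : (fun t => angdot (y + t *: u) u) = fun t =>
    angle6 (crd y 0 + t * crd u 0) (crd y 1 + t * crd u 1) (crd y 2 + t * crd u 2)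
      (crd y 3 + t * crd u 3) (crd y 4 + t * crd u 4) (crd y 5 + t * crd u 5) * crd u 0
  + angle6 (crd y 1 + t * crd u 1) (crd y 0 + t * crd u 0) (crd y 2 + t * crd u 2)
      (crd y 3 + t * crd u 3) (crd y 5 + t * crd u 5) (crd y 4 + t * crd u 4) * crd u 1
  + angle6 (crd y 2 + t * crd u 2) (crd y 0 + t * crd u 0) (crd y 1 + t * crd u 1)
      (crd y 4 + t * crd u 4) (crd y 5 + t * crd u 5) (crd y 3 + t * crd u 3) * crd u 2
  + angle6 (crd y 3 + t * crd u 3) (crd y 0 + t * crd u 0) (crd y 4 + t * crd u 4)
      (crd y 1 + t * crd u 1) (crd y 5 + t * crd u 5) (crd y 2 + t * crd u 2) * crd u 3
  + angle6 (crd y 4 + t * crd u 4) (crd y 0 + t * crd u 0) (crd y 3 + t * crd u 3)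
      (crd y 2 + t * crd u 2) (crd y 5 + t * crd u 5) (crd y 1 + t * crd u 1) * crd u 4
  + angle6 (crd y 5 + t * crd u 5) (crd y 1 + t * crd u 1) (crd y 3 + t * crd u 3)
      (crd y 2 + t * crd u 2) (crd y 4 + t * crd u 4) (crd y 0 + t * crd u 0) * crd u 5.
  by apply/funext => t; rewrite /angdot !crdD !crdZ.
move: p0 p1 p2 p3 p4 p5 g0.
move: (crd y 0) (crd y 1) (crd y 2) (crd y 3) (crd y 4) (crd y 5) (crd u 0) (crd u 1)
  (crd u 2) (crd u 3) (crd u 4) (crd u 5).
move=> a0 a1 a2 a3 a4 a5 u0 u1 u2 u3 u4 u5 p0 p1 p2 p3 p4 p5 g0.
set g := gram_det _ _ _ _ _ _ in g0 *.
have e1 : gram_det (cosh (a1 + s * u1)) (cosh (a0 + s * u0)) (cosh (a2 + s * u2))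
  (cosh (a3 + s * u3)) (cosh (a5 + s * u5)) (cosh (a4 + s * u4)) = g.
  by rewrite (gram_det_perm (cosh (a0 + _)) (cosh (a1 + _)) (cosh (a2 + _))).
have e2 : gram_det (cosh (a2 + s * u2)) (cosh (a0 + s * u0)) (cosh (a1 + s * u1))
  (cosh (a4 + s * u4)) (cosh (a5 + s * u5)) (cosh (a3 + s * u3)) = g.
  by rewrite (gram_det_perm (cosh (a0 + _)) (cosh (a1 + _)) (cosh (a2 + _))).
have e3 : gram_det (cosh (a3 + s * u3)) (cosh (a0 + s * u0)) (cosh (a4 + s * u4))
  (cosh (a1 + s * u1)) (cosh (a5 + s * u5)) (cosh (a2 + s * u2)) = g.
  by rewrite (gram_det_perm (cosh (a0 + _)) (cosh (a1 + _)) (cosh (a2 + _))).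
have e4 : gram_det (cosh (a4 + s * u4)) (cosh (a0 + s * u0)) (cosh (a3 + s * u3))
  (cosh (a2 + s * u2)) (cosh (a5 + s * u5)) (cosh (a1 + s * u1)) = g.
  by rewrite (gram_det_perm (cosh (a0 + _)) (cosh (a1 + _)) (cosh (a2 + _))).
have e5 : gram_det (cosh (a5 + s * u5)) (cosh (a1 + s * u1)) (cosh (a3 + s * u3))
  (cosh (a2 + s * u2)) (cosh (a4 + s * u4)) (cosh (a0 + s * u0)) = g.
  by rewrite (gram_det_perm (cosh (a0 + _)) (cosh (a1 + _)) (cosh (a2 + _))).
have d0 := is_derive_angle6 p0 p1 p2 p3 p4 p5 g0.
have := is_derive_angle6 p1 p0 p2 p3 p5 p4; rewrite e1 => /(_ g0) d1.
have := is_derive_angle6 p2 p0 p1 p4 p5 p3; rewrite e2 => /(_ g0) d2.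
have := is_derive_angle6 p3 p0 p4 p1 p5 p2; rewrite e3 => /(_ g0) d3.
have := is_derive_angle6 p4 p0 p3 p2 p5 p1; rewrite e4 => /(_ g0) d4.
have := is_derive_angle6 p5 p1 p3 p2 p4 p0; rewrite e5 => /(_ g0) d5.
apply: is_derive_eq.
rewrite tet_form_rows /GRing.scale /= -/g; move: (tet_row (cosh (a0 + _)) _ _ _ _ _ _ _ _ _ _ _)
  (tet_row (cosh (a1 + _)) _ _ _ _ _ _ _ _ _ _ _) (tet_row (cosh (a2 + _)) _ _ _ _ _ _ _ _ _ _ _)
  (tet_row (cosh (a3 + _)) _ _ _ _ _ _ _ _ _ _ _) (tet_row (cosh (a4 + _)) _ _ _ _ _ _ _ _ _ _ _)
  (tet_row (cosh (a5 + _)) _ _ _ _ _ _ _ _ _ _ _) ((Num.sqrt _)^-1).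
move=> r0 r1 r2 r3 r4 r5 q; ring.
Qed.

Lemma angdot_slope_gt0 x u : nondegenerate x -> 0 < sqnorm u -> 0 < angdot_slope x u.
Proof.
move=> [pos g0] u0; rewrite /angdot_slope divr_gt0 ?sqrtr_gt0 //; last by lra.
have c1 k : (k < 6)%N -> 1 < cosh (crd x k) by move=> k6; exact/cosh_gt1/pos.
apply: tet_form_gt0; rewrite ?c1 //.
rewrite ltNge; apply/negP => le.
have e0 k : (k < 6)%N -> 0 < sinh (crd x k) by move=> k6; exact/sinh_gt0/pos.
have z k : (k < 6)%N -> (sinh (crd x k) * crd u k) ^+ 2 <= 0 -> crd u k ^+ 2 <= 0.
  by move=> k6; rewrite exprMn pmulr_rle0 // exprn_gt0 // e0.
move: u0; rewrite ltNge => /negP; apply; rewrite /sqnorm.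
move: le (z 0%N isT) (z 1%N isT) (z 2%N isT) (z 3%N isT) (z 4%N isT) (z 5%N isT).
have := sqr_ge0 (sinh (crd x 0) * crd u 0); have := sqr_ge0 (sinh (crd x 1) * crd u 1).
have := sqr_ge0 (sinh (crd x 2) * crd u 2); have := sqr_ge0 (sinh (crd x 3) * crd u 3).
have := sqr_ge0 (sinh (crd x 4) * crd u 4); have := sqr_ge0 (sinh (crd x 5) * crd u 5).
move: ((sinh (crd x 0) * _) ^+ 2) ((sinh (crd x 1) * _) ^+ 2) ((sinh (crd x 2) * _) ^+ 2)
  ((sinh (crd x 3) * _) ^+ 2) ((sinh (crd x 4) * _) ^+ 2) ((sinh (crd x 5) * _) ^+ 2).
clear => x0 x1 x2 x3 x4 x5 n5 n4 n3 n2 n1 n0 le i0 i1 i2 i3 i4 i5.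
have := i0 ltac:(lra); have := i1 ltac:(lra); have := i2 ltac:(lra).
have := i3 ltac:(lra); have := i4 ltac:(lra); have := i5 ltac:(lra).
lra.
Qed.

Lemma cvg_angdot T (F : set_system T) {FF : Filter F} (f g : T -> 'rV[R]_6) x u :
  (forall k, (fun a => crd (f a) k) @ F --> crd x k) ->
  (forall k, (fun a => crd (g a) k) @ F --> crd u k) ->
  (fun a => angdot (f a) (g a)) @ F --> angdot x u.
Proof.
move=> fx gu; rewrite /angdot; do 5?[refine (cvg_add _ _)];
  (refine (cvg_mul _ _); [exact: cvg_angle6 | exact: gu]).
Qed.

(** The pairings of [u] with all choices of angles 0 or pi: at most 64 numbers, the same for every
    base point, so that one finite list serves a whole line. *)
Definition flat_values u : seq R :=
  codom (fun b : bool * bool * bool * bool * bool * bool =>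
    (if b.1.1.1.1.1 then pi else 0) * crd u 0 + (if b.1.1.1.1.2 then pi else 0) * crd u 1
  + (if b.1.1.1.2 then pi else 0) * crd u 2 + (if b.1.1.2 then pi else 0) * crd u 3
  + (if b.1.2 then pi else 0) * crd u 4 + (if b.2 then pi else 0) * crd u 5).

Lemma angdot_flat x u : (forall k, (k < 6)%N -> 0 < crd x k) -> 0 <= gdet x ->
  angdot x u \in flat_values u.
Proof.
move=> pos; have {}pos k : (k < 6)%N -> 0 <= crd x k by move=> k6; exact/ltW/pos.
have p0 := pos 0%N isT; have p1 := pos 1%N isT; have p2 := pos 2%N isT.
have p3 := pos 3%N isT; have p4 := pos 4%N isT; have p5 := pos 5%N isT.
rewrite /gdet /angdot => g0.
have [b0 ->] := angle6_flat p0 p1 p2 p3 p4 p5 g0.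
have [|b1 ->] := angle6_flat p1 p0 p2 p3 p5 p4.
  by rewrite (gram_det_perm (cosh (crd x 0)) (cosh (crd x 1)) (cosh (crd x 2))).
have [|b2 ->] := angle6_flat p2 p0 p1 p4 p5 p3.
  by rewrite (gram_det_perm (cosh (crd x 0)) (cosh (crd x 1)) (cosh (crd x 2))).
have [|b3 ->] := angle6_flat p3 p0 p4 p1 p5 p2.
  by rewrite (gram_det_perm (cosh (crd x 0)) (cosh (crd x 1)) (cosh (crd x 2))).
have [|b4 ->] := angle6_flat p4 p0 p3 p2 p5 p1.
  by rewrite (gram_det_perm (cosh (crd x 0)) (cosh (crd x 1)) (cosh (crd x 2))).
have [|b5 ->] := angle6_flat p5 p1 p3 p2 p4 p0.
  by rewrite (gram_det_perm (cosh (crd x 0)) (cosh (crd x 1)) (cosh (crd x 2))).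
by apply/codomP; exists (b0, b1, b2, b3, b4, b5).
Qed.

End AngleVector.

(** * Monotonicity of the angles *)

Section Monotone.
Variable R : realType.

(** By induction an open subinterval free of the listed values is kept; a new value is avoided by
    passing to the half that does not contain it. The witness is the last midpoint. *)
Lemma avoid_finite (V : seq R) (a b : R) : a < b -> exists2 y, a < y < b & y \notin V.
Proof.
move=> ab; suff [a' [b' [h1 h2 h3 hV]]] : exists a' b', [/\ a <= a', a' < b', b' <= b &
    forall v, v \in V -> (v <= a') || (b' <= v)].
  exists ((a' + b') / 2); first by apply/andP; split; lra.
  by apply/negP => /hV /orP[]; lra.
elim: V => [|v V [a' [b' [h1 h2 h3 hV]]]]; first by exists a, b.
have [va|va] := leP v ((a' + b') / 2).
  exists ((a' + b') / 2), b'; split; try lra.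
  move=> w; rewrite inE => /predU1P[->|/hV]; first by rewrite va.
  by move=> /orP[?|->]; rewrite ?orbT //; apply/orP; left; lra.
exists a', ((a' + b') / 2); split; try lra.
move=> w; rewrite inE => /predU1P[->|/hV]; first by rewrite (ltW va) orbT.
by move=> /orP[->//|?]; apply/orP; right; lra.
Qed.

Lemma derive_gt0_right (F : R -> R) (s d e : R) : is_derive s 1 F d -> 0 < d -> 0 < e ->
  exists2 h, 0 < h < e & F s < F (s + h).
Proof.
move=> [dF Fd] d0 e0; have := dF; rewrite /derivable => /cvg_ex[l cl].
have ld : l = d by rewrite -Fd; exact/esym/cvg_lim.
rewrite ld in cl.
have : nbhs (0 : R) (fun h => h != 0 -> 0 < h^-1 *: (F (h *: 1 + s) - F s)).
  exact: (@cvgr_gt _ _ _ _ _ _ cl _ d0).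
move=> /nbhs_ballP[r /= r0 hr].
pose h := Num.min (e / 2) (r / 2).
have h0 : 0 < h by rewrite lt_min !divr_gt0.
have he : h <= e / 2 by rewrite ge_min lexx.
have hr2 : h <= r / 2 by rewrite ge_min lexx orbT.
exists h; first by rewrite h0 /=; lra.
have := hr h; rewrite /ball /= sub0r normrN gtr0_norm // => /(_ ltac:(lra) (lt0r_neq0 h0)).
by rewrite /GRing.scale /= mulr1 pmulr_rgt0 ?invr_gt0 // subr_gt0 addrC.
Qed.

(** If [F 1 < F 0], choose a level [y] between them outside [V]. At the last point [s] with
    [y <= F s] the value is exactly [y], so the derivative is positive there and [F] exceeds [y]
    just after [s], a contradiction. *)
Lemma nondecreasing_off_values (F : R -> R) (V : seq R) : continuous F ->
  (forall s, 0 <= s < 1 -> F s \in V \/ exists2 d, 0 < d & is_derive s 1 F d) ->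
  F 0 <= F 1.
Proof.
move=> cF hF; rewrite leNgt; apply/negP => F10.
have [y /andP[y1 y0] yV] := avoid_finite V F10.
pose K := `[0, 1]%classic `&` [set s : R | y <= F s].
have cK : compact K.
  apply: (@subclosed_compact _ K (`[(0 : R), 1]%classic)).
  - apply: closedI; first exact: interval_closed.
    by move/continuous_closedP : cF => /(_ [set x | y <= x]); apply; exact: closed_ge.
  - exact: segment_compact.
  - by move=> ? [].
have K0 : K !=set0 by exists 0; split => /=; [rewrite in_itv /= lexx ler01 | exact: ltW].
have [s /set_mem[/=]] := @compact_EVT_max _ R id K K0 cK
  (continuous_subspaceT (fun x => @cvg_id _ (nbhs x))).
rewrite in_itv /= => /andP[s0 s1] yFs smax.
have {}s1 : s < 1.
  by rewrite lt_neqAle s1 andbT; apply/eqP => e; move: y1; rewrite -e ltNge yFs.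
have below t : s < t -> t <= 1 -> F t < y.
  move=> st t1; rewrite ltNge; apply/negP => yt.
  have : t <= s by apply: smax; apply/mem_set; split => //=; rewrite in_itv /= t1 andbT; lra.
  by rewrite leNgt st.
have Fsy : F s = y.
  apply/eqP; rewrite eq_le yFs andbT leNgt; apply/negP => ys.
  have : nbhs s (fun t => y < F t) by exact: (@cvgr_gt _ _ _ _ _ _ (cF s) _ ys).
  move=> /nbhs_ballP[e /= e0 he].
  pose t := Num.min 1 (s + e / 2).
  have st : s < t by rewrite lt_min s1 /=; lra.
  have [t1 te] : t <= 1 /\ t <= s + e / 2 by rewrite !ge_min !lexx orbT.
  have := he t; rewrite /ball /= ltr0_norm; last by lra.
  by move=> /(_ ltac:(lra)); rewrite ltNge ltW // below.
have [] := hF s; first by rewrite s0.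
  by rewrite Fsy (negbTE yV).
move=> [d d0 dF].
have [h /andP[h0 h1]] := derive_gt0_right dF d0 (ltac:(lra) : 0 < 1 - s).
by rewrite Fsy ltNge ltW // below; lra.
Qed.

End Monotone.

Section AngleMonotone.
Variable R : realType.
Implicit Types (x y z u : 'rV[R]_6) (s t : R).

Lemma angdot_line_continuous y u : continuous (fun t => angdot (y + t *: u) u).
Proof.
move=> t; apply: (@cvg_angdot _ _ (nbhs t) (nbhs_filter t) (fun t => y + t *: u) (fun=> u)) => k.
  under eq_fun do rewrite crdD crdZ.
  rewrite crdD crdZ; apply: (@cvg_add _ _ (nbhs t) (nbhs_filter t) (fun=> crd y k)).
    exact: (@cvg_cst _ _ _ (nbhs t) (nbhs_filter t)).
  apply: (@cvg_mul _ _ (nbhs t) (nbhs_filter t) id (fun=> crd u k)).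
    exact: (@cvg_id _ (nbhs t)).
  exact: (@cvg_cst _ _ _ (nbhs t) (nbhs_filter t)).
exact: (@cvg_cst _ _ _ (nbhs t) (nbhs_filter t)).
Qed.

Lemma angdotZ x t u : angdot x (t *: u) = t * angdot x u.
Proof.
rewrite /angdot !crdZ.
move: (angle6 (crd x 0) _ _ _ _ _) (angle6 (crd x 1) _ _ _ _ _)
  (angle6 (crd x 2) _ _ _ _ _) (angle6 (crd x 3) _ _ _ _ _)
  (angle6 (crd x 4) _ _ _ _ _) (angle6 (crd x 5) _ _ _ _ _) => *; ring.
Qed.

Lemma angdot0 x : angdot x 0 = 0.
Proof. by rewrite -(scale0r x) angdotZ mul0r. Qed.

(** As [y] is positive, every point of the segment before its end [z] has positive coordinates. This
    is why [nondecreasing_off_values] asks for its alternative only below 1: some lengths of [z] may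
    be 0. *)
Lemma angdot_monotone_nonneg y z : (forall k, (k < 6)%N -> 0 < crd y k) ->
  (forall k, (k < 6)%N -> 0 <= crd z k) -> angdot y (z - y) <= angdot z (z - y).
Proof.
move=> y0 z0; set u := z - y.
have [u0|u0] := eqVneq u 0.
  by rewrite u0 !angdot0.
have := @nondecreasing_off_values _ (fun t => angdot (y + t *: u) u) (flat_values u).
have yu : y + u = z by rewrite /u addrC subrK.
rewrite scale0r scale1r addr0 yu; apply.
  exact: angdot_line_continuous.
move=> s /andP[s0 s1].
have pos k : (k < 6)%N -> 0 < crd (y + s *: u) k.
  move=> k6; rewrite crdD crdZ /u crdB.
  have := y0 k k6; have := z0 k k6; move: (crd y k) (crd z k) => a b b0 a0.
  have -> : a + s * (b - a) = (1 - s) * a + s * b by ring.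
  by rewrite ltr_wpDr ?mulr_ge0 ?mulr_gt0 //; lra.
have [g0|g0] := leP 0 (gdet (y + s *: u)); first by left; exact: angdot_flat.
right; exists (angdot_slope (y + s *: u) u); last exact: is_derive_angdot.
apply: angdot_slope_gt0 => //.
rewrite lt_neqAle sqnorm_ge0 andbT eq_sym; apply/eqP => /sqnorm_eq0 e.
by rewrite e eqxx in u0.
Qed.

Definition pos_part x : 'rV[R]_6 := \row_k Num.max 0 (x 0 k).

Lemma crd_pos_part x k : crd (pos_part x) k = Num.max 0 (crd x k).
Proof. by rewrite /crd mxE. Qed.

Lemma angdot_pos_part x u : angdot (pos_part x) u = angdot x u.
Proof.
have idem (a : R) : Num.max 0 (Num.max 0 a) = Num.max 0 a by rewrite maxA maxxx.
by rewrite /angdot /angle6 !crd_pos_part !idem.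
Qed.

(* As the angle at an edge of nonpositive length vanishes, it suffices to treat
   the positive part of [z]. *)
Lemma angdot_monotone y z : (forall k, (k < 6)%N -> 0 < crd y k) ->
  angdot y (z - y) <= angdot z (z - y).
Proof.
move=> y0.
have zp k : (k < 6)%N -> 0 <= crd (pos_part z) k by move=> _; rewrite crd_pos_part le_max lexx.
have := angdot_monotone_nonneg y0 zp; rewrite angdot_pos_part.
suff : angdot z (z - y) - angdot y (z - y) >=
       angdot z (pos_part z - y) - angdot y (pos_part z - y) by lra.
rewrite -subr_ge0.
(* Passing to the positive part alters the pairing only in the coordinates where [a1 <= 0]. There
   the angle at [z] vanishes, and the contribution [- b * a1] is nonnegative. *)
have key (a1 a2 a3 a4 a5 a6 b : R) : 0 <= b ->
    0 <= (angle6 a1 a2 a3 a4 a5 a6 - b) * (a1 - Num.max 0 a1).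
  move=> b0; have [a0|a0] := leP a1 0.
    by rewrite angle6_le0 // mulr_le0 //; lra.
  by rewrite subrr mulr0.
rewrite /angdot !crdB !crd_pos_part.
clear zp; move: (crd z 0) (crd z 1) (crd z 2) (crd z 3) (crd z 4) (crd z 5) => z0 z1 z2 z3 z4 z5.
set b0 := angle6 (crd y 0) _ _ _ _ _; set b1 := angle6 (crd y 1) _ _ _ _ _.
set b2 := angle6 (crd y 2) _ _ _ _ _; set b3 := angle6 (crd y 3) _ _ _ _ _.
set b4 := angle6 (crd y 4) _ _ _ _ _; set b5 := angle6 (crd y 5) _ _ _ _ _.
have := key z0 z1 z2 z3 z4 z5 b0 (angle6_ge0 _ _ _ _ _ _).
have := key z1 z0 z2 z3 z5 z4 b1 (angle6_ge0 _ _ _ _ _ _).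
have := key z2 z0 z1 z4 z5 z3 b2 (angle6_ge0 _ _ _ _ _ _).
have := key z3 z0 z4 z1 z5 z2 b3 (angle6_ge0 _ _ _ _ _ _).
have := key z4 z0 z3 z2 z5 z1 b4 (angle6_ge0 _ _ _ _ _ _).
have := key z5 z1 z3 z2 z4 z0 b5 (angle6_ge0 _ _ _ _ _ _).
move: (angle6 z0 _ _ _ _ _) (angle6 z1 _ _ _ _ _) (angle6 z2 _ _ _ _ _)
  (angle6 z3 _ _ _ _ _) (angle6 z4 _ _ _ _ _) (angle6 z5 _ _ _ _ _).
move: (crd y 0) (crd y 1) (crd y 2) (crd y 3) (crd y 4) (crd y 5) b0 b1 b2 b3 b4 b5.
clear => *; lra.
Qed.

End AngleMonotone.

(** * Strong monotonicity on balls around a nondegenerate point *)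

Section LocalBound.
Variable R : realType.
Implicit Types (x y z u : 'rV[R]_6).

Lemma cvg_tet_form T (F : set_system T) {FF : Filter F}
    (f12 f13 f14 f23 f24 f34 g12 g13 g14 g23 g24 g34 : T -> R)
    (c12 c13 c14 c23 c24 c34 e12 e13 e14 e23 e24 e34 : R) :
  1 < c12 -> 1 < c13 -> 1 < c14 -> 1 < c23 -> 1 < c24 -> 1 < c34 ->
  gram_det c12 c13 c14 c23 c24 c34 < 0 ->
  f12 @ F --> c12 -> f13 @ F --> c13 -> f14 @ F --> c14 ->
  f23 @ F --> c23 -> f24 @ F --> c24 -> f34 @ F --> c34 ->
  g12 @ F --> e12 -> g13 @ F --> e13 -> g14 @ F --> e14 ->
  g23 @ F --> e23 -> g24 @ F --> e24 -> g34 @ F --> e34 ->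
  (fun t => tet_form (f12 t) (f13 t) (f14 t) (f23 t) (f24 t) (f34 t)
     (g12 t) (g13 t) (g14 t) (g23 t) (g24 t) (g34 t)) @ F -->
  tet_form c12 c13 c14 c23 c24 c34 e12 e13 e14 e23 e24 e34.
Proof.
move=> h12 h13 h14 h23 h24 h34 g0 F12 F13 F14 F23 F24 F34 G12 G13 G14 G23 G24 G34.
have ne (ij ik ih jk jh kh D D' : R) : 1 < ij ->
    gram_det ij ik ih jk jh kh = gram_det c12 c13 c14 c23 c24 c34 ->
    D = face_disc ij jh ih -> D' = face_disc ij jk ik ->
    D * D' - cofac ij ik ih jk jh kh ^+ 2 != 0.
  move=> ij1 ge -> ->; rewrite mulrC cofac_sqr ge gt_eqF // mulr_gt0 //; last by nra.
  lra.
have gp := gram_det_perm c12 c13 c14 c23 c24 c34.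
have p1 := face_disc_perm c23 c34 c24; have p2 := face_disc_perm c13 c34 c14.
have p3 := face_disc_perm c12 c24 c14; have p4 := face_disc_perm c12 c23 c13.
have n12 := ne c12 c13 c14 c23 c24 c34 _ _ h12 erefl erefl erefl.
have n13 := ne c13 c12 c14 c23 c34 c24 (face_disc c13 c34 c14) (face_disc c12 c23 c13) h13.
have {}n13 := n13 ltac:(by rewrite gp) erefl ltac:(by rewrite p4).
have n14 := ne c14 c12 c13 c24 c34 c23 (face_disc c13 c34 c14) (face_disc c12 c24 c14) h14.
have {}n14 := n14 ltac:(by rewrite gp) ltac:(by rewrite p2) ltac:(by rewrite p3).
have n23 := ne c23 c12 c24 c13 c34 c14 (face_disc c23 c34 c24) (face_disc c12 c23 c13) h23.
have {}n23 := n23 ltac:(by rewrite gp) erefl ltac:(by rewrite p4).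
have n24 := ne c24 c12 c23 c14 c34 c13 (face_disc c23 c34 c24) (face_disc c12 c24 c14) h24.
have {}n24 := n24 ltac:(by rewrite gp) ltac:(by rewrite p1) ltac:(by rewrite p3).
have n34 := ne c34 c13 c23 c14 c24 c12 (face_disc c23 c34 c24) (face_disc c13 c34 c14) h34.
have {}n34 := n34 ltac:(by rewrite gp) ltac:(by rewrite p1) ltac:(by rewrite p2).
have fd (x y z : R) : 1 < x -> 1 < y -> 1 < z -> face_disc x y z != 0.
  by move=> *; rewrite gt_eqF // face_disc_gt0 // ltW.
exact: (cvg_qform (FF := FF) (fd _ _ _ h23 h34 h24) (fd _ _ _ h13 h34 h14)
  (fd _ _ _ h12 h24 h14) (fd _ _ _ h12 h23 h13) n12 n13 n14 n23 n24 n34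
  (cvg_cofac (FF := FF) F12 F13 F14 F23 F24 F34)
  (cvg_cofac (FF := FF) F13 F12 F14 F23 F34 F24)
  (cvg_cofac (FF := FF) F14 F12 F13 F24 F34 F23)
  (cvg_cofac (FF := FF) F23 F12 F24 F13 F34 F14)
  (cvg_cofac (FF := FF) F24 F12 F23 F14 F34 F13)
  (cvg_cofac (FF := FF) F34 F13 F23 F14 F24 F12)
  (cvg_face_disc (FF := FF) F23 F34 F24) (cvg_face_disc (FF := FF) F13 F34 F14)
  (cvg_face_disc (FF := FF) F12 F24 F14) (cvg_face_disc (FF := FF) F12 F23 F13)
  G12 G13 G14 G23 G24 G34).
Qed.

Lemma crd_close x y k (d : R) : (k < 6)%N -> 0 < d -> sqnorm (y - x) <= d ^+ 2 ->
  `|crd y k - crd x k| <= d.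
Proof.
move=> k6 d0 le; have := le_trans (crd_sqr_le (y - x) k6) le; rewrite crdB => sq.
by rewrite -(@ler_pXn2r _ 2) ?nnegrE ?normr_ge0 ?(ltW d0) // real_normK ?num_real.
Qed.

Lemma nondegenerate_open x : nondegenerate x ->
  exists2 d, 0 < d & forall y, sqnorm (y - x) <= d ^+ 2 -> nondegenerate y.
Proof.
move=> [pos g0].
have np k : (k < 6)%N -> nbhs x (fun y => 0 < crd y k).
  by move=> k6; exact: (@cvgr_gt _ _ _ _ _ _ (@crd_continuous _ k x) _ (pos k k6)).
have ng : nbhs x (fun y => gdet y < 0).
  have cc k : (fun y => cosh (crd y k)) @ nbhs x --> cosh (crd x k).
    exact: (cvg_comp _ _ (@crd_continuous _ k x) (@cosh_continuous _ (crd x k))).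
  have := cvg_gram_det (FF := nbhs_filter x) (cc 0%N) (cc 1%N) (cc 2%N) (cc 3%N)
    (cc 4%N) (cc 5%N).
  by move=> cg; exact: (@cvgr_lt _ _ _ _ _ _ cg _ g0).
have : nbhs x ([set y | 0 < crd y 0] `&` ([set y | 0 < crd y 1] `&`
    ([set y | 0 < crd y 2] `&` ([set y | 0 < crd y 3] `&` ([set y | 0 < crd y 4] `&`
    ([set y | 0 < crd y 5] `&` [set y | gdet y < 0])))))).
  by do 6![apply: filterI; first exact: np].
move=> /nbhs_ballP[e /= e0 he]; exists (e / 2); first by rewrite divr_gt0.
move=> y yx; have : ball x e y.
  split => // i j; rewrite (ord1 i) /ball /=.
  have := crd_close (ltn_ord j) (ltac:(lra) : 0 < e / 2) yx.
  by rewrite /crd !inord_val distrC; lra.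
move=> /he[y0 [y1 [y2 [y3 [y4 [y5 gy]]]]]]; split => //.
by case=> [|[|[|[|[|[|//]]]]]].
Qed.

(** The slope is continuous and positive on the product of a small closed ball and the unit sphere,
    which is compact. *)
Lemma angdot_slope_bound x : nondegenerate x -> exists d c, [/\ 0 < d, 0 < c &
  forall y u, sqnorm (y - x) <= d ^+ 2 -> sqnorm u = 1 ->
    nondegenerate y /\ c <= angdot_slope y u].
Proof.
move=> nx; have [d d0 hd] := nondegenerate_open nx.
pose K := [set y | sqnorm (y - x) <= d ^+ 2] `*` [set u : 'rV[R]_6 | sqnorm u = 1].
have cK : compact K.
  apply: compact_setX; last exact: sphere_compact.
  exact: (@sqnorm_compact _ x [set r | r <= d ^+ 2] (d ^+ 2) (@closed_le _ _)).
have [||c c0 hc] := @compact_pos_bound R _ K (fun p => angdot_slope p.1 p.2) cK.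
- move=> [y u] [/= /hd ny u1].
  have [pos g0] := ny.
  have cy k : (fun p : 'rV[R]_6 * 'rV[R]_6 => crd p.1 k) @ nbhs (y, u) --> crd y k.
    have h : (@fst 'rV[R]_6 'rV[R]_6) @ nbhs (y, u) --> y.
      exact: (@cvg_fst _ _ (nbhs y) (nbhs u) _).
    exact: (@cvg_comp _ _ _ fst (fun y : 'rV[R]_6 => crd y k) _ (nbhs y) _ h
      (@crd_continuous R k y)).
  have cu k : (fun p : 'rV[R]_6 * 'rV[R]_6 => crd p.2 k) @ nbhs (y, u) --> crd u k.
    have h : (@snd 'rV[R]_6 'rV[R]_6) @ nbhs (y, u) --> u.
      exact: (@cvg_snd _ _ (nbhs y) (nbhs u) _).
    exact: (@cvg_comp _ _ _ snd (fun y : 'rV[R]_6 => crd y k) _ (nbhs u) _ h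
      (@crd_continuous R k u)).
  have cc k := cvg_comp _ _ (cy k) (@cosh_continuous _ (crd y k)).
  have cs k := cvg_mul (FF := nbhs_filter _)
    (cvg_comp _ _ (cy k) (@sinh_continuous _ (crd y k))) (cu k).
  have cg := cvg_gram_det (FF := nbhs_filter _) (cc 0%N) (cc 1%N) (cc 2%N) (cc 3%N)
    (cc 4%N) (cc 5%N).
  have cr := cvg_comp _ _ (cvgN (FF := nbhs_filter _) cg) (@sqrt_continuous _ _).
  have c1 k : (k < 6)%N -> 1 < cosh (crd y k) by move=> k6; exact/cosh_gt1/pos.
  have ct := cvg_tet_form (FF := nbhs_filter _) (c1 0%N isT) (c1 1%N isT) (c1 2%N isT)
    (c1 3%N isT) (c1 4%N isT) (c1 5%N isT) g0 (cc 0%N) (cc 1%N) (cc 2%N) (cc 3%N)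
    (cc 4%N) (cc 5%N) (cs 0%N) (cs 1%N) (cs 2%N) (cs 3%N) (cs 4%N) (cs 5%N).
  have r0 : Num.sqrt (- gdet y) != 0 by rewrite gt_eqF // sqrtr_gt0; lra.
  exact: (cvg_div (FF := nbhs_filter _) r0 ct cr).
- by move=> [y u] [/= /hd ny u1]; apply: angdot_slope_gt0 => //; rewrite u1.
exists d, c; split => // y u hy u1; split; first exact: hd.
by apply: (hc (y, u)).
Qed.

(** On the ray from [x] to [z], at distance [n <= r], the pairing with the unit direction gains at
    least [c * s] up to distance [s = min n d] by the mean value theorem. Beyond that,
    [angdot_monotone] keeps the gain. As [s >= min 1 (d / r) * n], the gain is proportional to
    [n]. *)
Lemma angdot_strongly_monotone x (r : R) : nondegenerate x -> 0 < r ->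
  exists2 c, 0 < c & forall z, sqnorm (z - x) <= r ^+ 2 ->
    c * sqnorm (z - x) <= angdot z (z - x) - angdot x (z - x).
Proof.
move=> nx r0; have [d [c [d0 c0 hdc]]] := angdot_slope_bound nx.
exists (c * Num.min 1 (d / r)); first by rewrite mulr_gt0 // lt_min ltr01 divr_gt0.
move=> z zr; have [zx|zx] := eqVneq (sqnorm (z - x)) 0.
  by rewrite zx mulr0 (sqnorm_eq0 zx) !angdot0 subrr.
have z0 : 0 < sqnorm (z - x) by rewrite lt_neqAle eq_sym zx sqnorm_ge0.
pose n := Num.sqrt (sqnorm (z - x)).
have n0 : 0 < n by rewrite sqrtr_gt0.
have n2 : n ^+ 2 = sqnorm (z - x) by rewrite sqr_sqrtr // ltW.
have nr : n <= r by rewrite -(@ler_pXn2r _ 2) ?nnegrE ?(ltW n0) ?(ltW r0) // n2.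
have [u zu u1] : exists2 u, z - x = n *: u & sqnorm u = 1.
  exists (n^-1 *: (z - x)); first by rewrite scalerA divff ?gt_eqF // scale1r.
  by rewrite sqnormZ -n2 exprVn mulVf // expf_neq0 // gt_eqF.
pose s := Num.min n d.
have s0 : 0 < s by rewrite lt_min n0.
have [sn sd] : s <= n /\ s <= d by rewrite !ge_min !lexx orbT.
have near t : 0 <= t <= s -> sqnorm (x + t *: u - x) <= d ^+ 2.
  move=> /andP[t0 ts]; rewrite addrC addKr sqnormZ u1 mulr1.
  by rewrite ler_pXn2r ?nnegrE ?(ltW d0) // (le_trans ts).
have dang t : t \in `]0, s[ ->
    is_derive t 1 (fun t => angdot (x + t *: u) u) (angdot_slope (x + t *: u) u).
  rewrite in_itv /= => /andP[t0 ts]; apply: is_derive_angdot.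
  by apply: (hdc _ u _ u1).1; apply: near; rewrite !ltW.
have [t] := MVT s0 dang (continuous_subspaceT (@angdot_line_continuous R x u)).
rewrite in_itv /= scale0r addr0 subr0 => /andP[t0 ts] mvt.
have slope : c * s <= angdot (x + s *: u) u - angdot x u.
  rewrite mvt ler_pM2r //; apply: (hdc _ u _ u1).2; apply: near; rewrite !ltW //.
have mono : angdot (x + s *: u) u <= angdot z u.
  have [e|ne] := eqVneq s n.
    by rewrite e -zu addrC subrK.
  have sn' : s < n by rewrite lt_neqAle ne.
  have [pos _] := (hdc _ u (near s ltac:(by rewrite lexx ltW)) u1).1.
  have := @angdot_monotone _ (x + s *: u) z pos.
  have -> : z - (x + s *: u) = (n - s) *: u.
    by rewrite opprD addrA zu -scaleNr -scalerDl.
  by rewrite !angdotZ ler_pM2l //; lra.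
rewrite zu !angdotZ -mulrBr -zu -n2.
have le : c * s <= angdot z u - angdot x u by lra.
have ms : Num.min 1 (d / r) * n <= s.
  rewrite le_min; apply/andP; split.
    by rewrite ler_piMl ?ge_min ?lexx // ltW.
  apply: (@le_trans _ _ (d / r * n)); first by rewrite ler_pM2r // ge_min lexx orbT.
  by rewrite mulrAC ler_pdivrMr // ler_pM2l.
have -> : c * Num.min 1 (d / r) * n ^+ 2 = n * (c * (Num.min 1 (d / r) * n)) by ring.
by rewrite ler_pM2l // (le_trans _ le) // ler_pM2l.
Qed.

End LocalBound.

(** * Truncated tetrahedra in the hyperboloid model *)

Section Hyperboloid.
Variable R : realType.
Implicit Types (x y p q : 'rV[R]_4).

Definition mink_mx : 'M[R]_4 := diag_mx (\row_i (if i == 0 then -1 else 1)).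

Lemma mink_mxE x y : mink x y = (x *m mink_mx *m y^T) 0 0.
Proof.
rewrite /mink /mink_mx mul_mx_diag [RHS]mxE [RHS](bigD1 0) //= !mxE eqxx mulrN1 mulNr.
by congr (_ + _); apply: eq_bigr => i i0; rewrite !mxE (negbTE i0) mulr1.
Qed.

Lemma minkC x y : mink x y = mink y x.
Proof.
by rewrite /mink mulrC; congr (_ + _); apply: eq_bigr => i _; rewrite mulrC.
Qed.

Lemma mink_row_mx (A B : 'M[R]_4) i j :
  mink (row i A) (row j B) = (A *m mink_mx *m B^T) i j.
Proof.
by rewrite mink_mxE -!row_mul mxE !mxE; apply: eq_bigr => k _; rewrite !mxE.
Qed.

Lemma mink_mx_unit : mink_mx \in unitmx.
Proof.
have : mink_mx *m mink_mx = 1%:M.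
  rewrite /mink_mx mulmx_diag; apply/matrixP => i j; rewrite !mxE.
  by case: (i == 0); rewrite ?mulrNN mulr1.
by case/mulmx1_unit.
Qed.

Lemma mink4 x y : mink x y = - (x 0 0 * y 0 0)
  + (x 0 1 * y 0 1 + x 0 2 * y 0 2 + x 0 3 * y 0 3).
Proof.
rewrite /mink (bigD1 1) //= (bigD1 2) //= (bigD1 3) //= big1 ?addr0 ?addrA //.
by case=> [[|[|[|[|//]]]] ?].
Qed.

(** Cauchy-Schwarz for the spatial parts, whose squared lengths are [a ^+ 2 - 1] and [a' ^+ 2 - 1],
    together with the positivity of the time coordinates. *)
Lemma mink_hyperboloid_lt0 p q : hyperboloid p -> hyperboloid q -> mink p q < 0.
Proof.
move=> [pp p0] [qq q0]; move: pp qq; rewrite !mink4.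
move: (p 0 0) (p 0 1) (p 0 2) (p 0 3) (q 0 0) (q 0 1) (q 0 2) (q 0 3) p0 q0.
move=> a b c d a' b' c' d' a0 a'0 e e'.
have cs : (b * b' + c * c' + d * d') ^+ 2 < (a * a') ^+ 2.
  have : (b * b' + c * c' + d * d') ^+ 2 <= (b ^+ 2 + c ^+ 2 + d ^+ 2) *
      (b' ^+ 2 + c' ^+ 2 + d' ^+ 2).
    have := sqr_ge0 (b * c' - c * b'); have := sqr_ge0 (b * d' - d * b').
    have := sqr_ge0 (c * d' - d * c'); lra.
  have -> : b ^+ 2 + c ^+ 2 + d ^+ 2 = a ^+ 2 - 1 by lra.
  have -> : b' ^+ 2 + c' ^+ 2 + d' ^+ 2 = a' ^+ 2 - 1 by lra.
  have : 1 <= a ^+ 2 by have := sqr_ge0 b; have := sqr_ge0 c; have := sqr_ge0 d; lra.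
  have : 1 <= a' ^+ 2 by have := sqr_ge0 b'; have := sqr_ge0 c'; have := sqr_ge0 d'; lra.
  rewrite exprMn; lra.
have aa : 0 < a * a' by rewrite mulr_gt0.
have : b * b' + c * c' + d * d' < a * a' by nra.
lra.
Qed.

End Hyperboloid.

Section Tetrahedron.
Variables (R : realType) (P : truncated_tet R).
Hypothesis hP : hyperideal_tet P.

Let V : 'M[R]_4 := \matrix_i tri_normal P i.
Let W : 'M[R]_4 := \matrix_i hex_normal P i.
Let lam : 'rV[R]_4 := \row_i mink (tri_normal P i) (hex_normal P i).

Let VE i : row i V = tri_normal P i. Proof. exact: rowK. Qed.
Let WE i : row i W = hex_normal P i. Proof. exact: rowK. Qed.

Lemma corner_hex_lt0 i j : i != j -> mink (corner P i j) (hex_normal P i) < 0 /\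
  mink (corner P i j) (hex_normal P j) < 0.
Proof.
move=> ij; have [[hyp sol] _ hh] := tet_corners hP ij.
split.
  by have [le _] := sol i; rewrite lt_neqAle le hh eqxx.
by have [le _] := sol j; rewrite lt_neqAle le hh eqxx andbF.
Qed.

Lemma corner_hex_eq0 i j k : i != j -> k != i -> k != j ->
  mink (corner P i j) (hex_normal P k) = 0.
Proof.
by move=> ij ki kj; have [_ _ hh] := tet_corners hP ij; apply/eqP; rewrite hh ki kj.
Qed.

Lemma corner_tri_lt0 i j k : i != j -> k != i ->
  mink (corner P i j) (tri_normal P k) < 0.
Proof.
move=> ij ki; have [[hyp sol] ht _] := tet_corners hP ij.
by have [_ le] := sol k; rewrite lt_neqAle le ht (negbTE ki).
Qed.

Lemma corner_tri_eq0 i j : i != j -> mink (corner P i j) (tri_normal P i) = 0.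
Proof.
by move=> ij; have [_ ht _] := tet_corners hP ij; apply/eqP; rewrite ht.
Qed.

Lemma mink_mulmx (b : 'rV[R]_4) (A : 'M[R]_4) y :
  mink (b *m A) y = \sum_k b 0 k * mink (row k A) y.
Proof.
rewrite mink_mxE -mulmxA -mulmxA mxE; apply: eq_bigr => k _.
by rewrite mink_mxE -mulmxA -row_mul [in RHS]mxE.
Qed.

Lemma sum2 (i j : 'I_4) (F : 'I_4 -> R) : i != j ->
  (forall k, k != i -> k != j -> F k = 0) -> \sum_k F k = F i + F j.
Proof.
move=> ij F0; rewrite (bigD1 i) //= (bigD1 j) 1?eq_sym //= big1 ?addr0 //.
by move=> k /andP[ki kj]; exact: F0.
Qed.

(** Pairing a linear relation [b] with the corner [(i, j)] leaves only the terms [i] and [j], both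
    with negative coefficient; hence [b_i] is a negative multiple of [b_j]. Around the three indices
    0, 1, 2 this forces [b] to vanish. *)
Lemma hex_unit : W \in unitmx.
Proof.
rewrite -row_free_unit; apply: inj_row_free => b bW.
have rel i j : i != j -> exists2 r, 0 < r & b 0 i = - r * b 0 j.
  move=> ij; have [li lj] := corner_hex_lt0 ij.
  exists (mink (corner P i j) (hex_normal P j) / mink (corner P i j) (hex_normal P i)).
    by rewrite nmulr_rgt0 // invr_lt0.
  have : mink (b *m W) (corner P i j) = 0 by rewrite bW mink_mxE !mul0mx mxE.
  rewrite mink_mulmx (sum2 ij); last first.
    by move=> k ki kj; rewrite WE minkC corner_hex_eq0 ?mulr0.
  rewrite !WE minkC [X in _ + _ * X]minkC => e.
  apply: (mulIf (ltr0_neq0 li)); rewrite mulNr mulNr mulrAC divfK ?ltr0_neq0 //; lra.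
have [r1 r1p e1] := @rel 0 1 isT; have [r2 r2p e2] := @rel 1 2 isT.
have [r3 r3p e3] := @rel 0 2 isT.
have b2 : b 0 2 = 0.
  have : (r1 * r2 + r3) * b 0 2 = 0.
    have : b 0 0 = r1 * r2 * b 0 2 by rewrite e1 e2; ring.
    by rewrite e3 mulrDl => <-; ring.
  move=> /eqP; rewrite mulf_eq0 => /orP[|/eqP//].
  by rewrite gt_eqF // addr_gt0 // mulr_gt0.
apply/rowP => i; rewrite mxE; have [->//|i2] := eqVneq i 2.
by have [r _ ->] := rel i 2 i2; rewrite b2 mulr0.
Qed.

Lemma tri_hex_diag : V *m mink_mx R *m W^T = diag_mx lam.
Proof.
apply/matrixP => i j; rewrite -mink_row_mx VE WE !mxE.
have [->|ij] := eqVneq i j; first by rewrite mulr1n.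
by rewrite mulr0n (tet_orthogonal hP ij).
Qed.

(** Otherwise the unit vector [tri_normal P k] would be orthogonal to a basis, the hexagon
    normals. *)
Lemma lam_neq0 k : lam 0 k != 0.
Proof.
apply/eqP => l0.
have : row k V *m mink_mx R *m W^T = 0.
  rewrite -!row_mul tri_hex_diag; apply/rowP => j; rewrite !mxE.
  case: eqVneq => [_|_]; last by rewrite mulr0n.
  by move: l0; rewrite mxE => ->; rewrite mul0rn.
move=> /(congr1 (fun A => A *m invmx (W^T))).
rewrite mul0mx mulmxK ?unitmx_tr ?hex_unit // => /(congr1 (fun A => A *m invmx (mink_mx R))).
rewrite mul0mx mulmxK ?mink_mx_unit // => v0.
have := tet_tri_unit hP k; rewrite -VE v0 mink_mxE !mul0mx mxE => /esym/eqP.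
by rewrite oner_eq0.
Qed.

Let D : 'M[R]_4 := diag_mx (\row_i (lam 0 i)^-1).

Lemma diag_lamK : diag_mx lam *m D = 1%:M.
Proof.
rewrite /D mulmx_diag; apply/matrixP => i j; rewrite !mxE.
by case: eqVneq => [->|_]; rewrite ?mulr0n // mulr1n divff //; have := lam_neq0 j; rewrite mxE.
Qed.

(** By orthogonality of the faces, the two families of normals are dual bases up to the factors
    [lam]. *)
Lemma tri_span (p : 'rV[R]_4) : p = (p *m mink_mx R *m W^T *m D) *m V.
Proof.
have h : V *m (mink_mx R *m W^T *m D) = 1%:M by rewrite !mulmxA tri_hex_diag diag_lamK.
by have := mulmx1C h; rewrite -!mulmxA => ->; rewrite mulmx1.
Qed.

Lemma mink_tri_span (p y : 'rV[R]_4) : mink p y =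
  \sum_k mink p (hex_normal P k) / lam 0 k * mink (tri_normal P k) y.
Proof.
rewrite {1}(tri_span p) mink_mulmx; apply: eq_bigr => k _; rewrite VE; congr (_ * _).
rewrite /D mul_mx_diag mxE [X in _ * X]mxE; congr (_ / _).
rewrite mink_mxE [LHS]mxE [RHS]mxE; apply: eq_bigr => m _; congr (_ * _).
by rewrite !mxE.
Qed.

Lemma mink_corner i j y : i != j -> mink (corner P i j) y =
  mink (corner P i j) (hex_normal P i) / lam 0 i * mink (tri_normal P i) y
  + mink (corner P i j) (hex_normal P j) / lam 0 j * mink (tri_normal P j) y.
Proof.
move=> ij; rewrite mink_tri_span (sum2 ij) // => k ki kj.
by rewrite corner_hex_eq0 // !mul0r.
Qed.

(** In the basis of triangle normals the corner [(i, j)] has only the coordinates [i] and [j].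
    Orthogonality to the normal [i] fixes their ratio and the norm -1 fixes their size. Since the
    corner lies inside the triangle plane [j], [a] is positive; since it lies inside the hexagon
    plane [j], [lam 0 j] is then negative. *)
Lemma edge_facts i j (g := mink (tri_normal P i) (tri_normal P j)) : i != j ->
  [/\ 1 < g ^+ 2, lam 0 j < 0 & exists2 a, 0 < a & a ^+ 2 * (g ^+ 2 - 1) = 1 /\
    forall y, mink (corner P i j) y = a * (mink (tri_normal P j) y - g * mink (tri_normal P i) y)].
Proof.
move=> ij; have := @mink_corner i j _ ij.
set b := _ / lam 0 i; set a := _ / lam 0 j => pE.
have ii := tet_tri_unit hP i; have jj := tet_tri_unit hP j.
have e0 := corner_tri_eq0 ij.
have ji : j != i by rewrite eq_sym.
have lt := corner_tri_lt0 ij ji.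
have ba : b = - a * g.
  move: e0; rewrite pE ii mulr1 (minkC (tri_normal P j)) -/g; lra.
have {}pE y : mink (corner P i j) y =
    a * (mink (tri_normal P j) y - g * mink (tri_normal P i) y).
  by rewrite pE ba; ring.
have [[[pp _] _] _ _] := tet_corners hP ij.
have pj : mink (corner P i j) (tri_normal P j) = a * (1 - g ^+ 2).
  by rewrite pE jj -/g; ring.
have e1 : a ^+ 2 * (g ^+ 2 - 1) = 1.
  move: pp; rewrite pE (minkC (tri_normal P j)) (minkC (tri_normal P i)) e0 pj; lra.
have g1 : 1 < g ^+ 2.
  have a2 : 0 < a ^+ 2.
    rewrite lt_neqAle sqr_ge0 andbT eq_sym; apply/eqP => a0.
    by move: e1; rewrite a0 mul0r => /esym/eqP; rewrite oner_eq0.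
  by rewrite -subr_gt0 -(pmulr_rgt0 _ a2) e1.
have a0 : 0 < a.
  by move: lt; rewrite pj nmulr_llt0 // subr_lt0.
split => //; last by exists a.
have [_ lj] := corner_hex_lt0 ij.
by move: a0; rewrite /a nmulr_rgt0 // invr_lt0.
Qed.

(** Substituting the formulas for both corners, their product collapses to [g], because the
    coefficients satisfy [a * b * (g ^+ 2 - 1) = 1]. Two points of the upper sheet have a negative
    product, which selects [g < -1] from [1 < g ^+ 2]. *)
Lemma cosh_tet_length i j : i != j ->
  cosh (tet_length P i j) = - mink (tri_normal P i) (tri_normal P j) /\
  0 < tet_length P i j.
Proof.
move=> ij; have ji : j != i by rewrite eq_sym.
have [g1 _ [a a0 [ea pE]]] := edge_facts ij.
have [_ _ [b b0 [eb qE]]] := edge_facts ji.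
have [[hp _] _ _] := tet_corners hP ij; have [[hq _] _ _] := tet_corners hP ji.
have := mink_hyperboloid_lt0 hp hq.
have ii := tet_tri_unit hP i; have jj := tet_tri_unit hP j.
rewrite /tet_length /hdist pE (minkC (tri_normal P j) (corner P j i)).
rewrite (minkC (tri_normal P i) (corner P j i)) !qE ii jj (minkC (tri_normal P j) (tri_normal P i)).
move: eb; rewrite (minkC (tri_normal P j) (tri_normal P i)) => eb.
set g := mink _ _ in g1 ea eb *.
have ab : a * b * (g ^+ 2 - 1) = 1.
  have : (a * b * (g ^+ 2 - 1)) ^+ 2 = 1.
    rewrite (_ : _ ^+ 2 = a ^+ 2 * (g ^+ 2 - 1) * (b ^+ 2 * (g ^+ 2 - 1))); last by ring.
    by rewrite ea eb mulr1.
  move=> /eqP; rewrite sqrf_eq1 => /orP[/eqP//|/eqP e].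
  have : 0 < a * b * (g ^+ 2 - 1) by rewrite !mulr_gt0 // subr_gt0.
  rewrite e; lra.
have -> : a * (b * (g - g * 1) - g * (b * (1 - g * g))) = g * (a * b * (g ^+ 2 - 1)) by ring.
rewrite ab mulr1 => g0.
have gN1 : 1 < - g by nra.
have cE := arcoshK (ltW gN1); split => //.
rewrite lt_neqAle arcosh_ge0 ?ltW // andbT eq_sym; apply/eqP => e.
by move: cE; rewrite e cosh0; lra.
Qed.

Section Lengths.
Variable l : 'I_4 -> 'I_4 -> R.
Hypothesis hl : forall i j, i != j -> l i j = tet_length P i j.

Lemma lengths_cosh i j : i != j -> cosh (l i j) = - mink (tri_normal P i) (tri_normal P j).
Proof. by move=> ij; rewrite hl //; case: (cosh_tet_length ij). Qed.

Lemma lengths_gt0 i j : i != j -> 0 < l i j.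
Proof. by move=> ij; rewrite hl //; case: (cosh_tet_length ij). Qed.

Let G := gram4 (cosh (l 0 1)) (cosh (l 0 2)) (cosh (l 0 3)) (cosh (l 1 2))
  (cosh (l 1 3)) (cosh (l 2 3)).
Let A := gram4_adj (cosh (l 0 1)) (cosh (l 0 2)) (cosh (l 0 3)) (cosh (l 1 2))
  (cosh (l 1 3)) (cosh (l 2 3)).
Let g := gram_det (cosh (l 0 1)) (cosh (l 0 2)) (cosh (l 0 3)) (cosh (l 1 2))
  (cosh (l 1 3)) (cosh (l 2 3)).

Lemma ord4P (i : 'I_4) : [\/ i = 0, i = 1, i = 2 | i = 3].
Proof.
by case: i => [[|[|[|[|//]]]] ?]; [constructor 1|constructor 2|constructor 3|constructor 4];
  exact/val_inj.
Qed.

Lemma tri_gram : V *m mink_mx R *m V^T = G.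
Proof.
apply/matrixP => i j; rewrite -mink_row_mx !VE mxE.
have u := tet_tri_unit hP.
have c a b : a != b -> - cosh (l a b) = mink (tri_normal P a) (tri_normal P b).
  by move=> ab; rewrite lengths_cosh // opprK.
by case: (ord4P i) => ->; case: (ord4P j) => -> /=; rewrite ?u ?c // minkC.
Qed.

(** Dual bases have inverse Gram matrices, here up to conjugation by [diag_mx lam]. Multiplying by
    [g] replaces the inverse of [G] by its adjugate [A], and the entry [(0, 0)] then reveals the
    sign of [g]. *)
Lemma hex_gram i j :
  g * mink (hex_normal P i) (hex_normal P j) = lam 0 i * lam 0 j * A i j.
Proof.
have VW := tri_hex_diag.
have WV : W *m mink_mx R *m V^T = diag_mx lam.
  have := congr1 trmx VW; rewrite tr_diag_mx !trmx_mul trmxK => <-.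
  by rewrite /mink_mx tr_diag_mx mulmxA.
have h : V *m (mink_mx R *m W^T *m D) = 1%:M by rewrite !mulmxA VW diag_lamK.
have h' := mulmx1C h.
have HG : W *m mink_mx R *m W^T *m D *m G = diag_mx lam.
  rewrite -tri_gram -WV.
  transitivity (W *m (mink_mx R *m W^T *m D *m V) *m mink_mx R *m V^T).
    by rewrite !mulmxA.
  by rewrite h' mulmx1.
have := congr1 (fun M => M *m A) HG.
rewrite -mulmxA mul_gram4_adj -/g mul_mx_scalar => /matrixP/(_ i j).
rewrite mul_diag_mx /D mul_mx_diag [LHS]mxE [in LHS]mxE -mink_row_mx !WE.
rewrite [X in _ * (_ * X)]mxE [RHS]mxE => e.
have lj := lam_neq0 j.
by rewrite mulrAC -e -mulrA divfK.
Qed.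

Lemma lengths_gram_lt0 : g < 0.
Proof.
have := hex_gram 0 0; rewrite (tet_hex_unit hP) mulr1 => ->.
have d : 0 < face_disc (cosh (l 1 2)) (cosh (l 2 3)) (cosh (l 1 3)).
  by rewrite face_disc_gt0 // cosh_ge1.
have -> : A 0 0 = - face_disc (cosh (l 1 2)) (cosh (l 2 3)) (cosh (l 1 3)).
  by rewrite mxE.
rewrite mulrN oppr_lt0 mulr_gt0 // -expr2 exprn_even_gt0 //=.
exact: lam_neq0.
Qed.

Lemma hex_angle k h (Dk Dh N : R) : k != h -> 0 < Dk -> 0 < Dh ->
  A k k = - Dk -> A h h = - Dh -> A k h = N ->
  - mink (hex_normal P k) (hex_normal P h) = N / (Num.sqrt Dk * Num.sqrt Dh).
Proof.
move=> kh k0 h0 Akk Ahh Akh.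
have g0 := lengths_gram_lt0.
have neg m : lam 0 m < 0.
  have [i im] : exists i : 'I_4, i != m.
    by have [->|m0] := eqVneq m 0; [exists 1 | exists 0; rewrite eq_sym].
  by have [_ hm _] := edge_facts im.
have := hex_gram k k; have := hex_gram h h; have := hex_gram k h.
rewrite !(tet_hex_unit hP) Akk Ahh Akh !mulr1.
move: (lam 0 k) (lam 0 h) (neg k) (neg h) (mink _ _) => a b a0 b0 m em eh ek.
have p0 : 0 < Num.sqrt Dk by rewrite sqrtr_gt0.
have q0 : 0 < Num.sqrt Dh by rewrite sqrtr_gt0.
have p2 := sqr_sqrtr (ltW k0); have q2 := sqr_sqrtr (ltW h0).
move: (Num.sqrt Dk) (Num.sqrt Dh) p0 q0 p2 q2 => p q p0 q0 p2 q2.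
have eg : g = - (a * p * (b * q)).
  have sq : (a * p) ^+ 2 = (b * q) ^+ 2.
    by rewrite !exprMn p2 q2; lra.
  have : (a * p - b * q) * (a * p + b * q) = 0 by rewrite -subr_sqr sq subrr.
  have ap : a * p < 0 by rewrite nmulr_rlt0.
  have bq : b * q < 0 by rewrite nmulr_rlt0.
  move=> /eqP; rewrite mulf_eq0 => /orP[|] /eqP e; last by lra.
  have e' : b * q = a * p by lra.
  by rewrite e' -expr2 exprMn p2 ek; ring.
apply: (mulfI (ltr0_neq0 g0)); rewrite mulrN em eg.
by field; rewrite !gt_eqF.
Qed.

End Lengths.

End Tetrahedron.

(** * Dihedral angles as functions of the six lengths *)

Section EdgeLengths.
Variable R : realType.
Implicit Types (l u : 'I_4 -> 'I_4 -> R).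

Definition lvec l : 'rV[R]_6 := vec6 (l 0 1) (l 0 2) (l 0 3) (l 1 2) (l 1 3) (l 2 3).

Lemma enum_ord4 : enum 'I_4 = [:: 0; 1; 2; 3].
Proof. by apply: (inj_map val_inj); rewrite val_enum_ord. Qed.

Lemma third_fourth : [/\ third 0 1 = 2, third 0 2 = 1, third 0 3 = 1 & third 1 2 = 0] /\
  [/\ third 1 3 = 0, third 2 3 = 0, fourth 0 1 = 3 & fourth 0 2 = 3] /\
  [/\ fourth 0 3 = 2, fourth 1 2 = 3, fourth 1 3 = 2 & fourth 2 3 = 1].
Proof. by rewrite /third /fourth enum_ord4. Qed.

Lemma ext_angle6 l : (forall i j, l i j = l j i) ->
  [/\ ext_angle l 0 1 = angle6 (l 0 1) (l 0 2) (l 0 3) (l 1 2) (l 1 3) (l 2 3),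
      ext_angle l 0 2 = angle6 (l 0 2) (l 0 1) (l 0 3) (l 1 2) (l 2 3) (l 1 3) &
      ext_angle l 0 3 = angle6 (l 0 3) (l 0 1) (l 0 2) (l 1 3) (l 2 3) (l 1 2)] /\
  [/\ ext_angle l 1 2 = angle6 (l 1 2) (l 0 1) (l 1 3) (l 0 2) (l 2 3) (l 0 3),
      ext_angle l 1 3 = angle6 (l 1 3) (l 0 1) (l 1 2) (l 0 3) (l 2 3) (l 0 2) &
      ext_angle l 2 3 = angle6 (l 2 3) (l 0 2) (l 1 2) (l 0 3) (l 1 3) (l 0 1)].
Proof.
move=> ls; have [[t01 t02 t03 t12] [[t13 t23 f01 f02] [f03 f12 f13 f23]]] := third_fourth.
rewrite /ext_angle t01 t02 t03 t12 t13 t23 f01 f02 f03 f12 f13 f23 /phi /phi_disc.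
rewrite !(ls 1 0) !(ls 2 0) !(ls 3 0) !(ls 2 1) !(ls 3 1) !(ls 3 2).
by do !split.
Qed.

Definition sum_edges (F : 'I_4 -> 'I_4 -> R) : R :=
  \sum_(i < 4) \sum_(j < 4 | (i < j)%N) F i j.

Lemma sum_edgesE (F : 'I_4 -> 'I_4 -> R) :
  sum_edges F = F 0 1 + F 0 2 + F 0 3 + F 1 2 + F 1 3 + F 2 3.
Proof.
have s4 (G : 'I_4 -> R) : \sum_(i < 4) G i = G 0 + G 1 + G 2 + G 3.
  by rewrite (bigD1 0) //= (bigD1 1) //= (bigD1 2) //= (bigD1 3) //= big1 ?addr0 ?addrA //;
    case=> [[|[|[|[|//]]]] ?].
rewrite /sum_edges s4 !(big_mkcond (fun j : 'I_4 => (_ < j)%N)) !s4 /=.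
by rewrite !add0r !addr0 !addrA.
Qed.

Lemma sum_edges_angdot l u : (forall i j, l i j = l j i) ->
  sum_edges (fun i j => ext_angle l i j * u i j) = angdot (lvec l) (lvec u).
Proof.
move=> ls; rewrite sum_edgesE /angdot /lvec !crd_vec6 //=.
by have [[-> -> ->] [-> -> ->]] := ext_angle6 ls.
Qed.

Lemma lvecB l u : lvec (fun i j => l i j - u i j) = lvec l - lvec u.
Proof.
by apply/rowP => -[[|[|[|[|[|[|//]]]]]] ?]; rewrite !mxE.
Qed.

Lemma sqnorm_lvec l : sqnorm (lvec l) = sum_edges (fun i j => l i j ^+ 2).
Proof. by rewrite sum_edgesE /sqnorm /lvec !crd_vec6. Qed.

Lemma edges_ind (Q : 'I_4 -> 'I_4 -> Prop) :
  Q 0 1 -> Q 0 2 -> Q 0 3 -> Q 1 2 -> Q 1 3 -> Q 2 3 ->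
  forall i j : 'I_4, (i < j)%N -> Q i j.
Proof. by move=> q01 q02 q03 q12 q13 q23 i j; case: (ord4P i) (ord4P j) => -> [] ->. Qed.

Lemma tet_lengths_angles (P : truncated_tet R) l : (forall i j, l i j = l j i) ->
  tet_lengths P l -> nondegenerate (lvec l) /\
  forall i j : 'I_4, (i < j)%N -> tet_angle P i j = ext_angle l i j.
Proof.
move=> ls [hP hl].
have g0 := lengths_gram_lt0 hP hl.
have pos := lengths_gt0 hP hl.
split.
  split; last by rewrite /gdet /lvec !crd_vec6.
  move=> k k6; rewrite /lvec crd_vec6 //.
  by case: k k6 => [|[|[|[|[|[|//]]]]]] _ /=; rewrite pos.
have d1 a b c : 0 < face_disc (cosh a) (cosh b) (cosh c) :> R.
  by rewrite face_disc_gt0 // cosh_ge1.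
have p01 := pos 0 1 isT; have p02 := pos 0 2 isT; have p03 := pos 0 3 isT.
have p12 := pos 1 2 isT; have p13 := pos 1 3 isT; have p23 := pos 2 3 isT.
have [[t01 t02 t03 t12] [[t13 t23 f01 f02] [f03 f12 f13 f23]]] := third_fourth.
have [[e01 e02 e03] [e12 e13 e23]] := ext_angle6 ls.
have gp := gram_det_perm (cosh (l 0 1)) (cosh (l 0 2)) (cosh (l 0 3)) (cosh (l 1 2))
  (cosh (l 1 3)) (cosh (l 2 3)).
have key k h (x1 x2 x3 x4 x5 x6 : R) : 0 < x1 -> 0 < x2 -> 0 < x3 -> 0 < x4 -> 0 < x5 -> 0 < x6 ->
    gram_det (cosh x1) (cosh x2) (cosh x3) (cosh x4) (cosh x5) (cosh x6) =
    gram_det (cosh (l 0 1)) (cosh (l 0 2)) (cosh (l 0 3)) (cosh (l 1 2))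
      (cosh (l 1 3)) (cosh (l 2 3)) ->
    - mink (hex_normal P k) (hex_normal P h) =
    cofac (cosh x1) (cosh x2) (cosh x3) (cosh x4) (cosh x5) (cosh x6) /
    (Num.sqrt (face_disc (cosh x1) (cosh x5) (cosh x3))
     * Num.sqrt (face_disc (cosh x1) (cosh x4) (cosh x2))) ->
    acos (- mink (hex_normal P k) (hex_normal P h)) = angle6 x1 x2 x3 x4 x5 x6.
  move=> h1 h2 h3 h4 h5 h6 ge ->.
  rewrite (angle6_pos (ltW h1) (ltW h2) (ltW h3) (ltW h4) (ltW h5) (ltW h6)).
  have itv := cosphi_itv (cosh_gt1 h1) (cosh_ge1 x2) (cosh_ge1 x3) (cosh_ge1 x4)
    (cosh_ge1 x5) (eq_ind_r (fun g => g < 0) g0 ge).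
  rewrite clamp_id; last by case/andP: itv => ? ?; rewrite !ltW.
  by rewrite /cosphi (sqrtrM _ (ltW (d1 _ _ _))) [Num.sqrt _ * Num.sqrt _]mulrC.
have q0 := face_disc_perm (cosh (l 1 2)) (cosh (l 2 3)) (cosh (l 1 3)).
have q1 := face_disc_perm (cosh (l 0 2)) (cosh (l 2 3)) (cosh (l 0 3)).
have q2 := face_disc_perm (cosh (l 0 1)) (cosh (l 1 3)) (cosh (l 0 3)).
have q3 := face_disc_perm (cosh (l 0 1)) (cosh (l 1 2)) (cosh (l 0 2)).
apply: edges_ind; rewrite /tet_angle.
- rewrite e01 t01 f01; apply: (key _ _ _ _ _ _ _ _ p01 p02 p03 p12 p13 p23); first exact: erefl.
  by apply: (hex_angle hP hl _ (d1 _ _ _) (d1 _ _ _)); rewrite ?mxE /= ?q0 ?q1 ?q2 ?q3.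
- rewrite e02 t02 f02; apply: (key _ _ _ _ _ _ _ _ p02 p01 p03 p12 p23 p13); first by rewrite gp.
  by apply: (hex_angle hP hl _ (d1 _ _ _) (d1 _ _ _)); rewrite ?mxE /= ?q0 ?q1 ?q2 ?q3.
- rewrite e03 t03 f03; apply: (key _ _ _ _ _ _ _ _ p03 p01 p02 p13 p23 p12); first by rewrite gp.
  by apply: (hex_angle hP hl _ (d1 _ _ _) (d1 _ _ _)); rewrite ?mxE /= ?q0 ?q1 ?q2 ?q3.
- rewrite e12 t12 f12; apply: (key _ _ _ _ _ _ _ _ p12 p01 p13 p02 p23 p03); first by rewrite gp.
  by apply: (hex_angle hP hl _ (d1 _ _ _) (d1 _ _ _)); rewrite ?mxE /= ?q0 ?q1 ?q2 ?q3.
- rewrite e13 t13 f13; apply: (key _ _ _ _ _ _ _ _ p13 p01 p12 p03 p23 p02); first by rewrite gp.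
  by apply: (hex_angle hP hl _ (d1 _ _ _) (d1 _ _ _)); rewrite ?mxE /= ?q0 ?q1 ?q2 ?q3.
- rewrite e23 t23 f23; apply: (key _ _ _ _ _ _ _ _ p23 p02 p12 p03 p13 p01); first by rewrite gp.
  by apply: (hex_angle hP hl _ (d1 _ _ _) (d1 _ _ _)); rewrite ?mxE /= ?q0 ?q1 ?q2 ?q3.
Qed.

(** Every tetrahedron with the lengths [l] has the angles [ext_angle l], so the angle picked by
    [xget] does not depend on the choice; the default value is excluded by the given tetrahedron. *)
Lemma hyperideal_lengths_angles l : (forall i j, l i j = l j i) ->
  hyperideal_lengths l -> nondegenerate (lvec l) /\
  forall i j : 'I_4, (i < j)%N -> dihedral l i j = ext_angle l i j.
Proof.
move=> ls [P hP]; have [nd ang] := tet_lengths_angles ls hP; split => // i j ij.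
rewrite /dihedral; case: xgetP => [a _ [P' [hP' ->]]|/(_ (tet_angle P i j))].
  by have [_ ->] := tet_lengths_angles ls hP'.
by case; exists P.
Qed.

End EdgeLengths.

(** * Curvature and the flow *)

Section EdgeSums.
Variables (R : realType) (T : finType) (tri : ideal_triangulation T).
Implicit Types (s : T) (i j : 'I_4) (e : edge tri).

Lemma edge_glued_sym : symmetric (edge_glued (nbr tri) (gperm tri)).
Proof.
suff imp x y : edge_glued (nbr tri) (gperm tri) x y -> edge_glued (nbr tri) (gperm tri) y x.
  by move=> x y; apply/idP/idP; exact: imp.
move: x => [[s i] j] /existsP[k /and3P[/= ki kj /eqP ->]].
apply/existsP; exists (gperm tri s k k) => /=.
by rewrite !(inj_eq perm_inj) ki kj nbrK gpermV !permK eqxx.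
Qed.

Lemma unoriented_edge_glued_sym : symmetric (unoriented_edge_glued (nbr tri) (gperm tri)).
Proof.
move=> x y; rewrite /unoriented_edge_glued edge_glued_sym; congr (_ || _).
by case: x y => [[s i] j] [[s' i'] j'] /=; apply/eqP/eqP => -[-> -> ->].
Qed.

Lemma edge_classC s i j : edge_class tri s i j = edge_class tri s j i.
Proof.
apply/setP => y; rewrite !inE; apply: same_connect.
  exact: sym_connect_sym unoriented_edge_glued_sym.
by apply: connect1; rewrite /unoriented_edge_glued /= eqxx orbT.
Qed.

Lemma tet_restrictC (l : edge tri -> R) s i j : tet_restrict l s i j = tet_restrict l s j i.
Proof. by rewrite /tet_restrict edge_classC. Qed.

Lemma tet_restrictB (l m : edge tri -> R) s i j :
  tet_restrict (fun e => l e - m e) s i j = tet_restrict l s i j - tet_restrict m s i j.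
Proof. by rewrite /tet_restrict; case: insub => [//|]; rewrite subr0. Qed.

Lemma tet_restrict_sqr (l : edge tri -> R) s i j :
  tet_restrict (fun e => l e ^+ 2) s i j = tet_restrict l s i j ^+ 2.
Proof. by rewrite /tet_restrict; case: insub => [//|]; rewrite expr0n. Qed.

Lemma tet_restrict_sum (l : edge tri -> R) s i j :
  \sum_(e | edge_class tri s i j == val e) l e = tet_restrict l s i j.
Proof.
rewrite /tet_restrict; case: insubP => [e _ <-|no].
  by rewrite (big_pred1 e) // => e'; rewrite /= eq_sym (inj_eq val_inj).
by rewrite big_pred0 // => e; apply/negP => /eqP h; rewrite h (valP e) in no.
Qed.

(** Double counting of the pairs formed by a tetrahedron edge and its class: a pairing on the edges
    of the triangulation splits into one pairing per tetrahedron. *)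
Lemma sum_edge_tet (l : edge tri -> R) (f : T -> 'I_4 -> 'I_4 -> R) :
  \sum_e l e * (\sum_s \sum_(i < 4)
    \sum_(j < 4 | (i < j)%N && (edge_class tri s i j == val e)) f s i j) =
  \sum_s sum_edges (fun i j => tet_restrict l s i j * f s i j).
Proof.
under eq_bigr => e _ do rewrite big_distrr /=.
rewrite exchange_big /=; apply: eq_bigr => s _.
under eq_bigr => e _ do rewrite big_distrr /=.
rewrite exchange_big /=; apply: eq_bigr => i _.
under eq_bigr => e _ do rewrite big_distrr /= big_mkcondr /=.
rewrite exchange_big /=; apply: eq_bigr => j _.
by rewrite -tet_restrict_sum big_distrl /= [RHS]big_mkcond.
Qed.

Lemma edge_in_tet e : exists s i j, (i < j)%N /\ edge_class tri s i j = val e.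
Proof.
have /imsetP[[[s i] j] /=] := valP e; rewrite inE /= => ij ->.
have [lt|gt|eq] := ltngtP i j; first by exists s, i, j.
  by exists s, j, i; rewrite edge_classC.
by move: ij; rewrite (val_inj eq) eqxx.
Qed.

(** Every class contains an edge of some tetrahedron, so each square on the left occurs at least
    once on the right. *)
Lemma sum_edges_sqr (l : edge tri -> R) :
  \sum_e l e ^+ 2 <= \sum_s sum_edges (fun i j => tet_restrict l s i j ^+ 2).
Proof.
have -> : \sum_s sum_edges (fun i j => tet_restrict l s i j ^+ 2) =
    \sum_s sum_edges (fun i j => tet_restrict (fun e => l e ^+ 2) s i j * 1).
  apply: eq_bigr => s _; apply: eq_bigr => i _; apply: eq_bigr => j _.
  by rewrite mulr1 tet_restrict_sqr.
rewrite -sum_edge_tet; apply: ler_sum => e _.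
rewrite -[leLHS]mulr1; apply: ler_wpM2l; first exact: sqr_ge0.
have [s [i [j [ij ce]]]] := edge_in_tet e.
rewrite (bigD1 s) //= (bigD1 i) //= (bigD1 j) /=; last by rewrite ij ce eqxx.
rewrite -!addrA lerDl; apply: addr_ge0; first exact: sumr_ge0.
by apply: addr_ge0; apply: sumr_ge0 => i' _; last apply: sumr_ge0 => j' _; exact: sumr_ge0.
Qed.

Lemma tet_restrict_le (l : edge tri -> R) s i j :
  tet_restrict l s i j ^+ 2 <= \sum_e l e ^+ 2.
Proof.
have sq (P : pred (edge tri)) : 0 <= \sum_(e | P e) l e ^+ 2.
  by apply: sumr_ge0 => *; exact: sqr_ge0.
rewrite /tet_restrict; case: insub => [e|]; last by rewrite expr0n sq.
by rewrite (bigD1 e) //= lerDl sq.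
Qed.

Lemma ext_angle_sum_pairing (d l : edge tri -> R) :
  \sum_e d e * angle_sum (@ext_angle R) l e =
  \sum_s angdot (lvec (tet_restrict l s)) (lvec (tet_restrict d s)).
Proof.
rewrite /angle_sum (sum_edge_tet d (fun s => ext_angle (tet_restrict l s))).
apply: eq_bigr => s _; rewrite -sum_edges_angdot; last exact: tet_restrictC.
by apply: eq_bigr => i _; apply: eq_bigr => j _; rewrite mulrC.
Qed.

End EdgeSums.

Section Metric.
Variables (R : realType) (T : finType) (tri : ideal_triangulation T).
Variable m : edge tri -> R.
Hypothesis m_metric : hyperideal_metric m.

Let x s := lvec (tet_restrict m s).

Lemma metric_nondegenerate s : nondegenerate (x s).
Proof.
have [_ hm] := m_metric.
by have [] := hyperideal_lengths_angles (tet_restrictC m s) (hm s).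
Qed.

Lemma metric_curvature e : ext_curvature m e = curvature m e.
Proof.
have [_ hm] := m_metric.
rewrite /ext_curvature /curvature /angle_sum; congr (_ - _).
apply: eq_bigr => s _; apply: eq_bigr => i _; apply: eq_bigr => j /andP[ij _].
by have [_ ->] := hyperideal_lengths_angles (tet_restrictC m s) (hm s).
Qed.

(** Angles enter the curvature with a minus sign, so this is minus the pairing of [l - m] with the
    difference of the extended curvatures. When [m] has zero curvature, the squared distance to [m]
    has derivative [- 2] times it along the flow. *)
Definition curvature_pairing (l : edge tri -> R) : R :=
  \sum_e (l e - m e) * (angle_sum (@ext_angle R) l e - angle_sum (@ext_angle R) m e).

Lemma curvature_pairingE l : curvature_pairing l =
  \sum_s (angdot (lvec (tet_restrict l s)) (lvec (tet_restrict l s) - x s)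
          - angdot (x s) (lvec (tet_restrict l s) - x s)).
Proof.
have dE s : lvec (tet_restrict l s) - x s = lvec (tet_restrict (fun e => l e - m e) s).
  by rewrite -lvecB; congr lvec; apply/funext => i; apply/funext => j; rewrite tet_restrictB.
under [RHS]eq_bigr => s _ do rewrite dE.
rewrite sumrB -!ext_angle_sum_pairing -sumrB.
by apply: eq_bigr => e _; rewrite mulrBr.
Qed.

Lemma curvature_pairing_ge0 l : 0 <= curvature_pairing l.
Proof.
rewrite curvature_pairingE; apply: sumr_ge0 => s _; rewrite subr_ge0.
by apply: angdot_monotone; have [] := metric_nondegenerate s.
Qed.

Lemma curvature_pairing_bound (B : R) : 0 <= B -> exists2 c, 0 < c &
  forall l, \sum_e (l e - m e) ^+ 2 <= B ->
    c * (\sum_e (l e - m e) ^+ 2) <= curvature_pairing l.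
Proof.
(* Each of the six edges of a tetrahedron contributes at most [B]; the summand 1 keeps [r] positive
   when [B] is 0. *)
move=> B0; pose r := Num.sqrt (6 * B + 1).
have r0 : 0 < r by rewrite sqrtr_gt0; lra.
have r2 : r ^+ 2 = 6 * B + 1 by rewrite sqr_sqrtr //; lra.
have /choice[c hc] : forall s, exists c, 0 < c /\ forall z, sqnorm (z - x s) <= r ^+ 2 ->
    c * sqnorm (z - x s) <= angdot z (z - x s) - angdot (x s) (z - x s).
  move=> s; have [c c0 h] := angdot_strongly_monotone (metric_nondegenerate s) r0.
  by exists c.
(* The base value 1 keeps the minimum positive even if there is no tetrahedron. *)
pose c0 := \big[Num.min/1]_s c s.
have c00 : 0 < c0 by apply: lt_bigmin => // s _; have [] := hc s.
have c0s s : c0 <= c s by exact: bigmin_le.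
exists c0 => // l lB.
have dE s : sqnorm (lvec (tet_restrict l s) - x s) =
    sum_edges (fun i j => tet_restrict (fun e => l e - m e) s i j ^+ 2).
  rewrite -lvecB sqnorm_lvec; congr sum_edges.
  by apply/funext => i; apply/funext => j; rewrite tet_restrictB.
have small s : sqnorm (lvec (tet_restrict l s) - x s) <= r ^+ 2.
  rewrite dE sum_edgesE r2.
  have le i j := le_trans (tet_restrict_le (fun e => l e - m e) s i j) lB.
  move: (le 0 1) (le 0 2) (le 0 3) (le 1 2) (le 1 3) (le 2 3) => /= *; lra.
rewrite curvature_pairingE.
apply: (@le_trans _ _ (\sum_s c0 * sqnorm (lvec (tet_restrict l s) - x s))).
  rewrite -mulr_sumr ler_pM2l //; apply: le_trans (sum_edges_sqr _) _.
  by rewrite le_eqVlt; apply/orP; left; apply/eqP; apply: eq_bigr => s _; rewrite dE.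
apply: ler_sum => s _; apply: le_trans ((hc s).2 _ (small s)).
by rewrite ler_wpM2r // sqnorm_ge0.
Qed.

End Metric.

(** * One-sided derivatives and exponential decay *)

Section Decay.
Variable R : realType.

Lemma is_derive_one_sided (f : R -> R) (t d : R) : 0 < t ->
  (f s - f t) / (s - t) @[s --> within `[0, +oo[ t^'] --> d -> is_derive t 1 f d.
Proof.
move=> t0 ft.
have ct : h^-1 *: (f (h *: 1 + t) - f t) @[h --> 0^'] --> d.
  have ht : (fun h : R => h + t) @ 0^' --> within `[0, +oo[%classic t^'.
    move=> A At.
    have {}At : nbhs t (fun s => s != t -> s \in `[0, +oo[ -> A s) by exact: At.
    have [r /= r0 hr] := (nbhs_ballP _ _).1 At.
    suff : nbhs (0 : R) (fun h => h != 0 -> A (h + t)) by [].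
    (* A radius at most [t] keeps [h + t] inside the half-line, where the one-sided limit speaks. *)
    apply/nbhs_ballP; exists (Num.min r t); first by rewrite /= lt_min r0.
    move=> h; rewrite /ball /= sub0r normrN lt_min => /andP[hr1 ht1] h0.
    apply: hr; first by rewrite /ball /= opprD addrC subrK normrN.
      by rewrite -subr_eq0 addrK.
    rewrite in_itv /= andbT; move: ht1; rewrite ltr_norml => /andP[]; lra.
  have := cvg_comp _ _ ht ft; apply: cvg_trans; apply: near_eq_cvg.
  near=> h; rewrite /= /GRing.scale /= mulr1 addrK mulrC.
  by [].
have dt : derivable f t 1 by apply/cvg_ex; exists d.
by apply: DeriveDef => //; exact: cvg_lim ct.
Unshelve. all: by end_near. Qed.

Lemma right_continuous_one_sided (f : R -> R) (d : R) :
  (f s - f 0) / (s - 0) @[s --> within `[0, +oo[ (0 : R)^'] --> d ->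
  f s @[s --> (0 : R)^'+] --> f 0.
Proof.
move=> f0.
have sub : (0 : R)^'+ `=>` within `[(0 : R), +oo[%classic (0 : R)^'.
  move=> A A0.
  have {}A0 : nbhs (0 : R) (fun s => s != 0 -> s \in `[0, +oo[ -> A s) by exact: A0.
  suff : nbhs (0 : R) (fun s => 0 < s -> A s) by [].
  by apply: filterS A0 => s As s0; apply: As; rewrite ?gt_eqF // in_itv /= andbT ltW.
have q0 : (f s - f 0) / (s - 0) @[s --> (0 : R)^'+] --> d by move=> A /f0 hA; exact: sub.
have i0 : s @[s --> (0 : R)^'+] --> (0 : R).
  move=> A A0; suff : nbhs (0 : R) (fun s => 0 < s -> A s) by [].
  by apply: filterS A0 => s As _.
have fE : (fun s => (f s - f 0) / (s - 0) * s + f 0) = f.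
  apply/funext => s; have [->|s0] := eqVneq s 0; first by rewrite mulr0 add0r.
  by rewrite subr0 divfK // subrK.
have Fp : Filter (0 : R)^'+ by exact: at_right_proper_filter.
have := cvg_add (FF := Fp) (cvg_mul (FF := Fp) q0 i0) (@cvg_cst _ (f 0) _ (0 : R)^'+ Fp).
by rewrite /cst fE mulr0 add0r.
Qed.

(** Gronwall: [G s * expR (c * s)] has nonpositive derivative for [s > 0]. Right continuity at 0
    lets the mean value theorem start at 0, where only a one-sided derivative is at hand. *)
Lemma exponential_decay (G dG : R -> R) (c : R) :
  (forall t : R, 0 < t -> is_derive t 1 G (dG t)) -> G s @[s --> (0 : R)^'+] --> G 0 ->
  (forall t, 0 < t -> dG t <= - c * G t) ->
  forall t, 0 <= t -> G t <= G 0 * expR (- (c * t)).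
Proof.
move=> dE G0 dle t; rewrite le_eqVlt => /predU1P[<-|t0].
  by rewrite mulr0 oppr0 expR0 mulr1.
pose F s := G s * expR (c * s).
have dexp (s : R) : is_derive s 1 (fun s => expR (c * s)) (c * expR (c * s)).
  have dl : is_derive s 1 (fun s => c * s) c.
    by apply: is_derive_eq; rewrite /GRing.scale /= mulr1; ring.
  apply: (is_derive_eq (@is_derive1_comp _ (@expR R) (fun s => c * s) s _ _ (is_derive_expR _) dl)).
  exact: mulrC.
have dF (s : R) : 0 < s -> is_derive s 1 F (G s * (c * expR (c * s)) + expR (c * s) * dG s).
  by move=> s0; exact: (is_derive_mul (dE s s0) (dexp s)).
have cF (s : R) : 0 < s -> {for s, continuous F}.
  move=> /dF[d _]; exact: (differentiable_continuous ((@derivable1_diffP _ _ _ s).1 d)).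
have cF0 : F s @[s --> (0 : R)^'+] --> F 0.
  apply: cvgM => //; apply: cvg_within_filter.
  have [d _] := dexp 0.
  exact: (differentiable_continuous ((@derivable1_diffP _ _ _ 0).1 d)).
have cF_ : {within `[0, t], continuous F}.
  apply/(continuous_within_itvP _ t0); split=> //.
    by move=> s; rewrite in_itv /= => /andP[s0 _]; exact: cF.
  by apply: cvg_at_left_filter; exact: cF.
have [s] := MVT t0 (fun s hs => dF s (ltac:(by move: hs; rewrite in_itv /= => /andP[]))) cF_.
rewrite in_itv /= => /andP[s0 _] e.
have le : F t <= F 0.
  rewrite -subr_le0 e pmulr_lle0 ?subr_gt0 //.
  have -> : G s * (c * expR (c * s)) + expR (c * s) * dG s =
      expR (c * s) * (c * G s + dG s) by ring.
  by rewrite pmulr_rle0 ?expR_gt0 //; have := dle s s0; lra.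
rewrite expRN -ler_pdivrMr ?invr_gt0 ?expR_gt0 // invrK.
by move: le; rewrite /F mulr0 expR0 mulr1.
Qed.

Lemma is_derive_bigsum (I : Type) (r : seq I) (f : I -> R -> R) (df : I -> R) (t : R) :
  (forall i, is_derive t 1 (f i) (df i)) ->
  is_derive t 1 (fun s => \sum_(i <- r) f i s) (\sum_(i <- r) df i).
Proof.
move=> h; elim: r => [|i r IH].
  under eq_fun do rewrite big_nil.
  rewrite big_nil; exact: is_derive_cst.
under eq_fun do rewrite big_cons.
by rewrite big_cons; exact: is_deriveD.
Qed.

Lemma cvg_bigsum (I : Type) (r : seq I) (T : Type) (F : set_system T) {FF : Filter F}
    (f : I -> T -> R) (a : I -> R) : (forall i, f i @ F --> a i) ->
  (fun s => \sum_(i <- r) f i s) @ F --> \sum_(i <- r) a i.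
Proof.
move=> h; elim: r => [|i r IH].
  under eq_fun do rewrite big_nil.
  rewrite big_nil; exact: cvg_cst.
under eq_fun do rewrite big_cons.
by rewrite big_cons; exact: cvgD.
Qed.

End Decay.

Theorem theorem1p2 (R : realType) (T : finType) (tri : ideal_triangulation T)
    (neg : negative_boundary tri)
    (lstar : edge tri -> R) (lstar_metric : hyperideal_metric lstar)
    (lstar_flat : forall e : edge tri, curvature lstar e = 0)
    (l0 : edge tri -> R) (l0_metric : hyperideal_metric l0)
    (l : R -> edge tri -> R) (l_init : l 0 = l0)
    (l_flow : extended_ricci_flow l) :
  exists C c : R, [/\ 0 < C, 0 < c &
    forall t : R, 0 <= t ->
      edge_norm (fun e : edge tri => l t e - lstar e) <= C * expR (- (c * t))].
Proof.
pose G t := \sum_e (l t e - lstar e) ^+ 2.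
have dG (t : R) : 0 < t -> is_derive t 1 G (- 2 * curvature_pairing lstar (l t)).
  move=> t0; have dl e := is_derive_one_sided t0 (l_flow t (ltW t0) e).
  have dsq e : is_derive t 1 (fun s => (l s e - lstar e) ^+ 2)
      (2 * (l t e - lstar e) * ext_curvature (l t) e).
    have d1 := dl e; apply: is_derive_eq; rewrite /GRing.scale /=; ring.
  apply: (is_derive_eq (is_derive_bigsum (index_enum _) dsq)).
  rewrite /curvature_pairing big_distrr /=; apply: eq_bigr => e _.
  have := lstar_flat e; rewrite -metric_curvature // /ext_curvature => fl.
  (* Zero curvature of [lstar] says that its angle sums are [2 * pi], which turns the velocity into
     a difference of angle sums. *)
  have -> : 2 * pi - angle_sum (@ext_angle R) (l t) e =
      angle_sum (@ext_angle R) lstar e - angle_sum (@ext_angle R) (l t) e by lra.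
  ring.
have G0 : G s @[s --> (0 : R)^'+] --> G 0.
  apply: cvg_bigsum => e.
  have le := right_continuous_one_sided (l_flow 0 (lexx 0) e).
  by apply: cvg_sqr; apply: cvgB => //; exact: cvg_cst.
have G_ge0 t : 0 <= G t by apply: sumr_ge0 => *; exact: sqr_ge0.
(* The rate 0 comes first: it confines the flow to the ball of squared radius [G 0], on which a
   positive rate can then be chosen. *)
have Gle t : 0 <= t -> G t <= G 0.
  move=> t0.
  have h0 s : 0 < s -> - 2 * curvature_pairing lstar (l s) <= - 0 * G s.
    move=> _; rewrite oppr0 mul0r mulNr oppr_le0 mulr_ge0 //.
    exact: curvature_pairing_ge0.
  by have := exponential_decay dG G0 h0 t0; rewrite mul0r oppr0 expR0 mulr1.
have [c c0 hc] := curvature_pairing_bound lstar_metric (G_ge0 0).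
(* The summand 1 keeps the constant positive when the flow starts at [lstar]. *)
exists (Num.sqrt (G 0) + 1), c; split; [by have := sqrtr_ge0 (G 0); lra | exact: c0 |].
move=> t t0; rewrite /edge_norm -/(G t).
(* The squared distance decays at the rate [2 * c]; the square root halves it. *)
have le : G t <= G 0 * expR (- (2 * c * t)).
  apply: (exponential_decay dG G0) => // s s0.
  by have := hc (l s) (Gle s (ltW s0)); rewrite -/(G s); lra.
apply: (@le_trans _ _ (Num.sqrt (G 0) * expR (- (c * t)))); last first.
  by rewrite ler_pM2r ?expR_gt0 // lerDl.
rewrite -[leRHS]ger0_norm ?mulr_ge0 ?sqrtr_ge0 ?expR_ge0 // -sqrtr_sqr ler_wsqrtr //.
rewrite exprMn sqr_sqrtr // -expRM_natl; apply: le_trans le _.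
by rewrite (_ : - (2 * c * t) = 2 * - (c * t)) //; ring.
Qed.
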